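(* Let $\psi$ be a $C^1$ wavelet ($\{\psi_I:I\in\mathcal{D}\}$ an orthonormal basis of $L^2(\mathbb{R})$) with $|\psi(x)|+|\psi'(x)|\leq C(1+|x|)^{-1-\varepsilon}$ for all $x$ and some $C,\varepsilon>0$, and let $\{a_I:I\in\mathcal{D}\}$ be independent random variables with $\sum_I\mathscr{E}|a_I|<\infty$ and $a_I\in\mathscr{G}(\nu)$ for all $I$, for some $\nu>0$. Let $Tf(x,\omega)=\sum_{I\in\mathcal{D}}a_I(\omega)\langle f,\psi_I\rangle\psi_I(x)$ for $f\in L^2(\mathbb{R})$. Then for each $1<p<\infty$ there is $C_p$ with $$\Big(\int_{\mathbb{R}}\|Tf(x,\cdot)\|^p_{L^2(\Omega,d\mathscr{P})}\,dx\Big)^{1/p}\leq C_p\|f\|_{L^p(\mathbb{R})}\quad\text{for all } f\in L^2(\mathbb{R})\cap L^p(\mathbb{R}),$$ so $T$ extends to a bounded operator from $L^p(\mathbb{R},dx)$ to $L^p(L^2(\Omega,d\mathscr{P});dx)$; moreover there is $C$ such that for all $t>0$ and $f\in L^1(\mathbb{R})\cap L^2(\mathbb{R})$, $$\big|\{x\in\mathbb{R}:\|Tf(x,\cdot)\|_{L^2(\Omega,d\mathscr{P})}>t\}\big|\leq\frac{C}{t}\|f\|_{L^1(\mathbb{R})}.$$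
   Context: $\mathcal{D}=\bigcup_{j\in\mathbb{Z}}\{[k2^{-j},(k+1)2^{-j}):k\in\mathbb{Z}\}$ is the family of dyadic intervals of $\mathbb{R}$; for $I=[k2^{-j},(k+1)2^{-j})$, $\psi_I(x)=2^{j/2}\psi(2^jx-k)$. $|E|$ denotes Lebesgue measure. For an integrable random variable $X$, $\eta_{X-\mathscr{E}X}(\lambda)=\log \mathscr{E}e^{\lambda(X-\mathscr{E}X)}$, and $X\in\mathscr{G}(\nu)$ means $X$ is integrable and $\eta_{X-\mathscr{E}X}(\lambda)\leq \lambda^2\nu/2$ for all $\lambda\in\mathbb{R}$. *)

(* Defs.v *)
From HB Require Import structures.
From mathcomp Require Import all_boot all_order all_algebra.
From mathcomp Require Import all_classical all_reals all_analysis.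
Set Implicit Arguments. Unset Strict Implicit. Unset Printing Implicit Defensive.
Import Order.TTheory GRing.Theory Num.Theory.
Import numFieldNormedType.Exports.
Local Open Scope classical_set_scope.
Local Open Scope ring_scope.

(* A dyadic interval I = [k 2^-j, (k+1) 2^-j) is encoded by the pair (j, k). *)
Definition dyadic := (int * int)%type.

Definition psiI {R : realType} (psi : R -> R) (I : dyadic) (x : R) : R :=
  (2 : R) `^ (I.1%:~R / 2) * psi ((2 : R) `^ (I.1%:~R) * x - I.2%:~R).

Definition inLp {R : realType} (p : R) (f : R -> R) : Prop :=
  measurable_fun setT f /\
  ('N[@lebesgue_measure R]_(p%:E)[EFin \o f] < +oo)%E.

Definition inner {R : realType} (f g : R -> R) : R :=
  fine (\int[@lebesgue_measure R]_x (f x * g x)%:E)%E.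

Definition C1 {R : realType} (psi : R -> R) : Prop :=
  (forall x, derivable psi x 1) /\ continuous (derive1 psi).

Definition wavelet_ONB {R : realType} (psi : R -> R) : Prop :=
  (forall I, inLp 2 (psiI psi I)) /\
  (forall I J, inner (psiI psi I) (psiI psi J) = (I == J)%:R) /\
  (forall f, inLp 2 f -> (forall I, inner f (psiI psi I) = 0) ->
     {ae @lebesgue_measure R, forall x, f x = 0}).

Definition mutually_independent {d} {T : measurableType d} {R : realType}
  (P : probability T R) {I : eqType} (a : I -> T -> R) : Prop :=
  (forall i, measurable_fun setT (a i)) /\
  forall (s : seq I) (B : I -> set R), uniq s ->
    (forall i, measurable (B i)) ->
    P (\bigcap_(i in [set` s]) (a i @^-1` B i)) =
      (\prod_(i <- s) P (a i @^-1` B i))%E.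

Definition sub_gaussian {d} {T : measurableType d} {R : realType}
  (P : probability T R) (nu : R) (X : T -> R) : Prop :=
  P.-integrable setT (EFin \o X) /\
  forall lam : R,
    let M := ('E_P[fun w => expR (lam * (X w - fine 'E_P[X]))])%E in
    (M < +oo)%E /\ ln (fine M) <= lam ^+ 2 * nu / 2.

Definition window (N : nat) : seq int :=
  [seq (i%:Z - N%:Z) | i <- iota 0 (N.*2.+1)].

Definition Tpartial {d} {T : measurableType d} {R : realType}
  (a : dyadic -> T -> R) (psi : R -> R) (f : R -> R) (N : nat)
  (x : R) (w : T) : R :=
  \sum_(j <- window N) \sum_(k <- window N)
     a (j, k) w * inner f (psiI psi (j, k)) * psiI psi (j, k) x.

(* G is (a jointly measurable version of) Tf, i.e. of the series
   sum_I a_I(w) <f, psi_I> psi_I(x), the series converging in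
   L^2(R x Omega, dx dP). *)
Definition is_Tf {d} {T : measurableType d} {R : realType}
  (P : probability T R) (a : dyadic -> T -> R) (psi : R -> R) (f : R -> R)
  (G : R -> T -> R) : Prop :=
  measurable_fun setT (fun z : R * T => G z.1 z.2) /\
  ((fun N : nat => \int[@lebesgue_measure R]_x \int[P]_w
      ((G x w - Tpartial a psi f N x w) ^+ 2)%:E) @ \oo --> 0)%E.

(* Main.v *)
(* For fixed x the independence of the a_I makes the centred coefficients
   orthogonal in L^2(Omega), so that, with c_I = <f, psi_I>,
     ||Tf(x)||^2 <= C (sum E|a_I| |c_I psi_I(x)|)^2 + C sum Var(a_I) (c_I psi_I(x))^2.
   The first sum is bounded on every L^p because the rank one operators
   f |-> c_I psi_I are uniformly bounded on L^p and the E|a_I| are summable.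
   In the second one the variances are bounded, so it is dominated by the square
   function, which is bounded on L^2 by Bessel's inequality and of weak type (1,1)
   by a Calderon-Zygmund decomposition; Marcinkiewicz interpolation gives 1 < p < 2.
   For p > 2 the sub-Gaussian moments and Hoelder's inequality give
   Var(a_I)^q <= C E|a_I| with q = (p/2)/(p/2 - 1), and Hoelder's inequality over I
   reduces the claim to sum |c_I|^p ||psi_I||_p^p <= C ||f||_p^p, which follows by
   interpolation between Bessel's inequality and the bound of c_I by ||f||_oo. *)
Require Import Defs.
From HB Require Import structures.
From mathcomp Require Import all_boot all_order all_algebra.
From mathcomp Require Import all_classical all_reals all_analysis.
From mathcomp Require Import measurable_realfun lebesgue_Rintegral lebesgue_integral_fubini.
From mathcomp Require Import ring lra zify.
Import Order.TTheory GRing.Theory Num.Theory.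
Import numFieldNormedType.Exports.
Local Open Scope classical_set_scope.
Local Open Scope ring_scope.

(** Every estimate is proved for finite families of wavelets with constants that do not depend on
    the family; the limit is taken only at the end. To make that limit painless the random sum is
    compared with a deterministic [majorant], nondecreasing in the truncation because all its terms
    are nonnegative. Convergence in L^2(dx dP) then enters only through the infimum over N of the
    errors, which vanishes almost everywhere, so no subsequence is extracted. The kernel regularity
    behind the weak type bound is proved with absolute values inside the sum over I (an l^1 rather
    than an l^2 condition), which keeps it scalar. The assumed decay exponent 1 + eps is written as
    1 + 2d: one d pays for the distance between the two points of the kernel, the other keeps the
    weights integrable and summable. The Calderon-Zygmund decomposition is a recursion of finite
    depth instead of a family of maximal intervals. Unstopped intervals leave an error proportional
    to the mesh, with a factor depending on the finite family; the depth is chosen after the family,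
    so this factor does not survive in the constant. *)

Section RealIntegrals.
Context {d} {T : measurableType d} {R : realType} (mu : {measure set T -> \bar R}).

Lemma ge0_integralZ (D : set T) (f : T -> R) (k : R) : 0 <= k -> measurable D ->
  measurable_fun D f -> (forall x, 0 <= f x) ->
  (\int[mu]_(x in D) (k * f x)%:E = k%:E * \int[mu]_(x in D) (f x)%:E)%E.
Proof.
move=> k0 mD mf f0; under eq_integral do rewrite EFinM.
by apply: ge0_integralZl_EFin => // [x _|]; [rewrite lee_fin|exact/measurable_EFinP].
Qed.

Lemma ge0_le_integral_EFin (D : set T) (f g : T -> R) : measurable D ->
  measurable_fun D f -> measurable_fun D g -> (forall x, 0 <= f x) ->
  (forall x, D x -> f x <= g x) ->
  (\int[mu]_(x in D) (f x)%:E <= \int[mu]_(x in D) (g x)%:E)%E.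
Proof.
move=> mD mf mg f0 fg; apply: ge0_le_integral => //.
- by move=> x _; rewrite lee_fin.
- exact/measurable_EFinP.
- exact/measurable_EFinP.
Qed.

Lemma ge0_integralD_EFin (D : set T) (f g : T -> R) : measurable D ->
  measurable_fun D f -> measurable_fun D g ->
  (forall x, 0 <= f x) -> (forall x, 0 <= g x) ->
  (\int[mu]_(x in D) (f x + g x)%:E
   = \int[mu]_(x in D) (f x)%:E + \int[mu]_(x in D) (g x)%:E)%E.
Proof.
move=> mD mf mg f0 g0; under eq_integral do rewrite EFinD.
apply: ge0_integralD => //.
- by move=> x _; rewrite lee_fin.
- exact/measurable_EFinP.
- by move=> x _; rewrite lee_fin.
- exact/measurable_EFinP.
Qed.

Lemma ge0_integral_sum_EFin (I : Type) (s : seq I) (D : set T) (f : I -> T -> R) :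
  measurable D -> (forall i, measurable_fun D (f i)) -> (forall i x, 0 <= f i x) ->
  (\int[mu]_(x in D) (\sum_(i <- s) f i x)%:E
   = \sum_(i <- s) \int[mu]_(x in D) (f i x)%:E)%E.
Proof.
move=> mD mf f0; under eq_integral do rewrite -sumEFin.
apply: ge0_integral_sum => //.
- by move=> i; exact/measurable_EFinP.
- by move=> i x _; rewrite lee_fin.
Qed.

End RealIntegrals.

(** * Finite sums over dyadic scales *)

Section FiniteSums.
Context {R : realType}.

Lemma ler_sum_uniq (T : eqType) (s t : seq T) (F : T -> R) :
  uniq s -> {subset s <= t} -> (forall i, 0 <= F i) ->
  \sum_(i <- s) F i <= \sum_(i <- t) F i.
Proof.
elim: s t => [|x s IH] t /=.
  by move=> _ _ F0; rewrite big_nil sumr_ge0.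
move=> /andP[xs us] st F0.
have xt : x \in t by apply: st; rewrite inE eqxx.
rewrite big_cons (perm_big _ (perm_to_rem xt)) big_cons lerD2l.
apply: IH => // y ys.
have : y \in t by apply: st; rewrite inE ys orbT.
rewrite (perm_mem (perm_to_rem xt)) inE => /orP[/eqP yx|//].
by move: xs; rewrite -yx ys.
Qed.

Lemma sum_geo_le (q : R) (s : seq nat) : 0 <= q < 1 -> uniq s ->
  \sum_(i <- s) q ^+ i <= (1 - q)^-1.
Proof.
move=> /andP[q0 q1] us.
have q1' : 0 < 1 - q by rewrite subr_gt0.
(* Distinct exponents lie in the initial segment ending at their maximum, where the closed formula
   applies. *)
have sN : {subset s <= iota 0 (\max_(i <- s) i).+1}.
  by move=> i si; rewrite mem_iota leq0n add0n ltnS /=; exact: leq_bigmax_seq.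
apply: (le_trans (ler_sum_uniq _ _ _ _ us sN _)); first by move=> i; rewrite exprn_ge0.
rewrite -{1}[_.+1]subn0 -/(index_iota 0 _) big_mkord -[leRHS]mul1r ler_pdivlMr//.
have := subrX1 q (\max_(i <- s) i).+1; set S := \sum_(_ < _) _ => e.
have : 0 <= q ^+ (\max_(i <- s) i).+1 by rewrite exprn_ge0.
by move: e; set z := q ^+ _ => e; nra.
Qed.

Lemma pow2_gt1 (s : R) : 0 < s -> 1 < 2 `^ s.
Proof.
move=> s0; have := @gt0_ltr_powR R s s0 1 2; rewrite powR1; apply; rewrite ?nnegrE//.
by rewrite ltr1n.
Qed.

Lemma pow2N_lt1 (s : R) : 0 < s -> 2 `^ (- s) < 1.
Proof. by move=> s0; rewrite powRN invf_lt1 ?powR_gt0// pow2_gt1. Qed.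

(** The full geometric series of ratio 2^(-s): the price of summing a power over all dyadic scales
    on one side of a threshold. *)
Definition geoc (s : R) : R := (1 - 2 `^ (- s))^-1.

Lemma geoc_gt0 (s : R) : 0 < s -> 0 < geoc s.
Proof.
by move=> s0; rewrite invr_gt0 subr_gt0 pow2N_lt1.
Qed.

(** The largest admissible scale 2^m dominates: the other scales are 2^(m-i) with distinct i >= 0,
    so the sum is 2^(ms) times a geometric one. *)
Lemma sum_dyadic_le (s y : R) (J : seq int) : 0 < s -> 0 < y -> uniq J ->
  \sum_(j <- J | 2 `^ j%:~R <= y) (2 `^ j%:~R) `^ s <= geoc s * y `^ s.
Proof.
move=> s0 y0 uJ.
rewrite -big_filter.
set J' := [seq i <- J | _].
have uJ' : uniq J' by rewrite filter_uniq.
have [J0|J0] := eqVneq J' [::].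
  by rewrite J0 big_nil mulr_ge0 ?powR_ge0// ltW// geoc_gt0.
have [m mJ mmax] : exists2 m, m \in J' & forall j, j \in J' -> j <= m.
  case: J' J0 uJ' => // a l _ _.
  elim: l a => [|b l IH] a; first by exists a; rewrite ?inE// => j; rewrite inE => /eqP->.
  have [m mbl mmax] := IH b.
  have [am|am] := leP a m.
    exists m; first by rewrite inE mbl orbT.
    by move=> j; rewrite inE => /orP[/eqP->//|]; exact: mmax.
  exists a; first by rewrite inE eqxx.
  move=> j; rewrite inE => /orP[/eqP->//|/mmax jm]; exact: (le_trans jm (ltW am)).
have my : 2 `^ m%:~R <= y by move: mJ; rewrite mem_filter => /andP[].
(* Reindexing by the distance i = m - j to the largest scale. *)
have -> : \sum_(j <- J') (2 `^ j%:~R) `^ s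
    = (2 `^ m%:~R) `^ s * \sum_(i <- [seq `|m - j|%N | j <- J']) (2 `^ (- s)) ^+ i.
  rewrite big_map mulr_sumr; apply: eq_big_seq => j jJ.
  rewrite -powR_mulrn ?powR_ge0// -!powRrM -powRD; last by rewrite pnatr_eq0 implybT.
  congr (_ `^ _).
  have : (`|m - j|%N)%:R = (m%:~R - j%:~R :> R).
    by rewrite natr_absz ger0_norm ?subr_ge0 ?mmax// rmorphB.
  by move=> ->; ring.
rewrite mulrC; apply: ler_pM; rewrite ?powR_ge0//.
- by rewrite big_map sumr_ge0// => j _; rewrite exprn_ge0 ?powR_ge0.
- apply: sum_geo_le.
    by rewrite powR_ge0 pow2N_lt1.
  rewrite map_inj_in_uniq// => i j /mmax im /mmax jm; lia.
- by apply: ge0_ler_powR; rewrite ?nnegrE ?powR_ge0// ltW.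
Qed.

(** The mirror image of [sum_dyadic_le] under j -> -j and y -> 1/y. *)
Lemma sum_dyadic_ge (s y : R) (J : seq int) : 0 < s -> 0 < y -> uniq J ->
  \sum_(j <- J | y <= 2 `^ j%:~R) (2 `^ j%:~R) `^ (- s) <= geoc s * y `^ (- s).
Proof.
move=> s0 y0 uJ.
have h : uniq [seq - j | j <- J] by rewrite map_inj_uniq//; exact: oppr_inj.
have y0' : 0 < y^-1 by rewrite invr_gt0.
have := sum_dyadic_le _ _ _ s0 y0' h.
rewrite big_map -(powR_inv1 (ltW y0)) -powRrM mulN1r.
apply: le_trans; rewrite le_eqVlt; apply/orP; left; apply/eqP.
apply: eq_big => j; rewrite rmorphN /=.
  rewrite powRN.
  by rewrite (powR_inv1 (ltW y0)) lef_pV2// posrE ?powR_gt0.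
by rewrite -!powRrM => _; congr (_ `^ _); ring.
Qed.

Lemma powRD_gt0 (x r s : R) : 0 < x -> x `^ (r + s) = x `^ r * x `^ s.
Proof. by move=> x0; apply: powRD; apply/implyP => _; rewrite gt_eqF. Qed.

Lemma ler_powR2 (r x y : R) : 0 <= r -> 0 <= x -> x <= y -> x `^ r <= y `^ r.
Proof.
by move=> r0 x0 xy; apply: ge0_ler_powR; rewrite ?nnegrE//; exact: le_trans xy.
Qed.

End FiniteSums.

(** * Decay weights *)

Section Weight.
Context {R : realType}.
Notation mu := (@lebesgue_measure R).

Definition wt (d : R) (x : R) : R := (1 + `|x|) `^ (- (1 + d)).

Lemma wt_gt0 (d x : R) : 0 < wt d x.
Proof. by rewrite powR_gt0// ltr_wpDr. Qed.

Lemma wt_ge0 (d x : R) : 0 <= wt d x. Proof. exact: ltW (wt_gt0 d x). Qed.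

Lemma wt_le1 (d x : R) : 0 <= d -> wt d x <= 1.
Proof.
move=> d0; rewrite /wt powRN invf_le1 ?powR_gt0 ?ltr_wpDr//.
have := @ler_powR2 R (1 + d) 1 (1 + `|x|); rewrite powR1; apply; rewrite ?lerDl//; lra.
Qed.

Lemma wtN (d x : R) : wt d (- x) = wt d x. Proof. by rewrite /wt normrN. Qed.

Lemma wt_le_near (d a x y : R) : 0 <= d -> 0 < a -> 1 + `|y| <= a * (1 + `|x|) ->
  wt d x <= a `^ (1 + d) * wt d y.
Proof.
move=> d0 a0 xy; rewrite /wt !powRN.
have px : 0 < 1 + `|x| by rewrite ltr_wpDr.
have py : 0 < 1 + `|y| by rewrite ltr_wpDr.
rewrite ler_pdivlMr ?powR_gt0// mulrC ler_pdivrMr ?powR_gt0//.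
rewrite -powRM ?(ltW px) ?(ltW a0)// ler_powR2 ?(ltW py)//; lra.
Qed.

Lemma wt_near (d x y : R) : 0 <= d -> `|x - y| <= 1 -> wt d x <= 2 `^ (1 + d) * wt d y.
Proof.
move=> d0 xy; apply: wt_le_near => //.
have := ler_normB x (x - y); rewrite subKr => h.
have := normr_ge0 x; lra.
Qed.

Lemma wt_le_wt (d e x : R) : d <= e -> wt e x <= wt d x.
Proof. by move=> de; apply: ler_powR; [rewrite lerDl|lra]. Qed.

(* Half of the decay of the two factors is spent on the separation of [u] and
   [z]: [(1 + |u|)(1 + |z|) >= 1 + |u| + |z| >= s]. *)
Lemma wt_split (d s u z : R) : 0 <= d -> 0 < s -> s <= `|u - z| ->
  wt (2 * d) u * wt (2 * d) z <= s `^ (- d) * (wt d u * wt d z).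
Proof.
move=> d0 s0 suz.
have pu : 0 < 1 + `|u| by rewrite ltr_wpDr.
have pz : 0 < 1 + `|z| by rewrite ltr_wpDr.
have E x : 0 < 1 + `|x| -> wt (2 * d) x = (1 + `|x|) `^ (- d) * wt d x.
  by move=> px; rewrite /wt -powRD_gt0//; congr (_ `^ _); ring.
rewrite !E// mulrACA ler_wpM2r ?mulr_ge0 ?wt_ge0//.
rewrite -powRM ?(ltW pu) ?(ltW pz)// !powRN lef_pV2 ?posrE ?powR_gt0 ?mulr_gt0//.
rewrite ler_powR2 ?(ltW s0)//.
have := ler_normB u z; have := normr_ge0 u; have := normr_ge0 z; nra.
Qed.

Lemma measurable_wt (d : R) : measurable_fun [set: R] (wt d).
Proof.
apply: (@measurableT_comp _ _ _ _ _ _ (@powR R ^~ (- (1 + d)))).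
  exact: measurable_powR.
by apply: measurable_funD => //; exact: measurableT_comp.
Qed.

Lemma measurable_wt_affine (d a b : R) : measurable_fun [set: R] (fun x => wt d (a * x - b)).
Proof.
apply: (measurableT_comp (measurable_wt d)).
by apply: measurable_funB => //; exact: measurable_funM.
Qed.

(** Bounds the integral of [wt d]: the ball of radius 2^(i+1) has length 4 * 2^i, and the weight on
    the i-th shell is at most 2^(-(1+d)i), which leaves 4 times the series of ratio 2^(-d). *)
Definition wtc (d : R) : R := 4 * geoc d.

Lemma wtc_gt0 (d : R) : 0 < d -> 0 < wtc d.
Proof. by move=> d0; rewrite mulr_gt0// geoc_gt0. Qed.

(** One term suffices: if 2^i <= 1 + |x| < 2^(i+1), the i-th indicator is 1 at x and its coefficient
    already dominates the weight. Integrating a series of step functions replaces the computation of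
    an improper integral. *)
Lemma le_wt_series (d x : R) : 0 <= d ->
  ((wt d x)%:E <= \sum_(0 <= i <oo)
     (2 `^ (- (1 + d)) ^+ i * \1_[set y : R | (`|y| < 2 ^+ i.+1)%R] x)%:E)%E.
Proof.
move=> d0.
pose i := `|Num.floor (ln (1 + `|x|) / ln 2)|%N.
have l2 : 0 < ln (2 : R) by rewrite ln_gt0// ltr1n.
have px : 0 < 1 + `|x| by rewrite ltr_wpDr.
have l0 : 0 <= ln (1 + `|x|) / ln 2.
  by rewrite divr_ge0 ?(ltW l2)// ln_ge0// lerDl.
have i1 : i%:R = (Num.floor (ln (1 + `|x|) / ln 2))%:~R :> R.
  by rewrite natr_absz ger0_norm// floor_ge0.
have := floor_itv (ln (1 + `|x|) / ln 2).
rewrite intrD -i1 => /andP[h1 h2].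
have L1 : 2 ^+ i <= 1 + `|x|.
  rewrite -powR_mulrn// /powR; rewrite ifF ?pnatr_eq0//.
  by rewrite -[leRHS]lnK ?posrE// ler_expR -ler_pdivlMr.
have L2 : 1 + `|x| < 2 ^+ i.+1.
  rewrite -powR_mulrn// /powR; rewrite ifF ?pnatr_eq0//.
  rewrite -[ltLHS]lnK ?posrE// ltr_expR -ltr_pdivrMr//.
  by apply: (lt_le_trans h2); rewrite mulr1z natr1.
apply: le_trans; last first.
  apply: (nneseries_lim_ge i.+1) => k _ _; rewrite lee_fin mulr_ge0 ?exprn_ge0 ?powR_ge0//.
rewrite big_nat_recr//= -[leLHS]add0e; apply: leeD.
  by apply: sume_ge0 => k _; rewrite lee_fin mulr_ge0 ?exprn_ge0 ?powR_ge0.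
rewrite lee_fin indicE mem_set/=; last by apply: le_lt_trans L2; rewrite lerDr.
rewrite mulr1 -powR_mulrn ?powR_ge0// -powRrM mulrC powRrM powR_mulrn//.
rewrite /wt !powRN lef_pV2 ?posrE ?powR_gt0 ?exprn_gt0//.
by rewrite ler_powR2 ?exprn_ge0// addr_ge0.
Qed.

Lemma integral_wt_affine (d a b : R) : 0 < d -> 0 < a ->
  (\int[mu]_x (wt d (a * x - b))%:E <= (wtc d / a)%:E)%E.
Proof.
move=> d0 a0.
pose A i := [set x : R | `|a * x - b| < 2 ^+ i.+1].
have AE i : A i = `](b - 2 ^+ i.+1) / a, (b + 2 ^+ i.+1) / a[%classic.
  apply/seteqP; split => x; rewrite /A /= in_itv /= ltr_norml ltr_pdivrMr// ltr_pdivlMr// => /andP[h1 h2];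
    apply/andP; split; lra.
have mA i : measurable (A i) by rewrite AE; exact: measurable_itv.
have muA i : mu (A i) = (2 ^+ i.+2 / a)%:E.
  rewrite AE lebesgue_measure_itv /= lte_fin ltr_pM2r ?invr_gt0//.
  have p0 : 0 < 2 ^+ i.+1 :> R by rewrite exprn_gt0.
  rewrite ifT; last by lra.
  by rewrite -EFinB; congr EFin; rewrite [in RHS]exprS; field; rewrite gt_eqF.
pose F i (x : measurableTypeR R) := (2 `^ (- (1 + d)) ^+ i * \1_(A i) x)%:E : \bar R.
have F0 i x : (0 <= F i x)%E by rewrite lee_fin mulr_ge0 ?exprn_ge0 ?powR_ge0.
have mF i : measurable_fun [set: R] (F i).
  by apply/measurable_EFinP; apply: measurable_funM.
apply: (@le_trans _ _ (\int[mu]_x (\sum_(0 <= i <oo) F i x))%E).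
  apply: ge0_le_integral => //.
  - by move=> x _; rewrite lee_fin wt_ge0.
  - by apply/measurable_EFinP; exact: measurable_wt_affine.
  - apply: (@ge0_emeasurable_sum _ _ _ _ F xpredT) => [k x _ _|k _]; [exact: F0|exact: mF].
  - by move=> x _; exact: (le_wt_series _ _ (ltW d0)).
rewrite integral_nneseries//.
apply: lime_le; first by apply: is_cvg_nneseries => n _ _; exact: integral_ge0.
apply: nearW => n.
have IF i : (\int[mu]_x F i x)%E = (2 `^ (- (1 + d)) ^+ i * (2 ^+ i.+2 / a))%:E.
  rewrite ge0_integralZ ?exprn_ge0 ?powR_ge0//; last by apply: measurable_indic; exact: mA.
  rewrite EFinM -muA; congr (_ * _)%E.
  by rewrite integral_indic ?setIT//; exact: mA.
under eq_bigr do rewrite IF.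
rewrite sumEFin lee_fin.
(* The length 2^(i+2)/a absorbs the factor 2^(-i) and leaves the ratio 2^(-d). *)
have E i : 2 `^ (- (1 + d)) ^+ i * (2 ^+ i.+2 / a) = 4 / a * (2 `^ (- d)) ^+ i.
  have -> : 2 `^ (- (1 + d)) = 2^-1 * 2 `^ (- d) :> R.
    by rewrite opprD powRD_gt0// powR_inv1.
  rewrite exprMn !exprS exprVn; field.
  by rewrite gt_eqF// expf_neq0.
under eq_bigr do rewrite E.
rewrite -mulr_sumr /wtc -[leRHS]mulrAC ler_wpM2l ?divr_ge0 ?(ltW a0)//.
by apply: sum_geo_le; rewrite ?iota_uniq// powR_ge0 pow2N_lt1.
Qed.

Definition wts (d : R) : R := 2 `^ (1 + d) * wtc d.

Lemma wts_gt0 (d : R) : 0 < d -> 0 < wts d.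
Proof. by move=> d0; rewrite mulr_gt0 ?powR_gt0// wtc_gt0. Qed.

(** Comparison with the integral: on the unit cell [k, k+1) the value at k is within a factor
    2^(1+d) of the value at any point x of the cell, by [wt_near]. *)
Lemma sum_wt (d v : R) (K : seq int) : 0 < d -> uniq K ->
  \sum_(k <- K) wt d (v - k%:~R) <= wts d.
Proof.
move=> d0 uK.
have mI (k : int) : measurable `[(k%:~R : R), k%:~R + 1[%classic by exact: measurable_itv.
have muI (k : int) : mu `[(k%:~R : R), k%:~R + 1[%classic = 1%E.
  by rewrite lebesgue_measure_itv /= lte_fin ltrDl ltr01 -EFinD addrAC subrr add0r.
pose F (k : int) (x : measurableTypeR R) := (wt d (v - k%:~R) * \1_`[(k%:~R : R), k%:~R + 1[%classic x)%:E.
have F0 k x : (0 <= F k x)%E by rewrite lee_fin mulr_ge0 ?wt_ge0.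
have mF k : measurable_fun [set: R] (F k).
  by apply/measurable_EFinP; apply: measurable_funM.
have E : (\sum_(k <- K) wt d (v - k%:~R))%:E = (\int[mu]_x \sum_(k <- K) F k x)%E.
  rewrite ge0_integral_sum// -sumEFin; apply: eq_bigr => k _.
  rewrite ge0_integralZ ?wt_ge0//.
  by rewrite integral_indic// setIT [X in (_ * X)%E]muI mule1.
rewrite -lee_fin E.
have := integral_wt_affine d 1 v d0 ltr01; rewrite divr1 => h.
apply: (@le_trans _ _ (\int[mu]_x ((2 `^ (1 + d))%:E * (wt d (1 * x - v))%:E))%E); last first.
  rewrite ge0_integralZl_EFin ?powR_ge0//.
  - by rewrite /wts EFinM lee_pmul2l// ?lte_fin ?powR_gt0.
  - by move=> x _; rewrite lee_fin wt_ge0.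
  - by apply/measurable_EFinP; exact: measurable_wt_affine.
apply: ge0_le_integral => //.
- by move=> x _; exact: sume_ge0.
- exact: emeasurable_sum.
- by apply/measurable_EFinP; apply: measurable_funM => //; exact: measurable_wt_affine.
move=> x _; rewrite sumEFin -EFinM lee_fin.
(* The unit cells are disjoint, so at most the term [k = Num.floor x] survives. *)
have P k : x \in `[(k%:~R : R), k%:~R + 1[%classic = (k == Num.floor x).
  apply/idP/idP.
    by rewrite inE/= in_itv/= => h1; rewrite eq_sym; apply/eqP/floor_def; rewrite intrD mulr1z.
  by move=> /eqP->; rewrite inE/= in_itv/= -intrD1 floor_itv.
have bnd : 0 <= 2 `^ (1 + d) * wt d (1 * x - v) by rewrite mulr_ge0 ?powR_ge0 ?wt_ge0.
under eq_bigr do rewrite indicE P.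
case: (boolP (Num.floor x \in K)) => fK; last first.
  rewrite big1_seq// => k /andP[_ kK]; case: eqP => [ek|_]; last by rewrite mulr0.
  by move: fK; rewrite -ek kK.
rewrite (perm_big _ (perm_to_rem fK)) big_cons /= eqxx mulr1 big1_seq ?addr0; last first.
  move=> k /andP[_]; rewrite mem_rem_uniq// inE => /andP[/negPf->]; by rewrite mulr0.
rewrite mul1r -[wt d (x - v)]wtN opprB; apply: wt_near; first exact: ltW.
have := floor_itv x; rewrite intrD mulr1z => /andP[h1 h2].
rewrite ler_norml; apply/andP; split; lra.
Qed.

End Weight.

(** * Kernel estimates for the wavelets *)

Section Wavelet.
Context {R : realType}.
Notation mu := (@lebesgue_measure R).
Notation dy j := ((2 : R) `^ (j%:~R)).
Notation sdy j := ((2 : R) `^ (j%:~R / 2)).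

Lemma dy_gt0 (j : int) : 0 < dy j. Proof. exact: powR_gt0. Qed.
Lemma sdy_gt0 (j : int) : 0 < sdy j. Proof. exact: powR_gt0. Qed.

Lemma sdyM (j : int) : sdy j * sdy j = dy j.
Proof. by rewrite -powRD_gt0//; congr (_ `^ _); field. Qed.

Variables (psi : R -> R) (C d : R).
Hypothesis psiC1 : C1 psi.
Hypothesis C0 : 0 < C.
Hypothesis d0 : 0 < d.
Hypothesis psi_decay : forall x, `|psi x| <= C * wt (2 * d) x.
Hypothesis psi'_decay : forall x, `|derive1 psi x| <= C * wt (2 * d) x.

Let d0' : 0 <= d. Proof. exact: ltW. Qed.
Let C0' : 0 <= C. Proof. exact: ltW. Qed.

Lemma psi_continuous : continuous psi.
Proof.
by move=> x; apply: differentiable_continuous; apply/derivable1_diffP; case: psiC1.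
Qed.

Lemma measurable_psiI I : measurable_fun [set: R] (psiI psi I).
Proof.
apply: measurable_funM => //.
apply: (@measurableT_comp _ _ _ _ _ _ psi).
  by apply: continuous_measurable_fun; exact: psi_continuous.
by apply: measurable_funB => //; exact: measurable_funM.
Qed.

Lemma psi_le (x : R) : `|psi x| <= C * wt d x.
Proof.
apply: (le_trans (psi_decay x)); rewrite ler_pM2l//; apply: wt_le_wt.
by rewrite ler_peMl//; lra.
Qed.

Lemma psiI_le (j k : int) x :
  `|psiI psi (j, k) x| <= C * sdy j * wt d (dy j * x - k%:~R).
Proof.
rewrite /psiI normrM gtr0_norm ?sdy_gt0//= [C * _]mulrC -mulrA.
by rewrite ler_pM2l ?sdy_gt0// psi_le.
Qed.

Lemma psiI_bound (j k : int) x : `|psiI psi (j, k) x| <= C * sdy j.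
Proof.
apply: (le_trans (psiI_le _ _ _)); rewrite ler_piMr ?wt_le1//.
by rewrite mulr_ge0// ltW// sdy_gt0.
Qed.

Lemma integral_psiI (j k : int) :
  (\int[mu]_x `|psiI psi (j, k) x|%:E <= (C * wtc d / sdy j)%:E)%E.
Proof.
apply: (@le_trans _ _ (\int[mu]_x ((C * sdy j) * wt d (dy j * x - k%:~R))%:E)%E).
  apply: ge0_le_integral_EFin => //.
  - by apply: measurableT_comp => //; exact: measurable_psiI.
  - by apply: measurable_funM => //; exact: measurable_wt_affine.
  - by move=> x _; exact: psiI_le.
rewrite ge0_integralZ//; first last.
- by move=> x; exact: wt_ge0.
- exact: measurable_wt_affine.
- by rewrite mulr_ge0// ltW// sdy_gt0.
apply: (@le_trans _ _ ((C * sdy j)%:E * (wtc d / dy j)%:E)%E).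
  rewrite lee_pmul2l// ?lte_fin ?mulr_gt0 ?sdy_gt0//.
  by apply: integral_wt_affine => //; exact: dy_gt0.
rewrite -EFinM lee_fin le_eqVlt; apply/orP; left; apply/eqP.
rewrite -sdyM; field; rewrite gt_eqF//; exact: sdy_gt0.
Qed.

Lemma psi_mvt (x y : R) : x <= y ->
  exists2 c, x <= c <= y & psi y - psi x = derive1 psi c * (y - x).
Proof.
move=> xy; have [dpsi _] := psiC1.
have H z : z \in `]x, y[%R -> is_derive z 1 psi (derive1 psi z).
  by move=> _; rewrite derive1E; exact: derivableP.
have [|c] := @MVT_segment R psi (derive1 psi) x y xy H.
  by apply: derivable_within_continuous => z _; exact: dpsi.
by rewrite in_itv/= => cxy ->; exists c.
Qed.

(** The position of the intermediate point is recorded because the decay of the derivative there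
    must later be transported back to [y]. *)
Lemma psi_mvt_sym (x y : R) :
  exists2 c, `|c - y| <= `|x - y| & `|psi x - psi y| = `|derive1 psi c| * `|x - y|.
Proof.
have [xy|/ltW yx] := leP x y.
  have [c /andP[c1 c2] e] := psi_mvt _ _ xy.
  exists c; last by rewrite distrC e normrM [`|y - x|]distrC.
  by rewrite !ler0_norm ?subr_le0// lerN2 lerD2r.
have [c /andP[c1 c2] e] := psi_mvt _ _ yx.
exists c; last by rewrite e normrM.
by rewrite !ger0_norm ?subr_ge0// lerD2r.
Qed.

Lemma psi_lip (x y : R) : `|psi x - psi y| <= C * `|x - y|.
Proof.
have [c _ ->] := psi_mvt_sym x y; rewrite ler_wpM2r//.
apply: (le_trans (psi'_decay c)); by rewrite ler_piMr// wt_le1// mulr_ge0.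
Qed.

Lemma psiI_lip (j k : int) (x y : R) :
  `|psiI psi (j, k) x - psiI psi (j, k) y| <= C * sdy j * dy j * `|x - y|.
Proof.
rewrite /psiI -mulrBr normrM gtr0_norm ?sdy_gt0//= [C * _]mulrC -!mulrA.
rewrite ler_pM2l ?sdy_gt0//.
apply: (le_trans (psi_lip _ _)); rewrite ler_pM2l//.
rewrite (_ : _ - _ - _ = dy j * (x - y)); last by ring.
by rewrite normrM gtr0_norm ?dy_gt0.
Qed.

Lemma psi_near (x y : R) : `|x - y| <= 1 ->
  `|psi x - psi y| <= C * 2 `^ (1 + d) * `|x - y| * wt d y.
Proof.
move=> xy; have [c cy ->] := psi_mvt_sym x y.
apply: (@le_trans _ _ (C * (2 `^ (1 + d) * wt d y) * `|x - y|)); last first.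
  by rewrite le_eqVlt; apply/orP; left; apply/eqP; ring.
rewrite ler_wpM2r//; apply: (le_trans (psi'_decay c)); rewrite ler_pM2l//.
apply: (@le_trans _ _ (wt d c)); first by apply: wt_le_wt; have d1 := d0; lra.
by apply: wt_near => //; exact: le_trans xy.
Qed.

(** Here s = 2^j h compares the length h of an interval with the scale 2^(-j) of the wavelet. For s
    <= 1 smoothness gains the factor s, for s > 1 the spatial decay gains s^(-d); both are summable
    over dyadic s. *)
Definition decay (s : R) := if s <= 1 then s else s `^ (- d).

Lemma decay_ge0 s : 0 <= s -> 0 <= decay s.
Proof. by move=> s0; rewrite /decay; case: ifP => _ //; rewrite powR_ge0. Qed.

(** For s <= 1 the mean value theorem supplies the gain. For s > 1 the difference brings no
    cancellation, and both of its terms are estimated separately through their distance to z. *)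
Lemma psi_kernel (s u u0 z : R) : 0 < s ->
  `|u - u0| <= s -> s <= `|u - z| -> s <= `|u0 - z| ->
  `|psi u - psi u0| * `|psi z|
    <= C ^+ 2 * 2 `^ (1 + d) * decay s * (wt d u + wt d u0) * wt d z.
Proof.
move=> s0 uu0 uz u0z; rewrite /decay.
have c1 : 1 <= 2 `^ (1 + d) :> R by apply/ltW/pow2_gt1; have d1 := d0; lra.
have wu := wt_ge0 d u; have wu0 := wt_ge0 d u0; have wz := wt_ge0 d z.
case: ifPn => [s1|s1].
  have h1 := psi_near _ _ (le_trans uu0 s1).
  have h2 := psi_le z.
  apply: (@le_trans _ _ ((C * 2 `^ (1 + d) * s * wt d u0) * (C * wt d z))).
    apply: ler_pM => //; apply: (le_trans h1).
    by rewrite ler_wpM2r// ler_wpM2l// mulr_ge0// powR_ge0.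
  rewrite [leLHS](_ : _ = C ^+ 2 * 2 `^ (1 + d) * s * wt d u0 * wt d z); last by ring.
  rewrite ler_wpM2r// ler_wpM2l// ?lerDr// !mulr_ge0 ?exprn_ge0 ?powR_ge0//.
  exact: ltW.
(* [wt_split] trades half of the decay of both factors for the separation, which is why the
   hypotheses on [psi] carry [2 * d]. *)
have P v : s <= `|v - z| -> `|psi v| * `|psi z| <= C ^+ 2 * (s `^ (- d) * (wt d v * wt d z)).
  move=> vz; apply: (@le_trans _ _ ((C * wt (2 * d) v) * (C * wt (2 * d) z))).
    by apply: ler_pM.
  rewrite mulrACA expr2 ler_wpM2l ?mulr_ge0//.
  exact: wt_split.
apply: (@le_trans _ _ (C ^+ 2 * (s `^ (- d) * (wt d u * wt d z)) + C ^+ 2 * (s `^ (- d) * (wt d u0 * wt d z)))).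
  apply: (@le_trans _ _ ((`|psi u| + `|psi u0|) * `|psi z|)).
    by rewrite ler_wpM2r// ler_normB.
  by rewrite mulrDl lerD// P.
rewrite [leLHS](_ : _ = C ^+ 2 * s `^ (- d) * (wt d u + wt d u0) * wt d z); last by ring.
rewrite ler_wpM2r// ler_wpM2r ?addr_ge0// ler_wpM2r ?powR_ge0//.
by rewrite ler_peMr// exprn_ge0.
Qed.

Lemma psiI_kernel (j k : int) (h y y0 z : R) : 0 < h ->
  `|y - y0| <= h -> h <= `|y - z| -> h <= `|y0 - z| ->
  `|psiI psi (j, k) y - psiI psi (j, k) y0| * `|psiI psi (j, k) z|
    <= C ^+ 2 * 2 `^ (1 + d) * decay (dy j * h)
       * (wt d (dy j * y - k%:~R) + wt d (dy j * y0 - k%:~R))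
       * dy j * wt d (dy j * z - k%:~R).
Proof.
move=> h0 yy0 yz y0z.
have E a b : `|dy j * a - k%:~R - (dy j * b - k%:~R)| = dy j * `|a - b|.
  rewrite (_ : _ - _ - _ = dy j * (a - b)); last by ring.
  by rewrite normrM gtr0_norm ?dy_gt0.
have := @psi_kernel (dy j * h) (dy j * y - k%:~R) (dy j * y0 - k%:~R) (dy j * z - k%:~R).
rewrite !E !ler_pM2l ?dy_gt0// mulr_gt0 ?dy_gt0// => /(_ isT yy0 yz y0z) H.
rewrite /psiI -mulrBr !normrM (gtr0_norm (sdy_gt0 j)) /= mulrACA sdyM.
rewrite [leRHS](_ : _ = dy j * (C ^+ 2 * 2 `^ (1 + d) * decay (dy j * h) *
   (wt d (dy j * y - k%:~R) + wt d (dy j * y0 - k%:~R)) * wt d (dy j * z - k%:~R))); last by ring.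
by rewrite ler_pM2l ?dy_gt0.
Qed.

Definition tailI (D : set R) (I : dyadic) : R := fine (\int[mu]_(x in D) `|psiI psi I x|%:E)%E.

Lemma integral_psiI_sub (D : set R) I : measurable D ->
  (\int[mu]_(x in D) `|psiI psi I x|%:E <= \int[mu]_x `|psiI psi I x|%:E)%E.
Proof.
move=> mD; apply: ge0_subset_integral => //.
by apply/measurable_EFinP; apply: measurableT_comp => //; exact: measurable_psiI.
Qed.

Lemma tailIE (D : set R) I : measurable D ->
  (\int[mu]_(x in D) `|psiI psi I x|%:E = (tailI D I)%:E)%E.
Proof.
move=> mD; rewrite /tailI fineK// ge0_fin_numE; last exact: integral_ge0.
case: I => j k; apply: (le_lt_trans (integral_psiI_sub _ _ mD)).
by apply: (le_lt_trans (integral_psiI j k)); rewrite ltry.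
Qed.

Lemma tailI_ge0 (D : set R) I : 0 <= tailI D I.
Proof. by apply: fine_ge0; exact: integral_ge0. Qed.

(** C^2 2^(1+d) comes from [psi_kernel], [wtc d] from the integral in the far variable, 2 [wts d]
    from the sum over translations at the two points y and y0, and the two [geoc] from the scales
    with 2^j h <= 1 and with 2^j h > 1. *)
Definition kerc : R := 2 * C ^+ 2 * 2 `^ (1 + d) * wtc d * wts d * (geoc 1 + geoc d).

(** Hoermander's regularity condition for the kernel, integrated outside the triple of the interval
    [y0, y0 + h). The absolute values stand inside the sum over wavelets, and the bound does not
    depend on [J], [K] or [h]. *)
Lemma kernel_sum (J K : seq int) (h y y0 : R) : uniq J -> uniq K -> 0 < h ->
  y0 <= y < y0 + h ->
  \sum_(j <- J) \sum_(k <- K) `|psiI psi (j, k) y - psiI psi (j, k) y0|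
     * tailI (~` `[y0 - h, y0 + 2 * h[) (j, k) <= kerc.
Proof.
move=> uJ uK h0 /andP[y1 y2].
set D := ~` _; have mD : measurable D by apply: measurableC; exact: measurable_itv.
pose c := C ^+ 2 * 2 `^ (1 + d) * wtc d.
have c0 : 0 <= c.
  have wc := ltW (wtc_gt0 _ d0).
  by rewrite /c mulr_ge0// mulr_ge0 ?exprn_ge0 ?powR_ge0.
have decay0 j : 0 <= decay (dy j * h) by rewrite decay_ge0// mulr_ge0 ?ltW// dy_gt0.
have T j k : `|psiI psi (j, k) y - psiI psi (j, k) y0| * tailI D (j, k)
    <= c * decay (dy j * h) * (wt d (dy j * y - k%:~R) + wt d (dy j * y0 - k%:~R)).
  set q := (wt d _ + _).
  have q0 : 0 <= q by rewrite addr_ge0// wt_ge0.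
  have c'0 : 0 <= C ^+ 2 * 2 `^ (1 + d) * decay (dy j * h) * q * dy j.
    by rewrite !mulr_ge0 ?exprn_ge0 ?powR_ge0.
  rewrite -lee_fin EFinM -tailIE// -ge0_integralZ//; last first.
    by apply: measurableT_comp => //; apply: measurable_funTS; exact: measurable_psiI.
  apply: (@le_trans _ _ (\int[mu]_(x in D) ((C ^+ 2 * 2 `^ (1 + d) * decay (dy j * h) * q * dy j)
      * wt d (dy j * x - k%:~R))%:E)%E).
    apply: ge0_le_integral_EFin => //.
    - apply: measurable_funM => //; apply: measurableT_comp => //; apply: measurable_funTS.
      exact: measurable_psiI.
    - by apply: measurable_funM => //; apply: measurable_funTS; exact: measurable_wt_affine.
    (* Outside the triple, x is at distance at least h from both y and y0, as [psiI_kernel]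
       requires. *)
    move=> x; rewrite /D /= in_itv /= => /negP; rewrite negb_and -ltNge -leNgt => /orP xD.
    by apply: psiI_kernel => //;
      [rewrite ger0_norm; lra|case: xD => xD; [rewrite ger0_norm; lra|rewrite ler0_norm; lra]..].
  apply: (@le_trans _ _ (\int[mu]_x ((C ^+ 2 * 2 `^ (1 + d) * decay (dy j * h) * q * dy j)
      * wt d (dy j * x - k%:~R))%:E)%E).
    apply: ge0_subset_integral => //.
      by apply/measurable_EFinP; apply: measurable_funM => //; exact: measurable_wt_affine.
    by move=> x _; rewrite lee_fin mulr_ge0// wt_ge0.
  rewrite ge0_integralZ//; [|exact: measurable_wt_affine|by move=> x; exact: wt_ge0].
  apply: (@le_trans _ _ ((C ^+ 2 * 2 `^ (1 + d) * decay (dy j * h) * q * dy j)%:E * (wtc d / dy j)%:E)%E).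
    apply: lee_wpmul2l; first by rewrite lee_fin.
    by apply: integral_wt_affine => //; exact: dy_gt0.
  rewrite -EFinM lee_fin le_eqVlt; apply/orP; left; apply/eqP; rewrite /c; field.
  by rewrite gt_eqF// dy_gt0.
have S j : \sum_(k <- K) `|psiI psi (j, k) y - psiI psi (j, k) y0| * tailI D (j, k)
    <= c * decay (dy j * h) * (2 * wts d).
  apply: (le_trans (ler_sum _ (fun k _ => T j k))).
  rewrite -mulr_sumr; apply: ler_wpM2l; first by rewrite mulr_ge0.
  rewrite big_split /= (_ : 2 * wts d = wts d + wts d); last by ring.
  by rewrite lerD// sum_wt.
apply: (le_trans (ler_sum _ (fun j _ => S j))).
under eq_bigr do rewrite -mulrA [decay _ * _]mulrC mulrA.
rewrite -mulr_sumr (_ : kerc = c * (2 * wts d) * (geoc 1 + geoc d)); last by rewrite /kerc /c; ring.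
have w0 := ltW (wts_gt0 _ d0); apply: ler_wpM2l.
  by apply: mulr_ge0 => //; apply: mulr_ge0.
(* Wavelets wider than h gain linearly by smoothness, narrower ones gain the power -d by decay. *)
rewrite (bigID (fun j => dy j <= h^-1)) /=; apply: lerD.
  have := sum_dyadic_le 1 h^-1 J; rewrite invr_gt0 ltr01 h0 => /(_ isT isT uJ) H.
  apply: (@le_trans _ _ (h * \sum_(j <- J | dy j <= h^-1) (dy j) `^ 1)).
    rewrite mulr_sumr; apply: ler_sum => j jh.
    rewrite powRr1 ?(ltW (dy_gt0 j))// /decay ifT; first by rewrite mulrC.
    by rewrite -ler_pdivlMr// div1r.
  apply: (le_trans (ler_wpM2l (ltW h0) H)).
  by rewrite powRr1 ?invr_ge0 ?(ltW h0)// mulrCA divff ?mulr1// gt_eqF.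
have := sum_dyadic_ge d h^-1 J; rewrite invr_gt0 d0 h0 => /(_ isT isT uJ) H.
apply: (@le_trans _ _ (h `^ (- d) * \sum_(j <- J | h^-1 <= dy j) (dy j) `^ (- d))).
  rewrite [leRHS]mulr_sumr [leRHS](bigID (fun j => dy j <= h^-1)) /= -[leLHS]add0r lerD//.
    by apply: sumr_ge0 => j _; rewrite mulr_ge0 ?powR_ge0.
  rewrite [leRHS](eq_bigl (fun j => ~~ (dy j <= h^-1))); last first.
    by move=> j; rewrite -ltNge /=; case: (ltP h^-1 (dy j)) => [/ltW->//|]; rewrite andbF.
  apply: ler_sum => j; rewrite -ltNge => jh.
  rewrite /decay ifF ?powRM ?(ltW h0) ?(ltW (dy_gt0 j))//; first by rewrite mulrC.
  by apply/negbTE; rewrite -ltNge -ltr_pdivrMr// div1r.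
apply: (le_trans (ler_wpM2l (powR_ge0 _ _) H)).
by rewrite mulrCA -powR_inv1 ?(ltW h0)// -powRrM mulN1r opprK -powRD_gt0// addNr powRr0 mulr1.
Qed.

End Wavelet.

(** * Chebyshev's inequality and integrability of real functions *)

Section Markov.
Context {d} {T : measurableType d} {R : realType} (mu : {measure set T -> \bar R}).

Lemma markov_EFin (D : set T) (f : T -> R) (a : R) : measurable D ->
  measurable_fun D f -> (forall x, 0 <= f x) -> 0 < a ->
  (mu (D `&` [set x | (a < f x)%R]) <= (a^-1)%:E * \int[mu]_(x in D) (f x)%:E)%E.
Proof.
move=> mD mf f0 a0.
have mf' : measurable_fun D (EFin \o f) by exact/measurable_EFinP.
have mS : measurable (D `&` [set x | (a < f x)%R]).
  rewrite (_ : _ `&` _ = D `&` [set x | (a%:E < (EFin \o f) x)%E]).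
    exact: emeasurable_fun_o_infty.
  by apply/seteqP; split => x /= [? ?]; split; rewrite ?lte_fin// -lte_fin.
have := le_integral_abse mu mD mf' a0.
rewrite (eq_integral (EFin \o f)); last by move=> x _ /=; rewrite ger0_norm.
move=> H; rewrite -(@lee_pmul2l _ a%:E)// ?lte_fin//.
rewrite muleA -EFinM divff ?gt_eqF// mul1e; apply: le_trans H.
rewrite lee_pmul2l// ?lte_fin//; apply: le_measure; rewrite ?inE//.
  by apply: emeasurable_fun_c_infty => //; exact: measurableT_comp.
by move=> x [Dx /= fx]; split => //=; rewrite lee_fin ger0_norm// ltW.
Qed.

Lemma integrable_EFinP (f : T -> R) : measurable_fun [set: T] f ->
  (\int[mu]_x `|f x|%:E < +oo)%E -> mu.-integrable [set: T] (EFin \o f).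
Proof. by move=> mf h; apply/integrableP; split => //; exact/measurable_EFinP. Qed.

Lemma integrable_measurable (f : T -> R) :
  mu.-integrable [set: T] (EFin \o f) -> measurable_fun [set: T] f.
Proof. by move=> /integrableP[/measurable_EFinP]. Qed.

Lemma integrable_ltoo (f : T -> R) :
  mu.-integrable [set: T] (EFin \o f) -> (\int[mu]_x `|f x|%:E < +oo)%E.
Proof. by move=> /integrableP[]. Qed.

Lemma integrableM_bounded (f g : T -> R) (M : R) :
  mu.-integrable [set: T] (EFin \o f) -> measurable_fun [set: T] g ->
  (forall x, `|g x| <= M) -> mu.-integrable [set: T] (EFin \o (fun x => f x * g x)).
Proof.
move=> intf mg gM; have mf := integrable_measurable _ intf.
apply: integrable_EFinP; first exact: measurable_funM.
(* A negative bound is possible only on an empty space, where every integral vanishes. *)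
have M0 : 0 <= M \/ forall x : T, False.
  have [M0|M0] := leP 0 M; first by left.
  by right => x; have := le_lt_trans (gM x) M0; rewrite normr_lt0.
case: M0 => [M0|M0]; last first.
  rewrite integral0_eq ?ltry// => x; by have := M0 x.
apply: (@le_lt_trans _ _ (\int[mu]_x (M * `|f x|)%:E)%E).
  apply: ge0_le_integral_EFin => //.
  - by apply: measurableT_comp => //; exact: measurable_funM.
  - by apply: measurable_funM => //; exact: measurableT_comp.
  - by move=> x _; rewrite normrM mulrC ler_wpM2r.
rewrite ge0_integralZ//; last exact: measurableT_comp.
by rewrite lte_mul_pinfty ?lee_fin// integrable_ltoo.
Qed.

Lemma integrableZ_EFin (f : T -> R) (k : R) : mu.-integrable [set: T] (EFin \o f) ->
  mu.-integrable [set: T] (EFin \o (fun x => k * f x)).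
Proof. by move=> /(integrableZl measurableT k). Qed.

Lemma integrableD_EFin (f g : T -> R) : mu.-integrable [set: T] (EFin \o f) ->
  mu.-integrable [set: T] (EFin \o g) ->
  mu.-integrable [set: T] (EFin \o (fun x => f x + g x)).
Proof. by move=> intf intg; have := integrableD measurableT intf intg. Qed.

Lemma integrableB_EFin (f g : T -> R) : mu.-integrable [set: T] (EFin \o f) ->
  mu.-integrable [set: T] (EFin \o g) ->
  mu.-integrable [set: T] (EFin \o (fun x => f x - g x)).
Proof. by move=> intf intg; have := integrableB measurableT intf intg. Qed.

Lemma integrable_sum_EFin (I : Type) (s : seq I) (f : I -> T -> R) :
  (forall i, mu.-integrable [set: T] (EFin \o f i)) ->
  mu.-integrable [set: T] (EFin \o (fun x => \sum_(i <- s) f i x)).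
Proof.
move=> intf; rewrite (_ : _ \o _ = fun x => (\sum_(i <- s) (EFin \o f i) x)%E).
  exact: integrable_sum.
by apply/funext => x /=; rewrite sumEFin.
Qed.

Lemma Rintegral_sum (I : Type) (s : seq I) (f : I -> T -> R) :
  (forall i, mu.-integrable [set: T] (EFin \o f i)) ->
  (\int[mu]_x (\sum_(i <- s) f i x))%R = \sum_(i <- s) (\int[mu]_x f i x)%R.
Proof.
move=> intf; elim: s => [|i s IH].
  by under eq_Rintegral do rewrite big_nil; rewrite big_nil Rintegral_cst// mul0r.
under eq_Rintegral do rewrite big_cons; rewrite big_cons RintegralD// ?IH//.
exact: integrable_sum_EFin.
Qed.

End Markov.

(** * L^p membership and wavelet coefficients *)

Section Coefficients.
Context {R : realType}.
Notation mu := (@lebesgue_measure R).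
Notation sdy j := ((2 : R) `^ (j%:~R / 2)).
Notation dy j := ((2 : R) `^ (j%:~R)).

Lemma inLpP (p : R) (f : R -> R) : 0 < p -> inLp p f <->
  measurable_fun [set: R] f /\ (\int[mu]_x (`|f x| `^ p)%:E < +oo)%E.
Proof.
move=> p0; have p0' : p != 0 by rewrite gt_eqF.
rewrite /inLp; split => -[mf h]; split => //.
  have := poweR_lty p h; rewrite poweR_Lnorm//.
rewrite unlock; apply: poweR_lty.
exact: h.
Qed.

Lemma inLp1P (f : R -> R) : inLp 1 f <-> mu.-integrable [set: R] (EFin \o f).
Proof.
rewrite inLpP//; split => [[mf]|intf].
  by under eq_integral do rewrite powRr1//; exact: integrable_EFinP.
split; first exact: integrable_measurable intf.
by under eq_integral do rewrite powRr1//; exact: integrable_ltoo.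
Qed.

Lemma inLp2P (f : R -> R) : inLp 2 f <->
  measurable_fun [set: R] f /\ (\int[mu]_x (f x ^+ 2)%:E < +oo)%E.
Proof.
have E x : `|f x| `^ 2 = f x ^+ 2 by rewrite powR_mulrn// real_normK ?num_real.
by rewrite inLpP//; under eq_integral do rewrite E.
Qed.

Lemma integrableM_inLp2 (f g : R -> R) : inLp 2 f -> inLp 2 g ->
  mu.-integrable [set: R] (EFin \o (fun x => f x * g x)).
Proof.
move=> /inLp2P[mf If] /inLp2P[mg Ig].
apply: integrable_EFinP; first exact: measurable_funM.
apply: (@le_lt_trans _ _ (\int[mu]_x (f x ^+ 2 + g x ^+ 2)%:E)%E).
  apply: ge0_le_integral_EFin => //.
  - by apply: measurableT_comp => //; exact: measurable_funM.
  - by apply: measurable_funD; exact: measurable_funX.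
  move=> x _; rewrite normrM -(real_normK (num_real (f x))) -(real_normK (num_real (g x))).
  by have := normr_ge0 (f x); have := normr_ge0 (g x); nra.
rewrite ge0_integralD_EFin//; try exact: measurable_funX; try by move=> x; exact: sqr_ge0.
by rewrite lte_add_pinfty.
Qed.

Lemma innerD (f g h : R -> R) :
  mu.-integrable [set: R] (EFin \o (fun x => f x * h x)) ->
  mu.-integrable [set: R] (EFin \o (fun x => g x * h x)) ->
  inner (fun x => f x + g x) h = inner f h + inner g h.
Proof.
move=> intf intg; rewrite /inner; under eq_integral do rewrite mulrDl.
exact: (@RintegralD _ _ _ mu setT (fun x => f x * h x) (fun x => g x * h x)).
Qed.

Lemma norm_inner_le (f g : R -> R) : measurable_fun [set: R] f -> measurable_fun [set: R] g ->
  (`|inner f g|%:E <= \int[mu]_x (`|f x| * `|g x|)%:E)%E.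
Proof.
move=> mf mg; rewrite /inner.
have mfg : measurable_fun [set: R] (fun x => (f x * g x)%:E).
  by apply/measurable_EFinP; exact: measurable_funM.
have := le_abse_integral mu measurableT mfg.
have -> : (\int[mu]_x `|(f x * g x)%:E| = \int[mu]_x (`|f x| * `|g x|)%:E)%E.
  by apply: eq_integral => x _; rewrite abse_EFin normrM.
apply: le_trans.
(* [inner] goes through [fine], whose value is 0 at an infinite integral; the bound is then
   trivial. *)
case: (\int[mu]_x _)%E => //=.
by rewrite normr0 leey.
by rewrite normr0 leey.
Qed.

End Coefficients.

(** * The square function *)

Section Bessel.
Context {R : realType}.
Notation mu := (@lebesgue_measure R).
Variable psi : R -> R.
Hypothesis psi_L2 : forall I, inLp 2 (psiI psi I).
Hypothesis psi_orth : forall I J, inner (psiI psi I) (psiI psi J) = (I == J)%:R.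

(** The square of the wavelet square function; keeping the square turns Bessel's inequality into a
    bound of its plain integral. *)
Definition Sq (s : seq dyadic) (f : R -> R) (x : R) : R :=
  \sum_(I <- s) inner f (psiI psi I) ^+ 2 * psiI psi I x ^+ 2.

Lemma integral_psiI2 I : (\int[mu]_x (psiI psi I x ^+ 2)%:E = 1)%E.
Proof.
have := psi_orth I I; rewrite eqxx /inner.
under eq_integral do rewrite -expr2.
(* An infinite norm would make [inner] equal to the default value 0 instead of 1. *)
by case: (\int[mu]_x _)%E => [r /= ->|/= /eqP|/= /eqP]//; rewrite eq_sym oner_eq0.
Qed.

Lemma measurable_psiI2 I : measurable_fun [set: R] (psiI psi I).
Proof. by case: (psi_L2 I). Qed.

Lemma integral_sum_psiI2 (s : seq dyadic) (c : dyadic -> R) :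
  (forall I, 0 <= c I) ->
  (\int[mu]_x (\sum_(I <- s) c I * psiI psi I x ^+ 2)%:E = (\sum_(I <- s) c I)%:E)%E.
Proof.
move=> c0; rewrite ge0_integral_sum_EFin//.
- rewrite -sumEFin; apply: eq_bigr => I _.
  rewrite ge0_integralZ//; first by rewrite integral_psiI2 mule1.
    by apply: measurable_funX; exact: measurable_psiI2.
  by move=> x; exact: sqr_ge0.
- move=> I; apply: measurable_funM => //; apply: measurable_funX; exact: measurable_psiI2.
- by move=> I x; rewrite mulr_ge0// sqr_ge0.
Qed.

Lemma integral_Sq (s : seq dyadic) (f : R -> R) :
  (\int[mu]_x (Sq s f x)%:E = (\sum_(I <- s) inner f (psiI psi I) ^+ 2)%:E)%E.
Proof. by apply: integral_sum_psiI2 => I; exact: sqr_ge0. Qed.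

Lemma measurable_Sq (s : seq dyadic) (f : R -> R) : measurable_fun [set: R] (Sq s f).
Proof.
apply: measurable_sum => I; apply: measurable_funM => //; apply: measurable_funX.
exact: measurable_psiI2.
Qed.

Lemma Sq_ge0 (s : seq dyadic) (f : R -> R) x : 0 <= Sq s f x.
Proof. by apply: sumr_ge0 => I _; rewrite mulr_ge0// sqr_ge0. Qed.

(** With g the orthogonal projection of f on the span of the family, 0 <= integral of (f - g)^2
    expands to the integral of f^2 minus the sum of the squared coefficients. *)
Lemma bessel (s : seq dyadic) (f : R -> R) : uniq s -> inLp 2 f ->
  ((\sum_(I <- s) inner f (psiI psi I) ^+ 2)%:E <= \int[mu]_x (f x ^+ 2)%:E)%E.
Proof.
move=> us f2; pose c I := inner f (psiI psi I).
pose g x := \sum_(I <- s) c I * psiI psi I x.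
have mf := f2.1.
have mg : measurable_fun [set: R] g.
  by apply: measurable_sum => I; apply: measurable_funM => //; exact: measurable_psiI2.
have If : mu.-integrable [set: R] (EFin \o (fun x => f x ^+ 2)).
  by rewrite (_ : (fun _ => _) = (fun x => f x * f x))//; exact: integrableM_inLp2.
have IfI I : mu.-integrable [set: R] (EFin \o (fun x => c I * (f x * psiI psi I x))).
  by apply: integrableZ_EFin; exact: integrableM_inLp2.
have IIJ I J : mu.-integrable [set: R] (EFin \o (fun x => c I * c J * (psiI psi I x * psiI psi J x))).
  by apply: integrableZ_EFin; exact: integrableM_inLp2.
have sumI (F : dyadic -> R -> R) : (forall I, mu.-integrable [set: R] (EFin \o F I)) ->
    mu.-integrable [set: R] (EFin \o (fun x => \sum_(I <- s) F I x)).
  exact: integrable_sum_EFin.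
have E1 : (\int[mu]_x (\sum_(I <- s) c I * (f x * psiI psi I x)))%R = \sum_(I <- s) c I ^+ 2.
  rewrite Rintegral_sum//; apply: eq_bigr => I _.
  by rewrite RintegralZl//; exact: integrableM_inLp2.
have E2 : (\int[mu]_x (\sum_(I <- s) \sum_(J <- s) c I * c J * (psiI psi I x * psiI psi J x)))%R
    = \sum_(I <- s) c I ^+ 2.
  rewrite Rintegral_sum; last by move=> I; exact: sumI.
  apply: eq_big_seq => I sI; rewrite Rintegral_sum//.
  rewrite (perm_big _ (perm_to_rem sI)) big_cons /= big1_seq; last first.
    move=> J /andP[_]; rewrite mem_rem_uniq// inE => /andP[/negPf JI _].
    rewrite RintegralZl//; last exact: integrableM_inLp2.
    by rewrite [X in _ * X](psi_orth I J) eq_sym JI mulr0.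
  rewrite RintegralZl//; last exact: integrableM_inLp2.
  by rewrite [X in _ * X](psi_orth I I) eqxx mulr1 addr0.
have E : (\int[mu]_x ((f x - g x) ^+ 2))%R = (\int[mu]_x (f x ^+ 2))%R - \sum_(I <- s) c I ^+ 2.
  transitivity (\int[mu]_x (f x ^+ 2 - (2 * (\sum_(I <- s) c I * (f x * psiI psi I x)) -
     \sum_(I <- s) \sum_(J <- s) c I * c J * (psiI psi I x * psiI psi J x))))%R.
    apply: eq_Rintegral => x _.
    have -> : \sum_(I <- s) c I * (f x * psiI psi I x) = f x * g x.
      by rewrite /g mulr_sumr; apply: eq_bigr => I _; ring.
    have -> : \sum_(I <- s) \sum_(J <- s) c I * c J * (psiI psi I x * psiI psi J x) = g x * g x.
      rewrite /g mulr_suml; apply: eq_bigr => I _; rewrite mulr_sumr; apply: eq_bigr => J _; ring.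
    by ring.
  rewrite RintegralB//; last first.
    apply: integrableB_EFin; first by apply: integrableZ_EFin; exact: sumI.
    by apply: integrable_sum_EFin => I; exact: sumI.
  rewrite RintegralB//; first last.
  - by apply: integrable_sum_EFin => I; exact: sumI.
  - by apply: integrableZ_EFin; exact: sumI.
  rewrite E2 RintegralZl//; last exact: sumI.
  by rewrite E1; ring.
have : 0 <= (\int[mu]_x ((f x - g x) ^+ 2))%R by apply: Rintegral_ge0 => x _; exact: sqr_ge0.
rewrite E subr_ge0 => H.
rewrite -[leRHS]fineK ?lee_fin//; exact: (integrable_fin_num measurableT If).
Qed.

End Bessel.

(** * Weak type (1,1) of the square function *)

Section WeakType.
Context {R : realType}.
Notation mu := (@lebesgue_measure R).
Notation dy j := ((2 : R) `^ (j%:~R)).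
Notation sdy j := ((2 : R) `^ (j%:~R / 2)).
Variables (psi : R -> R) (C d : R).
Hypothesis psiC1 : C1 psi.
Hypothesis C0 : 0 < C.
Hypothesis d0 : 0 < d.
Hypothesis psi_decay : forall x, `|psi x| <= C * wt (2 * d) x.
Hypothesis psi'_decay : forall x, `|derive1 psi x| <= C * wt (2 * d) x.
Hypothesis psi_L2 : forall I, inLp 2 (psiI psi I).
Hypothesis psi_orth : forall I J, inner (psiI psi I) (psiI psi J) = (I == J)%:R.

Let mpsi := measurable_psiI psi psiC1.

Lemma psiI_bounded (I : dyadic) x : `|psiI psi I x| <= C * sdy I.1.
Proof. by case: I => j k; exact: (psiI_bound psi C d). Qed.

Lemma integrableM_psiI (f : R -> R) I : mu.-integrable [set: R] (EFin \o f) ->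
  mu.-integrable [set: R] (EFin \o (fun x => f x * psiI psi I x)).
Proof.
by move=> intf; apply: (@integrableM_bounded _ _ _ _ _ _ (C * sdy I.1)) => //; [exact: mpsi|move=> x; exact: psiI_bounded].
Qed.

(** Mean zero allows the constant psi_I(y0) to be subtracted from the wavelet, which turns size into
    regularity. *)
Lemma mean_zero_coef (b : R -> R) y0 I : mu.-integrable [set: R] (EFin \o b) ->
  (\int[mu]_x b x)%R = 0 ->
  (`|inner b (psiI psi I)|%:E <= \int[mu]_y (`|b y| * `|psiI psi I y - psiI psi I y0|)%:E)%E.
Proof.
move=> intb b0; have mb := integrable_measurable _ _ intb.
have -> : inner b (psiI psi I) = inner b (fun y => psiI psi I y - psiI psi I y0).
  rewrite [RHS](_ : _ = (\int[mu]_y (b y * psiI psi I y - psiI psi I y0 * b y))%R); last first.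
    by apply: eq_Rintegral => y _; ring.
  rewrite RintegralB//; [|exact: integrableM_psiI|exact: integrableZ_EFin].
  by rewrite RintegralZl// b0 mulr0 subr0.
by apply: norm_inner_le => //; apply: measurable_funB.
Qed.

(** An l^1 majorant of the square root of [Sq]. It is subadditive in [b] and its integral is
    explicit, so the bad parts of a decomposition can simply be added up. *)
Definition coef_sum (s : seq dyadic) (b : R -> R) (x : R) : R :=
  \sum_(I <- s) `|inner b (psiI psi I)| * `|psiI psi I x|.

Lemma coef_sum_ge0 s b x : 0 <= coef_sum s b x.
Proof. by apply: sumr_ge0 => I _; rewrite mulr_ge0. Qed.

Lemma measurable_coef_sum s b : measurable_fun [set: R] (coef_sum s b).
Proof.
by apply: measurable_sum => I; apply: measurable_funM => //; exact: measurableT_comp.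
Qed.

Lemma integral_coef_sum (D : set R) s b : measurable D ->
  (\int[mu]_(x in D) (coef_sum s b x)%:E
   = (\sum_(I <- s) `|inner b (psiI psi I)| * tailI psi D I)%:E)%E.
Proof.
move=> mD; rewrite ge0_integral_sum_EFin//.
- rewrite -sumEFin; apply: eq_bigr => I _; rewrite ge0_integralZ//.
    by rewrite (tailIE psi C d)// -EFinM.
  by apply: measurableT_comp => //; apply: measurable_funTS; exact: mpsi.
- by move=> I; apply: measurable_funM => //; apply: measurableT_comp => //; apply: measurable_funTS; exact: mpsi.
Qed.

(** Exchanging the sum over wavelets with the integral over the support [Q] of [b] leaves, at each
    y, a regularity sum bounded by [M]. It serves twice: with [D] the complement of the triple and
    [M] the constant [kerc], and with [D] the whole line and [M] a multiple of the mesh. *)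
Lemma mean_zero_coef_sum (D : set R) (s : seq dyadic) (b : R -> R) (Q : set R) (y0 M : R) :
  measurable D -> mu.-integrable [set: R] (EFin \o b) -> (\int[mu]_x b x)%R = 0 ->
  (forall x, ~ Q x -> b x = 0) -> 0 <= M ->
  (forall y, Q y -> \sum_(I <- s) `|psiI psi I y - psiI psi I y0| * tailI psi D I <= M) ->
  (\int[mu]_(x in D) (coef_sum s b x)%:E <= M%:E * \int[mu]_x `|b x|%:E)%E.
Proof.
move=> mD intb b0 bQ M0 HM; have mb := integrable_measurable _ _ intb.
rewrite integral_coef_sum// -sumEFin.
have mF I : measurable_fun [set: R] (fun y => `|b y| * `|psiI psi I y - psiI psi I y0|).
  by apply: measurable_funM; apply: measurableT_comp => //; exact: measurable_funB.
have mF' I : measurable_fun [set: R]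
    (fun y => tailI psi D I * (`|b y| * `|psiI psi I y - psiI psi I y0|)).
  exact: measurable_funM.
apply: (@le_trans _ _ (\sum_(I <- s)
    \int[mu]_y (tailI psi D I * (`|b y| * `|psiI psi I y - psiI psi I y0|))%:E)%E).
  apply: lee_sum => I _; rewrite ge0_integralZ ?tailI_ge0//; last exact: mF.
  rewrite mulrC EFinM; by apply: lee_wpmul2l; rewrite ?lee_fin ?tailI_ge0//; exact: mean_zero_coef.
rewrite -ge0_integral_sum_EFin//; last first.
  by move=> I x; rewrite !mulr_ge0// tailI_ge0.
rewrite -ge0_integralZ//; last exact: measurableT_comp.
apply: ge0_le_integral_EFin => //.
- exact: measurable_sum.
- by apply: measurable_funM => //; exact: measurableT_comp.
- by move=> x; apply: sumr_ge0 => I _; rewrite !mulr_ge0// tailI_ge0.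
move=> x _; have [Qx|Qx] := pselect (Q x); last first.
  by rewrite bQ// normr0 mulr0 big1// => I _; rewrite mul0r mulr0.
rewrite (eq_bigr (fun I => `|b x| * (`|psiI psi I x - psiI psi I y0| * tailI psi D I))); last first.
  by move=> I _; ring.
by rewrite -mulr_sumr mulrC ler_wpM2r// HM.
Qed.

Definition rect (J K : seq int) : seq dyadic := [seq (j, k) | j <- J, k <- K].

Lemma kernel_sum_rect (J K : seq int) (h y y0 : R) : uniq J -> uniq K -> 0 < h ->
  y0 <= y < y0 + h ->
  \sum_(I <- rect J K) `|psiI psi I y - psiI psi I y0|
     * tailI psi (~` `[y0 - h, y0 + 2 * h[) I <= kerc C d.
Proof. by move=> *; rewrite big_allpairs; exact: kernel_sum. Qed.

(** A crude Lipschitz constant of the finite family, weighted by the L^1 norms. It grows with [s],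
    but it is only ever multiplied by an interval length that can be made small. *)
Definition lipc (s : seq dyadic) : R :=
  \sum_(I <- s) C * sdy I.1 * dy I.1 * tailI psi setT I.

Lemma lipc_ge0 s : 0 <= lipc s.
Proof.
by apply: sumr_ge0 => I _; rewrite !mulr_ge0 ?tailI_ge0 ?powR_ge0// ltW.
Qed.

Lemma lip_sum (s : seq dyadic) (h y y0 : R) : y0 <= y < y0 + h ->
  \sum_(I <- s) `|psiI psi I y - psiI psi I y0| * tailI psi setT I <= lipc s * h.
Proof.
move=> /andP[y1 y2]; rewrite mulr_suml; apply: ler_sum => -[j k] _ /=.
rewrite mulrAC ler_wpM2r ?tailI_ge0//.
apply: (le_trans (psiI_lip psi C d psiC1 C0 d0 psi'_decay _ _ _ _)).
rewrite ler_wpM2l ?mulr_ge0 ?powR_ge0 ?(ltW C0)//.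
rewrite ger0_norm ?subr_ge0// lerBlDl ltW//.
Qed.

Lemma kerc_ge0 : 0 <= kerc C d.
Proof.
have w1 := wtc_gt0 d d0; have w2 := wts_gt0 d d0; have g1 := geoc_gt0 d d0.
have g2 := @geoc_gt0 R 1 ltr01.
rewrite /kerc; apply: mulr_ge0; last by rewrite addr_ge0 ?ltW.
by do 3 (apply: mulr_ge0; last by rewrite ?powR_ge0 ?ltW); rewrite mulr_ge0 ?sqr_ge0.
Qed.

Definition cut (f : R -> R) (D : set R) (x : R) : R := f x * \1_D x.

Lemma integrable_cut f D : mu.-integrable [set: R] (EFin \o f) -> measurable D ->
  mu.-integrable [set: R] (EFin \o cut f D).
Proof.
move=> intf mD; apply: (@integrableM_bounded _ _ _ _ _ _ 1) => //.
by move=> x; rewrite indicE; case: (_ \in _); rewrite ?normr1 ?normr0.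
Qed.

Lemma integral_cut f D : measurable_fun [set: R] f -> measurable D ->
  (\int[mu]_x `|cut f D x|%:E = \int[mu]_(x in D) `|f x|%:E)%E.
Proof.
move=> mf mD; rewrite [RHS]integral_mkcond; apply: eq_integral => x _.
by rewrite /cut patchE indicE; case: ifP => _; rewrite ?mulr1// mulr0 normr0.
Qed.

(** Half-open, so that halving yields an exact partition. *)
Definition icoI (y0 h : R) : set R := `[y0, (y0 + h)%R[%classic.

Lemma measurable_icoI y0 h : measurable (icoI y0 h).
Proof. exact: measurable_itv. Qed.

Lemma lebesgue_icoI y0 h : 0 < h -> mu (icoI y0 h) = h%:E.
Proof.
move=> h0.
by rewrite /icoI lebesgue_measure_itv /= lte_fin ltrDl h0 -EFinD addrAC subrr add0r.
Qed.

(** The good part [g] is the mean of f over the interval times its indicator. The factor 2 for the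
    remainder is the triangle inequality, since averaging does not increase the L^1 norm. *)
Lemma mean_decomposition (f : R -> R) (m y0 h : R) :
  mu.-integrable [set: R] (EFin \o f) -> 0 < h ->
  (\int[mu]_(x in icoI y0 h) `|f x|%:E <= (m * h)%:E)%E ->
  exists g : R -> R, [/\ measurable_fun [set: R] g, (forall x, `|g x| <= m * \1_(icoI y0 h) x) &
    (\int[mu]_x `|g x|%:E <= \int[mu]_(x in icoI y0 h) `|f x|%:E)%E] /\
    let b x := cut f (icoI y0 h) x - g x in
    [/\ mu.-integrable [set: R] (EFin \o b), (\int[mu]_x b x)%R = 0,
      (forall x, ~ icoI y0 h x -> b x = 0) &
      (\int[mu]_x `|b x|%:E <= 2%:E * \int[mu]_(x in icoI y0 h) `|f x|%:E)%E].
Proof.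
move=> intf h0; set Q := icoI y0 h; set F := (\int[mu]_(x in Q) _)%E => FQ.
have mf := integrable_measurable _ _ intf.
have mnf : measurable_fun [set: R] (fun x => `|f x|) by exact: measurableT_comp.
have mQ : measurable Q by exact: measurable_itv.
have F0 : (0 <= F)%E by exact: integral_ge0.
have Ffin : F \is a fin_num.
  by rewrite ge0_fin_numE//; apply: (le_lt_trans FQ); rewrite ltry.
pose r := fine F; have Fr : F = r%:E by rewrite /r fineK.
have muQ : mu Q = h%:E by exact: lebesgue_icoI.
pose c := fine (\int[mu]_(x in Q) (f x)%:E)%E / h; pose g x := c * \1_Q x.
have intQ : mu.-integrable [set: R] (EFin \o \1_Q).
  exact: integrable_indic_itv.
have intg : mu.-integrable [set: R] (EFin \o g) by exact: integrableZ_EFin.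
have mg : measurable_fun [set: R] g by exact: integrable_measurable intg.
have intcf : mu.-integrable [set: R] (EFin \o cut f Q) by exact: integrable_cut.
have mcf := integrable_measurable _ _ intcf.
have cr : `|c| <= r / h.
  rewrite /c normrM (gtr0_norm (_ : 0 < h^-1)) ?invr_gt0// ler_wpM2r ?invr_ge0 ?(ltW h0)//.
  rewrite -lee_fin -Fr; apply: (@le_trans _ _ `|\int[mu]_(x in Q) (f x)%:E|%E).
    by case: (\int[mu]_(x in Q) _)%E => //=; rewrite normr0 leey.
  by apply: le_abse_integral => //; apply/measurable_EFinP; exact: measurable_funTS.
have gE x : `|g x| = `|c| * \1_Q x by rewrite /g normrM [`|\1_Q x|]ger0_norm.
have intb : mu.-integrable [set: R] (EFin \o (fun x => cut f Q x - g x)).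
  exact: integrableB_EFin.
have Ig : (\int[mu]_x `|g x|%:E <= F)%E.
  under eq_integral do rewrite gE.
  rewrite ge0_integralZ// integral_indic// setIT [X in (_ * X <= _)%E]muQ -EFinM.
  by rewrite Fr lee_fin -ler_pdivlMr.
exists g; split; split => //.
- move=> x; rewrite gE ler_wpM2r//.
  by apply: (le_trans cr); rewrite ler_pdivrMr// -lee_fin -Fr.
- rewrite RintegralB// /g RintegralZl//.
  rewrite [X in c * X](_ : _ = h); last by rewrite /Rintegral integral_indic// setIT [X in fine X]muQ.
  rewrite /c divfK ?gt_eqF//; apply/eqP; rewrite subr_eq0; apply/eqP.
  rewrite /Rintegral; congr fine; rewrite [RHS]integral_mkcond; apply: eq_integral => x _.
  by rewrite /cut patchE indicE; case: ifP => _; rewrite ?mulr1// mulr0.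
- by move=> x Qx; rewrite /cut /g indicE memNset// !mulr0 subr0.
apply: (@le_trans _ _ (\int[mu]_x (`|cut f Q x| + `|g x|)%:E)%E).
  apply: ge0_le_integral_EFin => //.
  - by apply: measurableT_comp => //; exact: integrable_measurable intb.
  - by apply: measurable_funD; exact: measurableT_comp.
  - by move=> x _; exact: ler_normB.
rewrite ge0_integralD_EFin//; [|exact: measurableT_comp|exact: measurableT_comp].
by rewrite integral_cut// -/F Fr -EFinM mulr_natl mulr2n EFinD -Fr leeD2l.
Qed.

(* The Calderon-Zygmund decomposition of [f] on [Q = [y0, y0 + h[ ]: halve the
   interval until either the average of [|f|] exceeds [lam] (and [Q] enters the
   exceptional set [E], enlarged to its triple) or the depth [n] is reached, in
   which case the smoothness of the finitely many [psiI] makes the error small.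
   All the estimates are additive over the two halves. *)
Lemma calderon_zygmund (J K : seq int) (f : R -> R) (lam : R) (n : nat) (y0 h : R) :
  uniq J -> uniq K -> 0 < lam -> mu.-integrable [set: R] (EFin \o f) -> 0 < h ->
  (\int[mu]_(x in icoI y0 h) `|f x|%:E <= (2 * lam * h)%:E)%E ->
  exists (g : R -> R) (E : set R), [/\ measurable_fun [set: R] g, measurable E &
      forall x, `|g x| <= 2 * lam * \1_(icoI y0 h) x] /\
    [/\ (\int[mu]_x `|g x|%:E <= \int[mu]_(x in icoI y0 h) `|f x|%:E)%E,
      (mu E <= (3 / lam)%:E * \int[mu]_(x in icoI y0 h) `|f x|%:E)%E &
      (\int[mu]_(x in ~` E) (coef_sum (rect J K) (fun x => cut f (icoI y0 h) x - g x) x)%:E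
       <= (2 * kerc C d + 2 * lipc (rect J K) * (h / 2 ^+ n))%:E
          * \int[mu]_(x in icoI y0 h) `|f x|%:E)%E].
Proof.
move=> uJ uK lam0 intf; have mf := integrable_measurable _ _ intf.
have mnf : measurable_fun [set: R] (fun x => `|f x|) by exact: measurableT_comp.
have k0 := kerc_ge0; have l0 := lipc_ge0 (rect J K).
elim: n y0 h => [|n IH] y0 h h0 FQ.
all: have [g [[mg gle Ig]] [intb b0 bQ Ib]] := mean_decomposition _ _ _ _ intf h0 FQ.
all: move: FQ gle Ig intb b0 bQ Ib; set Q := icoI y0 h; set F := (\int[mu]_(x in Q) _)%E.
all: move=> FQ gle Ig intb b0 bQ Ib.
all: have mQ : measurable Q by exact: measurable_icoI.
all: have F0 : (0 <= F)%E by exact: integral_ge0.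
all: have Ffin : F \is a fin_num by
  rewrite ge0_fin_numE//; apply: (le_lt_trans FQ); rewrite ltry.
all: pose r := fine F; have Fr : F = r%:E by rewrite /r fineK.
all: have r0 : 0 <= r by rewrite -lee_fin -Fr.
all: have hn m : 0 <= 2 * lipc (rect J K) * (h / 2 ^+ m) by
  apply: mulr_ge0; [exact: mulr_ge0|exact: divr_ge0 (ltW h0) (exprn_ge0 _ _)].
(* Stopping case: the average exceeds [lam], while the hypothesis of the recursion keeps it below
   [2 * lam]. The triple has length 3h, and lam * h < F makes this at most 3F / lam. *)
all: have bad m : lam * h < r -> exists (g : R -> R) (E : set R), [/\ measurable_fun [set: R] g, measurable E &
      forall x, `|g x| <= 2 * lam * \1_Q x] /\
    [/\ (\int[mu]_x `|g x|%:E <= F)%E, (mu E <= (3 / lam)%:E * F)%E &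
      (\int[mu]_(x in ~` E) (coef_sum (rect J K) (fun x => cut f Q x - g x) x)%:E
       <= (2 * kerc C d + 2 * lipc (rect J K) * (h / 2 ^+ m))%:E * F)%E].
1,3: move=> lr; exists g, `[y0 - h, y0 + 2 * h[%classic; split; first (by split); split => //;
  [by rewrite lebesgue_measure_itv /= lte_fin ifT; [rewrite Fr -EFinM lee_fin mulrAC ler_pdivlMr//; lra|lra]
  |apply: (@le_trans _ _ ((kerc C d)%:E * (2%:E * F))%E);
    [apply: (le_trans (mean_zero_coef_sum _ _ _ Q y0 (kerc C d) _ intb b0 bQ k0 _));
      [by apply: measurableC; exact: measurable_itv
      |by move=> y; rewrite /Q /icoI /= in_itv/= => yQ; exact: kernel_sum_rect
      |by apply: lee_wpmul2l; rewrite ?lee_fin]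
    |by rewrite muleA -EFinM; apply: lee_wpmul2r => //; rewrite lee_fin mulrC lerDl]].
all: have [|good] := ltP (lam * h) r; first exact: bad.
(* Depth exhausted without stopping: no exceptional set, and the remainder is controlled by
   [lip_sum] on the whole line. *)
- exists g, set0; split; first (by split); split => //.
    by rewrite measure0 mule_ge0// lee_fin; apply: divr_ge0 => //; exact: ltW.
  rewrite setC0; apply: (@le_trans _ _ ((lipc (rect J K) * h)%:E * (2%:E * F))%E).
    apply: (le_trans (mean_zero_coef_sum _ _ _ Q y0 (lipc (rect J K) * h) _ intb b0 bQ _ _)) => //.
    + by apply: mulr_ge0 => //; exact: ltW.
    + by move=> y; rewrite /Q /icoI /= in_itv/= => yQ; exact: lip_sum.
    + by apply: lee_wpmul2l; rewrite // lee_fin; apply: mulr_ge0 => //; exact: ltW.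
  rewrite muleA -EFinM; apply: lee_wpmul2r => //; rewrite lee_fin expr0 divr1; nra.
have h20 : 0 < h / 2 by rewrite divr_gt0.
pose Q1 := icoI y0 (h / 2); pose Q2 := icoI (y0 + h / 2) (h / 2).
have mQ1 : measurable Q1 by exact: measurable_itv.
have mQ2 : measurable Q2 by exact: measurable_itv.
have hh : y0 + h / 2 + h / 2 = y0 + h by field.
have QE : Q = Q1 `|` Q2.
  apply/seteqP; split => x; rewrite /Q /Q1 /Q2 /icoI /= !in_itv /= hh.
    by move=> /andP[x1 x2]; have [xh|xh] := ltP x (y0 + h / 2); [left|right]; apply/andP; split.
  by move=> [/andP[x1 x2]|/andP[x1 x2]]; apply/andP; split; lra.
have Q12 : [disjoint Q1 & Q2].
  rewrite disj_set2E; apply/eqP/seteqP; split => x //; rewrite /Q1 /Q2 /icoI /= !in_itv /=.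
  by move=> [/andP[x1 x2] /andP[x3 x4]]; lra.
have FE : F = ((\int[mu]_(x in Q1) `|f x|%:E) + \int[mu]_(x in Q2) `|f x|%:E)%E.
  rewrite /F QE ge0_integral_setU//.
  by apply/measurable_EFinP; exact: measurable_funTS.
set F1 := (\int[mu]_(x in Q1) _)%E in FE; set F2 := (\int[mu]_(x in Q2) _)%E in FE.
have F10 : (0 <= F1)%E by exact: integral_ge0.
have F20 : (0 <= F2)%E by exact: integral_ge0.
(* The average over the whole interval is at most [lam], hence over each half at most [2 * lam]: the
   hypothesis of the recursion is restored. *)
have B1 : (F1 <= (2 * lam * (h / 2))%:E)%E.
  apply: (@le_trans _ _ F); first by rewrite FE leeDl.
  by rewrite Fr lee_fin; apply: (le_trans good); rewrite le_eqVlt; apply/orP; left; apply/eqP; field.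
have B2 : (F2 <= (2 * lam * (h / 2))%:E)%E.
  apply: (@le_trans _ _ F); first by rewrite FE leeDr.
  by rewrite Fr lee_fin; apply: (le_trans good); rewrite le_eqVlt; apply/orP; left; apply/eqP; field.
have [g1 [E1 [[mg1 mE1 g1le] [Ig1 muE1 H1]]]] := IH y0 (h / 2) h20 B1.
have [g2 [E2 [[mg2 mE2 g2le] [Ig2 muE2 H2]]]] := IH (y0 + h / 2) (h / 2) h20 B2.
have intgi (gi : R -> R) (Fi : \bar R) : measurable_fun [set: R] gi ->
    (\int[mu]_x `|gi x|%:E <= Fi)%E -> (Fi <= F)%E -> mu.-integrable [set: R] (EFin \o gi).
  move=> mgi Igi FiF; apply: integrable_EFinP => //.
  by apply: (le_lt_trans Igi); apply: (le_lt_trans FiF); rewrite Fr ltry.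
have intg1 : mu.-integrable [set: R] (EFin \o g1) by apply: (intgi _ F1) => //; rewrite FE leeDl.
have intg2 : mu.-integrable [set: R] (EFin \o g2) by apply: (intgi _ F2) => //; rewrite FE leeDr.
have ind x : \1_Q x = \1_Q1 x + \1_Q2 x :> R.
  rewrite QE !indicE in_setU; case: (boolP (x \in Q1)) => x1; case: (boolP (x \in Q2)) => x2;
    rewrite /= ?addr0 ?add0r//.
  exfalso; move: Q12; rewrite disj_set2E => /eqP.
  by move: x1 x2; rewrite !inE => x1 x2 /seteqP[/(_ x) + _]; apply.
exists (fun x => g1 x + g2 x), (E1 `|` E2); split; split.
- exact: measurable_funD.
- exact: measurableU.
- by move=> x; apply: (le_trans (ler_normD _ _)); rewrite ind mulrDr lerD.
- apply: (@le_trans _ _ (\int[mu]_x (`|g1 x| + `|g2 x|)%:E)%E).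
    apply: ge0_le_integral_EFin => //.
    + by apply: measurableT_comp => //; exact: measurable_funD.
    + by apply: measurable_funD; exact: measurableT_comp.
    + by move=> x _; exact: ler_normD.
  rewrite ge0_integralD_EFin//; [|exact: measurableT_comp|exact: measurableT_comp].
  by rewrite FE leeD.
- apply: (@le_trans _ _ (mu E1 + mu E2)%E); first exact: measureU2.
  by rewrite FE ge0_muleDr// leeD.
pose b1 x := cut f Q1 x - g1 x; pose b2 x := cut f Q2 x - g2 x.
have intb1 : mu.-integrable [set: R] (EFin \o b1) by apply: integrableB_EFin => //; exact: integrable_cut.
have intb2 : mu.-integrable [set: R] (EFin \o b2) by apply: integrableB_EFin => //; exact: integrable_cut.
have bE I : inner (fun x => cut f Q x - (g1 x + g2 x)) (psiI psi I)
    = inner b1 (psiI psi I) + inner b2 (psiI psi I).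
  rewrite -innerD; [|exact: integrableM_psiI|exact: integrableM_psiI].
  congr inner; apply/funext => x; rewrite /b1 /b2 /cut ind; ring.
have le12 x : coef_sum (rect J K) (fun x => cut f Q x - (g1 x + g2 x)) x
    <= coef_sum (rect J K) b1 x + coef_sum (rect J K) b2 x.
  rewrite /coef_sum -big_split; apply: ler_sum => I _ /=; rewrite bE -mulrDl ler_wpM2r//.
  exact: ler_normD.
have mE : measurable (~` (E1 `|` E2)) by apply: measurableC; exact: measurableU.
have mcs b' : measurable_fun (~` (E1 `|` E2)) (coef_sum (rect J K) b').
  by apply: measurable_funTS; exact: measurable_coef_sum.
apply: (@le_trans _ _ (\int[mu]_(x in ~` (E1 `|` E2)) (coef_sum (rect J K) b1 x + coef_sum (rect J K) b2 x)%:E)%E).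
  apply: ge0_le_integral_EFin => //.
  - exact: mcs.
  - by apply: measurable_funD; exact: mcs.
  - by move=> x; exact: coef_sum_ge0.
rewrite ge0_integralD_EFin//; try (by move=> x; exact: coef_sum_ge0); try exact: mcs.
rewrite FE ge0_muleDr//; apply: leeD.
  apply: (@le_trans _ _ (\int[mu]_(x in ~` E1) (coef_sum (rect J K) b1 x)%:E)%E).
    apply: ge0_subset_integral => //; first exact: measurableC.
    - by apply/measurable_EFinP; apply: measurable_funTS; exact: measurable_coef_sum.
    - by move=> x _; rewrite lee_fin coef_sum_ge0.
    - by apply: subsetC; exact: subsetUl.
  by rewrite (_ : h / 2 ^+ n.+1 = h / 2 / 2 ^+ n); [exact: H1|rewrite exprS invfM mulrA].
apply: (@le_trans _ _ (\int[mu]_(x in ~` E2) (coef_sum (rect J K) b2 x)%:E)%E).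
  apply: ge0_subset_integral => //; first exact: measurableC.
  - by apply/measurable_EFinP; apply: measurable_funTS; exact: measurable_coef_sum.
  - by move=> x _; rewrite lee_fin coef_sum_ge0.
  - by apply: subsetC; exact: subsetUr.
by rewrite (_ : h / 2 ^+ n.+1 = h / 2 / 2 ^+ n); [exact: H2|rewrite exprS invfM mulrA].
Qed.

Lemma sum_sqr_le (s : seq dyadic) (a : dyadic -> R) : (forall I, 0 <= a I) ->
  \sum_(I <- s) a I ^+ 2 <= (\sum_(I <- s) a I) ^+ 2.
Proof.
move=> a0; elim: s => [|I s IH]; first by rewrite !big_nil expr0n.
rewrite !big_cons; have := a0 I.
have : 0 <= \sum_(J <- s) a J by exact: sumr_ge0.
by move: IH; set x := \sum_(J <- s) a J; set y := \sum_(J <- s) _; nra.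
Qed.

Lemma tail_integral_small (f : R -> R) (e : R) : mu.-integrable [set: R] (EFin \o f) -> 0 < e ->
  \forall n \near \oo, (\int[mu]_(x in ~` icoI (- n%:R) (2 * n%:R)) `|f x|%:E <= e%:E)%E.
Proof.
move=> intf e0; pose Q (n : nat) := icoI (- n%:R) (2 * n%:R : R).
have mf := integrable_measurable _ _ intf.
have mnf : measurable_fun [set: R] (fun x => `|f x|%:E).
  by apply/measurable_EFinP; exact: measurableT_comp.
have QE n x : Q n x <-> - n%:R <= x < n%:R.
  by rewrite /Q /icoI /= in_itv /= (_ : - n%:R + 2 * n%:R = n%:R)//; ring.
have mQ n : measurable (Q n) by exact: measurable_icoI.
have UQ : \bigcup_n Q n = setT.
  apply/seteqP; split => // x _; exists (Num.trunc `|x|).+1 => //; apply/QE.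
  have := truncnS_gt `|x|; rewrite ltr_norml => /andP[/ltW h1 h2]; exact/andP.
have : (\int[mu]_(x in Q n) `|f x|%:E)%E @[n --> \oo] --> (\int[mu]_x `|f x|%:E)%E.
  rewrite -[X in _ --> (\int[mu]_(x in X) _)%E]UQ; apply: ge0_nondecreasing_set_cvg_integral => //.
  - move=> m n mn; apply/subsetPset => x /QE/andP[x1 x2]; apply/QE.
    have : m%:R <= n%:R :> R by rewrite ler_nat.
    by move=> mn'; apply/andP; split; lra.
  - by move=> n; exact: measurable_funTS.
have fin : (\int[mu]_x `|f x|%:E)%E \is a fin_num.
  by rewrite ge0_fin_numE ?integrable_ltoo// integral_ge0.
have split n : (\int[mu]_x `|f x|%:E = \int[mu]_(x in Q n) `|f x|%:E + \int[mu]_(x in ~` Q n) `|f x|%:E)%E.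
  have mC : measurable (~` Q n) by exact: measurableC.
  have := ge0_integral_setU mu (mQ n) mC (f := fun x => `|f x|%:E).
  by rewrite setUv; apply => //; rewrite disj_set2E setICr.
rewrite -(fineK fin) => /fine_cvgP[_ /cvgrPdist_le /(_ _ e0)].
apply: filterS => n /=; rewrite distrC.
have fQ : (\int[mu]_(x in Q n) `|f x|%:E)%E \is a fin_num.
  rewrite ge0_fin_numE ?integral_ge0//; apply: le_lt_trans (integrable_ltoo _ _ intf).
  by rewrite (split n) leeDl ?integral_ge0.
have fQ' : (\int[mu]_(x in ~` Q n) `|f x|%:E)%E \is a fin_num.
  rewrite ge0_fin_numE ?integral_ge0//; apply: le_lt_trans (integrable_ltoo _ _ intf).
  by rewrite (split n) leeDr ?integral_ge0.
have -> : fine (\int[mu]_x `|f x|%:E)%E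
    = fine (\int[mu]_(x in Q n) `|f x|%:E)%E + fine (\int[mu]_(x in ~` Q n) `|f x|%:E)%E.
  by rewrite (split n) (fineD fQ fQ').
rewrite opprD addrA subrr sub0r normrN ger0_norm ?fine_ge0 ?integral_ge0//.
by rewrite -lee_fin fineK.
Qed.

(** Divided by [lam], the good part contributes 2, the exceptional set 3, and the bad part
    [2 * kerc C d + 1]. *)
Definition weakc : R := 2 * kerc C d + 6.

Lemma weakc_gt0 : 0 < weakc.
Proof. by have := kerc_ge0; rewrite /weakc; set k := kerc _ _; lra. Qed.

(** Write f = g + b1 + b2 with b2 the part outside a large interval and g + b1 the decomposition
    inside it. If [Sq] of g is at most lam^2 and the two [coef_sum] add up to at most lam, then [Sq]
    of f is at most 4 lam^2; this explains the threshold. The part b2 costs an arbitrarily small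
    e. *)
Lemma weak_type (J K : seq int) (f : R -> R) (lam : R) : uniq J -> uniq K -> 0 < lam ->
  mu.-integrable [set: R] (EFin \o f) ->
  (mu [set x | (4 * lam ^+ 2 < Sq psi (rect J K) f x)%R]
     <= (weakc / lam)%:E * \int[mu]_x `|f x|%:E)%E.
Proof.
move=> uJ uK lam0 intf; set s := rect J K; set F := (\int[mu]_x _)%E.
have mf := integrable_measurable _ _ intf.
have mnf : measurable_fun [set: R] (fun x => `|f x|) by exact: measurableT_comp.
have F0 : (0 <= F)%E by exact: integral_ge0.
have Fr : F = (fine F)%:E by rewrite fineK// ge0_fin_numE// integrable_ltoo.
set r := fine F in Fr; have r0 : 0 <= r by rewrite -lee_fin -Fr.
(* [D] bounds [coef_sum s] from L^1 to L^1 with no cancellation. It depends on the family, so it may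
   only meet the small tail b2; in the threshold below, [D + 1] avoids dividing by 0. *)
pose D := \sum_(I <- s) C * sdy I.1 * tailI psi setT I.
have D0 : 0 <= D.
  by apply: sumr_ge0 => I _; rewrite !mulr_ge0 ?tailI_ge0 ?powR_ge0// ltW.
apply/lee_addgt0Pr => e e0.
have e'0 : 0 < e * lam / (D + 1) by rewrite divr_gt0 ?mulr_gt0// ltr_wpDl.
have := tail_integral_small _ _ intf e'0.
(* The starting interval [-M, M) must be long enough for the average of |f| to satisfy the
   hypothesis of the recursion. *)
have nlarge : \forall n \near \oo, r / lam + 1 <= n%:R by exact: nbhs_infty_ger.
move=> /(filterI nlarge) [n0 _ /(_ n0 (leqnn _))] /= [].
set M : R := n0%:R => rM tailM.
have M0 : 0 < M by apply: lt_le_trans rM; rewrite ltr_wpDl// divr_ge0// ltW.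
pose Q := icoI (- M) (2 * M); have mQ : measurable Q by exact: measurable_icoI.
have M20 : 0 < 2 * M by rewrite mulr_gt0.
have FQ : (\int[mu]_(x in Q) `|f x|%:E <= F)%E.
  by apply: ge0_subset_integral => //; exact/measurable_EFinP.
have rlam : r <= lam * M.
  have : r / lam <= M by apply: le_trans rM; rewrite lerDl.
  by rewrite ler_pdivrMr// mulrC.
have FQ' : (\int[mu]_(x in Q) `|f x|%:E <= (2 * lam * (2 * M))%:E)%E.
  apply: (le_trans FQ); rewrite Fr lee_fin; apply: (le_trans rlam).
  by have := mulr_gt0 lam0 M0; lra.
(* Once the family and [M] are fixed, the depth makes the Lipschitz error at most 1, which is the
   [+ 1] in the bound of the bad part. *)
have [n nB] : exists n, 2 * lipc s * (2 * M / 2 ^+ n) <= 1.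
  have l0 := lipc_ge0 s.
  exists (Num.trunc (4 * lipc s * M)).+1; set n := (Num.trunc _).+1.
  rewrite (_ : 2 * lipc s * _ = (4 * lipc s * M) / 2 ^+ n); last by ring.
  rewrite ler_pdivrMr ?exprn_gt0// mul1r; apply: (@le_trans _ _ n%:R).
    by rewrite ltW// truncnS_gt.
  by rewrite -natrX ler_nat ltnW// ltn_expl.
have [g [E [[mg mE gle] [Ig muE H]]]] := calderon_zygmund J K f lam n _ _ uJ uK lam0 intf M20 FQ'.
pose b1 x := cut f Q x - g x; pose b2 := cut f (~` Q).
have mQc : measurable (~` Q) by exact: measurableC.
have intg : mu.-integrable [set: R] (EFin \o g).
  apply: integrable_EFinP => //; apply: (le_lt_trans Ig); apply: (le_lt_trans FQ).
  by rewrite Fr ltry.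
have intb2 : mu.-integrable [set: R] (EFin \o b2) by exact: integrable_cut.
have intb1 : mu.-integrable [set: R] (EFin \o b1).
  by apply: integrableB_EFin => //; exact: integrable_cut.
have fE I : inner f (psiI psi I) = inner g (psiI psi I) + (inner b1 (psiI psi I) + inner b2 (psiI psi I)).
  rewrite -innerD; [|exact: integrableM_psiI|exact: integrableM_psiI].
  rewrite -innerD; [|exact: integrableM_psiI|by apply: integrableM_psiI; exact: integrableD_EFin].
  congr inner; apply/funext => x; rewrite /b1 /b2 /cut !indicE in_setC.
  by case: (x \in Q) => /=; ring.
(* The good part stays quadratic, for Bessel's inequality; the bad parts pass from l^2 to l^1 by
   [sum_sqr_le]. *)
have SqE x : Sq psi s f x <= 2 * Sq psi s g x + 2 * (coef_sum s b1 x + coef_sum s b2 x) ^+ 2.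
  have -> : coef_sum s b1 x + coef_sum s b2 x = \sum_(I <- s)
      (`|inner b1 (psiI psi I)| + `|inner b2 (psiI psi I)|) * `|psiI psi I x|.
    by rewrite /coef_sum -big_split; apply: eq_bigr => I _; rewrite mulrDl.
  apply: (@le_trans _ _ (2 * Sq psi s g x + 2 * \sum_(I <- s)
      ((`|inner b1 (psiI psi I)| + `|inner b2 (psiI psi I)|) * `|psiI psi I x|) ^+ 2)); last first.
    by rewrite lerD2l ler_wpM2l// sum_sqr_le// => I; rewrite mulr_ge0// addr_ge0.
  rewrite /Sq !mulr_sumr -big_split; apply: ler_sum => I _ /=; rewrite fE.
  set u := inner g _; set v := inner b1 _; set w := inner b2 _.
  rewrite [X in _ <= _ + 2 * X]exprMn (real_normK (num_real (psiI psi I x))).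
  set q := psiI psi I x ^+ 2; have q0 : 0 <= q by exact: sqr_ge0.
  rewrite [leRHS](_ : _ = (2 * u ^+ 2 + 2 * (`|v| + `|w|) ^+ 2) * q); last by ring.
  rewrite ler_wpM2r//.
  apply: (@le_trans _ _ (2 * u ^+ 2 + 2 * (v + w) ^+ 2)).
    by have := sqr_ge0 (u - (v + w)); nra.
  rewrite lerD2l ler_wpM2l// -(real_normK (num_real (v + w))) ler_sqr ?nnegrE ?addr_ge0//.
  exact: ler_normD.
pose A1 := setT `&` [set x | (lam ^+ 2 < Sq psi s g x)%R].
pose A2 := ~` E `&` [set x | (lam < coef_sum s b1 x + coef_sum s b2 x)%R].
have mS h : measurable_fun [set: R] (Sq psi s h) by exact: measurable_Sq.
have mset (Z : set R) (h : R -> R) (t : R) : measurable Z -> measurable_fun [set: R] h ->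
    measurable (Z `&` [set x | (t < h x)%R]).
  move=> mZ mh; rewrite (_ : Z `&` _ = Z `&` [set x | (t%:E < (EFin \o h) x)%E]).
    by apply: emeasurable_fun_o_infty => //; apply/measurable_EFinP; exact: measurable_funTS.
  by apply/seteqP; split => x /= [? ?]; split; rewrite ?lte_fin// -lte_fin.
have mEc : measurable (~` E) by exact: measurableC.
have mcs b : measurable_fun [set: R] (coef_sum s b) by exact: measurable_coef_sum.
have mcs' b (Z : set R) : measurable_fun Z (coef_sum s b) by exact: measurable_funTS.
have mA1 : measurable A1 by exact: mset.
have mA2 : measurable A2 by apply: mset => //; exact: measurable_funD.
have cover : [set x | (4 * lam ^+ 2 < Sq psi s f x)%R] `<=` A1 `|` (E `|` A2).
  move=> x /= Sx; have [Ex|Ex] := pselect (E x); first by right; left.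
  have [gx|gx] := ltP (lam ^+ 2) (Sq psi s g x); first by left; split.
  right; right; split => //=; rewrite ltNge; apply/negP => bx.
  have b0 : 0 <= coef_sum s b1 x + coef_sum s b2 x by rewrite addr_ge0// coef_sum_ge0.
  have : (coef_sum s b1 x + coef_sum s b2 x) ^+ 2 <= lam ^+ 2.
    by rewrite ler_sqr ?nnegrE// ltW.
  by have := SqE x; move: Sx gx; set z := _ ^+ 2; lra.
have mL : measurable [set x | (4 * lam ^+ 2 < Sq psi s f x)%R].
  by rewrite -[X in measurable X]setTI; exact: mset.
apply: (@le_trans _ _ (mu A1 + (mu E + mu A2))%E).
  apply: (@le_trans _ _ (mu (A1 `|` (E `|` A2)))).
    apply: le_measure; rewrite ?inE//; do 2 apply: measurableU => //.
  apply: (le_trans (measureU2 _ _ _)) => //; first exact: measurableU.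
  by rewrite leeD2l//; exact: measureU2.
(* Chebyshev at lam^2, Bessel's inequality, and g^2 <= 2 lam |g| from the pointwise bound of the
   good part. *)
have P1 : (mu A1 <= (2 / lam)%:E * F)%E.
  apply: (le_trans (markov_EFin mu _ _ _ measurableT (mS g) (Sq_ge0 psi s g) _)).
    by rewrite exprn_gt0.
  have g2 : inLp 2 g.
    apply/inLp2P; split => //.
    apply: (@le_lt_trans _ _ (\int[mu]_x (2 * lam * `|g x|)%:E)%E).
      apply: ge0_le_integral_EFin => //.
      - exact: measurable_funX.
      - by apply: measurable_funM => //; exact: measurableT_comp.
      - by move=> x; exact: sqr_ge0.
      - move=> x _; rewrite -(real_normK (num_real (g x))) expr2 ler_wpM2r//.
        apply: (le_trans (gle x)); apply: ler_piMr; first by rewrite mulr_ge0 ?(ltW lam0).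
        by rewrite indicE; case: (_ \in _).
    rewrite ge0_integralZ ?mulr_ge0 ?(ltW lam0)//; last exact: measurableT_comp.
    by rewrite lte_mul_pinfty ?lee_fin ?mulr_ge0 ?(ltW lam0)// integrable_ltoo.
  rewrite integral_Sq//.
  apply: (@le_trans _ _ ((lam ^+ 2)^-1%:E * ((2 * lam)%:E * F))%E); last first.
    rewrite muleA -EFinM Fr -!EFinM lee_fin ler_wpM2r// le_eqVlt; apply/orP; left; apply/eqP.
    by field; rewrite gt_eqF.
  apply: lee_wpmul2l; first by rewrite lee_fin invr_ge0 exprn_ge0// ltW.
  apply: (le_trans (bessel psi psi_L2 psi_orth s g _ g2)).
    by apply: allpairs_uniq => // -[? ?] [? ?].
  apply: (@le_trans _ _ (\int[mu]_x (2 * lam * `|g x|)%:E)%E).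
    apply: ge0_le_integral_EFin => //.
    - exact: measurable_funX.
    - by apply: measurable_funM => //; exact: measurableT_comp.
    - by move=> x; exact: sqr_ge0.
    - move=> x _; rewrite -(real_normK (num_real (g x))) expr2 ler_wpM2r//.
      apply: (le_trans (gle x)); apply: ler_piMr; first by rewrite mulr_ge0 ?(ltW lam0).
      by rewrite indicE; case: (_ \in _).
  rewrite ge0_integralZ ?mulr_ge0 ?(ltW lam0)//; last exact: measurableT_comp.
  apply: lee_wpmul2l; first by rewrite lee_fin mulr_ge0// ltW.
  exact: (le_trans Ig FQ).
have P2 : (mu E <= (3 / lam)%:E * F)%E.
  by apply: (le_trans muE); apply: lee_wpmul2l => //; rewrite lee_fin divr_ge0// ltW.
have P3 : (mu A2 <= ((2 * kerc C d + 1) / lam)%:E * F + e%:E)%E.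
  have k0 := kerc_ge0.
  apply: (le_trans (markov_EFin mu _ (fun x => coef_sum s b1 x + coef_sum s b2 x) lam mEc _ _ lam0)).
  - by apply: measurable_funD; exact: mcs'.
  - by move=> x; rewrite addr_ge0// coef_sum_ge0.
  rewrite ge0_integralD_EFin//; try (by move=> x; exact: coef_sum_ge0); try exact: mcs'.
  rewrite ge0_muleDr ?integral_ge0//; try (by move=> x _; rewrite lee_fin coef_sum_ge0).
  apply: leeD.
    rewrite [_ / lam]mulrC EFinM -muleA; apply: lee_wpmul2l; first by rewrite lee_fin invr_ge0 ltW.
    apply: (le_trans H); apply: (@le_trans _ _ ((2 * kerc C d + 1)%:E * \int[mu]_(x in Q) `|f x|%:E)%E).
      by apply: lee_wpmul2r; rewrite ?integral_ge0// lee_fin lerD2l.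
    by apply: lee_wpmul2l; rewrite // lee_fin; move: k0; set k := kerc _ _; lra.
  apply: (@le_trans _ _ (lam^-1%:E * (D * (e * lam / (D + 1)))%:E)%E); last first.
    rewrite -EFinM lee_fin [leLHS](_ : _ = e * (D / (D + 1))).
      by rewrite ler_piMr ?(ltW e0)// ler_pdivrMr ?ltr_wpDl// mul1r lerDl.
    by field; rewrite !gt_eqF// ltr_wpDl.
  apply: lee_wpmul2l; first by rewrite lee_fin invr_ge0 ltW.
  rewrite integral_coef_sum// lee_fin mulr_suml; apply: ler_sum => I _.
  rewrite mulrAC ler_pM ?tailI_ge0//.
    rewrite -lee_fin; apply: (le_trans (norm_inner_le _ _ (integrable_measurable _ _ intb2) (mpsi I))).
    apply: (@le_trans _ _ (\int[mu]_x ((C * sdy I.1) * `|b2 x|)%:E)%E).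
      have mb2 := integrable_measurable _ _ intb2.
      apply: ge0_le_integral_EFin => //.
      - by apply: measurable_funM; apply: measurableT_comp => //; exact: mpsi.
      - by apply: measurable_funM => //; exact: measurableT_comp.
      - by move=> x _; rewrite mulrC ler_wpM2r// psiI_bounded.
    have Cs0 : 0 <= C * sdy I.1 by rewrite mulr_ge0 ?powR_ge0// ltW.
    rewrite ge0_integralZ//; last by apply: measurableT_comp => //; exact: integrable_measurable intb2.
    by rewrite [leRHS]EFinM; apply: lee_wpmul2l; rewrite ?lee_fin// integral_cut.
  rewrite /tailI; apply: fine_le.
  - by rewrite (tailIE psi C d).
  - by rewrite (tailIE psi C d).
  - by apply: integral_psiI_sub.
apply: (le_trans (leeD P1 (leeD P2 P3))).
rewrite Fr -!EFinM -!EFinD lee_fin /weakc le_eqVlt; apply/orP; left; apply/eqP.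
by field; rewrite gt_eqF.
Qed.

End WeakType.

(** * L^p estimates *)

Section RealInequalities.
Context {R : realType}.
Notation dy j := ((2 : R) `^ (j%:~R)).

Lemma dyadic_scale (y : R) : 0 < y -> exists n : int, dy n < y <= 2 * dy n.
Proof.
move=> y0; have l2 : 0 < ln (2 : R) by rewrite ln_gt0// ltr1n.
have E (n : int) : dy n = expR (n%:~R * ln 2).
  by rewrite /powR ifF//; apply/negbTE; rewrite pnatr_eq0.
pose n := Num.ceil (ln y / ln 2); exists (n - 1).
have /andP[h1 h2] : n%:~R - 1 < ln y / ln 2 <= (n%:~R : R).
  by have := ceil_itv (ln y / ln 2); rewrite intrD.
have -> : 2 * dy (n - 1) = dy n.
  rewrite intrD -[X in X * _](@powRr1 R 2)// -powRD_gt0//; congr (_ `^ _).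
  by rewrite addrC subrK.
rewrite !E -[X in _ < X <= _](lnK y0) ltr_expR ler_expR.
by rewrite -ltr_pdivlMr// -ler_pdivrMr// intrD h1.
Qed.

Lemma mem_window (N : nat) (n : int) : (n \in window N) = (- N%:Z <= n <= N%:Z).
Proof.
apply/mapP/idP => [[i]|].
  by rewrite mem_iota => + ->; lia.
move=> /andP[n1 n2]; exists (absz (n + N%:Z)); last by lia.
by rewrite mem_iota; lia.
Qed.

Lemma uniq_window (N : nat) : uniq (window N).
Proof. by rewrite map_inj_uniq ?iota_uniq// => i j; lia. Qed.

Lemma sub_window (N M : nat) : (N <= M)%N -> {subset window N <= window M}.
Proof. by move=> NM n; rewrite !mem_window; lia. Qed.

(** The convex function z^p lies above its tangent at A. Leaving [A] free, to be optimised later,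
    yields Jensen's and Hoelder's inequalities without normalising anything. *)
Lemma young_powR (p A z : R) : 1 <= p -> 0 < A -> 0 <= z ->
  p * A `^ (p - 1) * z <= z `^ p + (p - 1) * A `^ p.
Proof.
move=> p1 A0 z0; have [->|p1'] := eqVneq p 1.
  by rewrite subrr powRr0 mul0r addr0 powRr1// !mul1r.
have {p1 p1'}p1 : 1 < p by rewrite lt_neqAle eq_sym p1'.
have p0 : 0 < p by lra.
have q0 : 0 < p / (p - 1) by rewrite divr_gt0// subr_gt0.
have := @conjugate_powR R z (A `^ (p - 1)) p (p / (p - 1)) z0 (powR_ge0 _ _) p0 q0.
have -> : p^-1 + (p / (p - 1))^-1 = 1 by field; lra.
move=> /(_ erefl); rewrite -powRrM (_ : (p - 1) * _ = p); last by field; lra.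
move=> h; have := ler_wpM2l (ltW p0) h; rewrite mulrDr.
rewrite (_ : p * (_ / p) = z `^ p); last by field; lra.
rewrite (_ : p * (_ / (p / (p - 1))) = (p - 1) * A `^ p); last by field; lra.
by rewrite mulrA mulrAC.
Qed.

(** The weights have mass at most [M] rather than 1, hence the factor M^(r-1). *)
Lemma jensen_sum (T : Type) (s : seq T) (m z : T -> R) (M r : R) : 1 <= r ->
  (forall i, 0 <= m i) -> (forall i, 0 <= z i) -> 0 < M -> \sum_(i <- s) m i <= M ->
  (\sum_(i <- s) m i * z i) `^ r <= M `^ (r - 1) * \sum_(i <- s) m i * z i `^ r.
Proof.
move=> r1 m0 z0 M0 sM; set S := \sum_(i <- s) _; set Z := \sum_(i <- s) _.
have Z0 : 0 <= Z by apply: sumr_ge0 => i _; rewrite mulr_ge0 ?powR_ge0.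
have [->|S0] := eqVneq S 0.
  by rewrite powR0 ?mulr_ge0 ?powR_ge0// gt_eqF//; lra.
have {S0} S0 : 0 < S by rewrite lt_neqAle eq_sym S0 sumr_ge0// => i _; rewrite mulr_ge0.
(* Tangent point: the mean of the [z i] with respect to the total mass [M]. *)
pose A := S / M; have A0 : 0 < A by rewrite divr_gt0.
have H : r * A `^ (r - 1) * S <= Z + (r - 1) * A `^ r * M.
  apply: (@le_trans _ _ (Z + (r - 1) * A `^ r * \sum_(i <- s) m i)); last first.
    by rewrite lerD2l ler_wpM2l// mulr_ge0 ?powR_ge0//; lra.
  rewrite /S /Z !mulr_sumr -big_split; apply: ler_sum => i _ /=.
  have := ler_wpM2l (m0 i) (young_powR r A (z i) r1 A0 (z0 i)).
  by rewrite mulrDr; set a := A `^ _; set b := A `^ _; set c := _ `^ _; lra.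
have SA : S = A * M by rewrite /A divfK// gt_eqF.
have AA : A `^ r = A `^ (r - 1) * A.
  by rewrite -[X in _ * X]powRr1 ?(ltW A0)// -powRD_gt0// subrK.
have {}H : A `^ r * M <= Z.
  by move: H; rewrite SA AA; set a := A `^ _; nra.
rewrite SA powRM ?(ltW A0) ?(ltW M0)// (_ : M `^ r = M * M `^ (r - 1)); last first.
  by rewrite mulrC -[X in _ * X]powRr1 ?(ltW M0)// -powRD_gt0// subrK.
by rewrite mulrA mulrC ler_wpM2l// powR_ge0.
Qed.

(** Jensen's inequality for the weights v^r' and the values v^(1-r') u^2, where r' = r/(r-1).
    Raising the values to the power r produces v^(-r'), which cancels the weight. *)
Lemma hoelder_sum (T : Type) (s : seq T) (v u : T -> R) (M r : R) : 1 < r ->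
  (forall i, 0 <= v i) -> (forall i, 0 <= u i) -> 0 < M ->
  \sum_(i <- s) v i `^ (r / (r - 1)) <= M ->
  (\sum_(i <- s) v i * u i ^+ 2) `^ r <= M `^ (r - 1) * \sum_(i <- s) u i `^ (2 * r).
Proof.
move=> r1 v0 u0 M0 vM; set r' := r / (r - 1).
have r'0 : r' != 0 by rewrite gt_eqF// divr_gt0; lra.
have E i : v i * u i ^+ 2 = v i `^ r' * (v i `^ (1 - r') * u i ^+ 2).
  rewrite mulrA; congr (_ * _); have [->|vi] := eqVneq (v i) 0; first by rewrite powR0// mul0r.
  by rewrite -powRD_gt0 ?lt_neqAle ?v0 ?andbT 1?eq_sym// addrC subrK powRr1.
rewrite (eq_bigr _ (fun i _ => E i)).
apply: (@le_trans _ _ (M `^ (r - 1) * \sum_(i <- s) v i `^ r' * (v i `^ (1 - r') * u i ^+ 2) `^ r)).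
  apply: jensen_sum => //; first exact: ltW.
  - by move=> i; exact: powR_ge0.
  - by move=> i; rewrite mulr_ge0 ?powR_ge0// sqr_ge0.
rewrite ler_wpM2l ?powR_ge0//; apply: ler_sum => i _.
rewrite powRM ?powR_ge0 ?sqr_ge0// mulrA -powR_mulrn// -[X in _ * X]powRrM.
rewrite ler_piMl ?powR_ge0//.
have [->|vi] := eqVneq (v i) 0; first by rewrite powR0// mul0r.
rewrite -powRrM -powRD_gt0 ?lt_neqAle ?v0 ?andbT 1?eq_sym//.
by rewrite (_ : r' + _ = 0) ?powRr0// /r'; field; lra.
Qed.

End RealInequalities.

(** * Dyadic layer-cake bound *)

Section LayerCake.
Context {d} {T : measurableType d} {R : realType} (mu : {measure set T -> \bar R}).
Notation dy j := ((2 : R) `^ (j%:~R)).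

Lemma measurable_gt (g : T -> R) (t : R) : measurable_fun [set: T] g ->
  measurable [set x | (t < g x)%R].
Proof.
move=> mg; rewrite (_ : [set x | _] = setT `&` [set x | (t%:E < (EFin \o g) x)%E]).
  by apply: emeasurable_fun_o_infty => //; exact/measurable_EFinP.
by rewrite setTI; apply/seteqP; split => x /=; rewrite lte_fin.
Qed.

(** Where 2^n < g <= 2^(n+1), the single layer n already dominates, as g^q <= 2^q 2^(nq). *)
Lemma le_layers (g : T -> R) (q : R) (B : \bar R) : measurable_fun [set: T] g ->
  (forall x, 0 <= g x) -> 0 < q ->
  (forall N, \sum_(n <- window N) (2 `^ q * dy n `^ q)%:E * mu [set x | (dy n < g x)%R] <= B)%E ->
  (\int[mu]_x (g x `^ q)%:E <= B)%E.
Proof.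
move=> mg g0 q0 HB.
(* On [A N] the relevant layer has its index in [window N], so a finite sum suffices; monotone
   convergence then removes the truncation. The zeros of g are never in [A N], but contribute 0
   since q > 0. *)
pose A N := [set x | ((2 : R) ^- N < g x <= 2 ^+ N)%R].
have mA N : measurable (A N).
  rewrite (_ : A N = [set x | ((2 : R) ^- N < g x)%R] `\` [set x | (2 ^+ N < g x)%R]).
    by apply: measurableD; exact: measurable_gt.
  apply/seteqP; split => x; rewrite /A /=.
    by move=> /andP[-> h]; split => //; apply/negP; rewrite -leNgt.
  by move=> [-> /negP]; rewrite -leNgt.
pose phi N x := (g x `^ q * \1_(A N) x)%:E.
have mgq : measurable_fun [set: T] (fun x => g x `^ q).
  by apply: (measurableT_comp (measurable_powR q)).
have mphi N : measurable_fun [set: T] (phi N).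
  by apply/measurable_EFinP; apply: measurable_funM.
have phi0 N x : setT x -> (0 <= phi N x)%E by move=> _; rewrite lee_fin mulr_ge0 ?powR_ge0.
have sub m n : (m <= n)%N -> A m `<=` A n.
  move=> mn x /andP[h1 h2]; apply/andP; split.
    by apply: le_lt_trans h1; rewrite lef_pV2 ?posrE ?exprn_gt0// ler_weXn2l// ler1n.
  by apply: (le_trans h2); rewrite ler_weXn2l// ler1n.
have nd x : setT x -> nondecreasing_seq (phi ^~ x).
  move=> _ m n mn; rewrite lee_fin ler_wpM2l ?powR_ge0// !indicE.
  case: (boolP (x \in A m)) => // /set_mem /(sub _ _ mn) xA.
  by rewrite (mem_set xA).
have lim x : limn (phi ^~ x) = (g x `^ q)%:E.
  apply: cvg_lim => //; have [gx|gx] := eqVneq (g x) 0.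
    rewrite (_ : phi ^~ x = cst (g x `^ q)%:E); first exact: cvg_cst.
    by apply/funext => N; rewrite /phi gx powR0 ?mul0r// gt_eqF.
  have {gx} gx : 0 < g x by rewrite lt_neqAle eq_sym gx g0.
  apply: cvg_near_cst.
  exists (maxn (Num.trunc (g x)).+1 (Num.trunc (g x)^-1).+1) => // N /=.
  rewrite geq_max => /andP[N1 N2].
  have le2 (k : nat) (y : R) : 0 <= y -> ((Num.trunc y).+1 <= k)%N -> y < 2 ^+ k.
    move=> y0 yk; apply: (lt_le_trans (truncnS_gt y)); rewrite -natrX ler_nat.
    by apply: (leq_trans yk); rewrite ltnW// ltn_expl.
  rewrite /phi indicE mem_set ?mulr1//; apply/andP; split.
    by rewrite invf_plt ?posrE ?exprn_gt0//; apply: le2 => //; rewrite invr_ge0.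
  by rewrite ltW//; exact: le2.
rewrite -(eq_integral _ _ (fun x _ => lim x)) monotone_convergence//.
apply: lime_le.
  apply: ereal_nondecreasing_is_cvgn => m n mn; apply: ge0_le_integral => //; [exact: phi0|].
  by move=> x _; exact: nd.
apply: nearW => N; apply: le_trans (HB N).
have mI n : measurable_fun [set: T] (fun x => 2 `^ q * dy n `^ q * \1_[set x | (dy n < g x)%R] x).
  by apply: measurable_funM => //; apply: measurable_indic; exact: measurable_gt.
apply: (@le_trans _ _ (\int[mu]_x (\sum_(n <- window N)
    2 `^ q * dy n `^ q * \1_[set x | (dy n < g x)%R] x)%:E)%E); last first.
  rewrite ge0_integral_sum_EFin//.
  apply: lee_sum => n _; rewrite ge0_integralZ//.
  - by rewrite integral_indic ?setIT//; exact: measurable_gt.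
  - by apply: measurable_indic; exact: measurable_gt.
apply: ge0_le_integral_EFin => //.
- by apply: measurable_funM.
- exact: measurable_sum.
- by move=> x; rewrite mulr_ge0 ?powR_ge0.
move=> x _; rewrite indicE; have [xA|xA] := boolP (x \in A N); last first.
  by rewrite mulr0; apply: sumr_ge0 => n _; rewrite !mulr_ge0 ?powR_ge0.
move: xA => /set_mem /= /andP[h1 h2].
have gx : 0 < g x by apply: lt_trans h1; rewrite invr_gt0 exprn_gt0.
have [n /andP[n1 n2]] := dyadic_scale _ gx.
have l1 (a b : int) : dy a < dy b -> a < b.
  move=> ab; rewrite ltNge; apply/negP => ba; move: ab; rewrite ltNge.
  by rewrite ler_powR ?ler1n// ler_int.
have nN : n \in window N.
  have dN : dy N%:Z = 2 ^+ N by rewrite powR_mulrn.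
  have dNn : dy (- N%:Z) = 2 ^- N by rewrite rmorphN powR_invn.
  have d1 : 2 * dy n = dy (n + 1).
    by rewrite intrD powRD_gt0// powRr1// mulrC.
  have : n < N%:Z by apply: l1; rewrite dN; exact: lt_le_trans n1 h2.
  have : - N%:Z < n + 1 by apply: l1; rewrite dNn -d1; exact: lt_le_trans h1 n2.
  by rewrite mem_window; lia.
rewrite mulr1 (perm_big _ (perm_to_rem nN)).
rewrite big_cons /= indicE mem_set// mulr1.
rewrite -[leLHS]addr0; apply: lerD.
  by rewrite -powRM ?powR_ge0// ler_powR2 ?(ltW q0) ?(ltW gx).
by apply: sumr_ge0 => k _; rewrite !mulr_ge0 ?powR_ge0.
Qed.

End LayerCake.

(** * Hoelder's inequality against a weight of finite mass *)

Section WeightedHoelder.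
Context {d} {T : measurableType d} {R : realType} (mu : {measure set T -> \bar R}).

Lemma measurable_norm_powR (f : T -> R) (p : R) : measurable_fun [set: T] f ->
  measurable_fun [set: T] (fun x => `|f x| `^ p).
Proof.
move=> mf; apply: (measurableT_comp (measurable_powR p)).
exact: measurableT_comp.
Qed.

(** Integrates the tangent inequality [young_powR] against [w] at the point A with A^p = (phi +
    e)/W. The real [X] stands below the integral of |f| w so that no finiteness has to be
    established first. *)
Lemma hoelder_weight (f w : T -> R) (p W phi X : R) : 1 <= p -> 0 < W ->
  measurable_fun [set: T] f -> measurable_fun [set: T] w ->
  (forall x, 0 <= w x) -> (\int[mu]_x (w x)%:E <= W%:E)%E ->
  (\int[mu]_x (`|f x| `^ p * w x)%:E <= phi%:E)%E ->
  0 <= X -> (X%:E <= \int[mu]_x (`|f x| * w x)%:E)%E ->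
  X `^ p <= phi * W `^ (p - 1).
Proof.
move=> p1 W0 mf mw w0 IW Iphi X0 IX.
have mnf : measurable_fun [set: T] (fun x => `|f x|) by exact: measurableT_comp.
have mfp := measurable_norm_powR f p mf.
have phi0 : 0 <= phi.
  by rewrite -lee_fin; apply: le_trans Iphi; apply: integral_ge0 => x _; rewrite lee_fin mulr_ge0 ?powR_ge0.
have p0 : 0 < p by lra.
apply/ler_addgt0Pr => e' e'0.
(* The perturbation [e] keeps the tangent point positive when [phi] is 0. *)
pose e := e' / W `^ (p - 1); have e0 : 0 < e by rewrite divr_gt0// powR_gt0.
have -> : phi * W `^ (p - 1) + e' = (phi + e) * W `^ (p - 1).
  by rewrite mulrDl /e divfK// gt_eqF// powR_gt0.
have pe0 : 0 < phi + e by rewrite ltr_wpDl.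
pose A := ((phi + e) / W) `^ p^-1; have A0 : 0 < A by rewrite powR_gt0// divr_gt0.
have AE : A `^ p = (phi + e) / W.
  by rewrite /A -powRrM mulVf ?gt_eqF// powRr1// divr_ge0// ltW.
have Ap1 : 0 < A `^ (p - 1) by exact: powR_gt0.
have H : p * A `^ (p - 1) * X <= p * (phi + e).
  rewrite -lee_fin; apply: (@le_trans _ _ (\int[mu]_x (`|f x| `^ p * w x + (p - 1) * A `^ p * w x)%:E)%E).
    rewrite EFinM; apply: (@le_trans _ _ ((p * A `^ (p - 1))%:E * \int[mu]_x (`|f x| * w x)%:E)%E).
      by apply: lee_wpmul2l => //; rewrite lee_fin mulr_ge0// ltW.
    rewrite -ge0_integralZ//; first last.
    - by move=> x; rewrite mulr_ge0.
    - exact: measurable_funM.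
    - by rewrite mulr_ge0// ltW.
    apply: ge0_le_integral_EFin => //.
    - by apply: measurable_funM => //; exact: measurable_funM.
    - by apply: measurable_funD; exact: measurable_funM.
    - by move=> x; rewrite !mulr_ge0// ltW.
    move=> x _; rewrite mulrA -mulrDl ler_wpM2r//.
    exact: young_powR.
  have c0 : 0 <= (p - 1) * A `^ p by rewrite mulr_ge0 ?powR_ge0// subr_ge0.
  rewrite ge0_integralD_EFin//; try (exact: measurable_funM);
    try (by move=> x; rewrite mulr_ge0 ?powR_ge0).
  rewrite ge0_integralZ//.
  have -> : p * (phi + e) = (phi + e) + ((p - 1) * A `^ p) * W.
    by rewrite AE; field; rewrite gt_eqF.
  rewrite EFinD; apply: leeD; last by rewrite [leRHS]EFinM; apply: lee_wpmul2l.
  by apply: (le_trans Iphi); rewrite lee_fin lerDl ltW.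
have {}H : X <= (phi + e) / A `^ (p - 1).
  by rewrite ler_pdivlMr// -(ler_pM2l p0) (_ : p * (X * _) = p * A `^ (p - 1) * X)//; ring.
apply: (le_trans (ler_powR2 _ _ _ (ltW p0) X0 H)).
rewrite powRM ?invr_ge0 ?powR_ge0 ?(ltW pe0)// -powR_inv1 ?powR_ge0//.
rewrite -!powRrM (_ : (p - 1) * (-1 * p) = p * (1 - p)); last by ring.
rewrite [p^-1 * _](_ : _ = 1 - p); last by field; rewrite gt_eqF.
rewrite powRM ?invr_ge0 ?(ltW pe0) ?(ltW W0)// mulrA -powRD_gt0//.
rewrite [_ + (1 - p)]addrC subrK powRr1 ?(ltW pe0)//.
by rewrite -powR_inv1 ?(ltW W0)// -powRrM (_ : -1 * _ = p - 1)//; ring.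
Qed.

End WeightedHoelder.

(** * Rank one operators and the contribution of the means *)

Section LpEstimates.
Context {R : realType}.
Notation mu := (@lebesgue_measure R).
Notation dy j := ((2 : R) `^ (j%:~R)).
Notation sdy j := ((2 : R) `^ (j%:~R / 2)).
Variables (psi : R -> R) (C d : R).
Hypothesis psiC1 : C1 psi.
Hypothesis C0 : 0 < C.
Hypothesis d0 : 0 < d.
Hypothesis psi_decay : forall x, `|psi x| <= C * wt (2 * d) x.
Hypothesis psi'_decay : forall x, `|derive1 psi x| <= C * wt (2 * d) x.
Hypothesis psi_L2 : forall I, inLp 2 (psiI psi I).
Hypothesis psi_orth : forall I J, inner (psiI psi I) (psiI psi J) = (I == J)%:R.

Let mpsi := measurable_psiI psi psiC1.
Let wc0 : 0 < wtc d := wtc_gt0 d d0.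

(** As 0 < [wt] <= 1, its p-th power is below itself, so the constant [wtc d] serves for every p >=
    1. *)
Lemma integral_psiI_powR (p : R) I : 1 <= p ->
  (\int[mu]_x (`|psiI psi I x| `^ p)%:E <= (C `^ p * sdy I.1 `^ p * (wtc d / dy I.1))%:E)%E.
Proof.
move=> p1; have p0 : 0 <= p by lra.
case: I => j k /=; have Cs : 0 <= C * sdy j by rewrite mulr_ge0 ?powR_ge0// ltW.
apply: (@le_trans _ _ (\int[mu]_x ((C * sdy j) `^ p * wt d (dy j * x - k%:~R))%:E)%E).
  apply: ge0_le_integral_EFin => //.
  - by apply: measurable_norm_powR; exact: mpsi.
  - by apply: measurable_funM => //; exact: measurable_wt_affine.
  move=> x _; have w0 := wt_ge0 d (dy j * x - k%:~R).
  have w1 : wt d (dy j * x - k%:~R) <= 1 by rewrite wt_le1// ltW.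
  have := ler_powR2 _ _ _ p0 (normr_ge0 _) (psiI_le psi C d C0 d0 psi_decay j k x).
  move=> /le_trans; apply; rewrite powRM//; apply: ler_wpM2l; first exact: powR_ge0.
  by apply: ge1r_powR => //; rewrite wt_gt0.
rewrite ge0_integralZ ?powR_ge0//; [|exact: measurable_wt_affine|by move=> x; exact: wt_ge0].
rewrite [leRHS]EFinM -powRM ?powR_ge0 ?(ltW C0)//; apply: lee_wpmul2l; first by rewrite lee_fin powR_ge0.
by apply: integral_wt_affine => //; exact: dy_gt0.
Qed.

(** Hoelder's inequality with the decay weight of the wavelet as measure; its mass is at most wtc d
    / 2^j. *)
Lemma coef_powR (f : R -> R) (p phi : R) I : 1 <= p -> measurable_fun [set: R] f ->
  (\int[mu]_x (`|f x| `^ p)%:E <= phi%:E)%E ->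
  `|inner f (psiI psi I)| `^ p <= C `^ p * sdy I.1 `^ p * (phi * (wtc d / dy I.1) `^ (p - 1)).
Proof.
move=> p1 mf Iphi; have p0 : 0 <= p by lra.
case: I => j k /=; have Cs : 0 < C * sdy j by rewrite mulr_gt0 ?powR_gt0.
have mw := measurable_wt_affine d (dy j) k%:~R.
have w0 x := wt_ge0 d (dy j * x - k%:~R).
pose X := `|inner f (psiI psi (j, k))| / (C * sdy j).
have X0 : 0 <= X by rewrite divr_ge0// ltW.
have -> : `|inner f (psiI psi (j, k))| = (C * sdy j) * X by rewrite /X mulrC divfK// gt_eqF.
have <- : (C * sdy j) `^ p = C `^ p * sdy j `^ p by rewrite powRM ?powR_ge0 ?(ltW C0).
rewrite powRM ?(ltW Cs)//; apply: ler_wpM2l; first exact: powR_ge0.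
apply: (@hoelder_weight _ _ _ mu f (fun x => wt d (dy j * x - k%:~R))) => //.
- by rewrite divr_gt0// powR_gt0.
- by apply: integral_wt_affine => //; exact: dy_gt0.
- apply: le_trans Iphi; apply: ge0_le_integral_EFin => //.
  + by apply: measurable_funM => //; exact: measurable_norm_powR.
  + exact: measurable_norm_powR.
  + by move=> x; rewrite mulr_ge0 ?powR_ge0.
  + by move=> x _; rewrite ler_piMr ?powR_ge0// wt_le1// ltW.
have mnf : measurable_fun [set: R] (fun x => `|f x|) by exact: measurableT_comp.
rewrite -(@lee_pmul2l _ (C * sdy j)%:E) ?lte_fin// -EFinM {1}/X mulrCA divff ?gt_eqF// mulr1.
apply: (le_trans (norm_inner_le _ _ mf (mpsi (j, k)))).
rewrite -ge0_integralZ ?(ltW Cs)//; last 2 first.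
- exact: measurable_funM.
- by move=> x; rewrite mulr_ge0.
apply: ge0_le_integral_EFin => //.
- by apply: measurable_funM => //; apply: measurableT_comp => //; exact: mpsi.
- by apply: measurable_funM => //; exact: measurable_funM.
- by move=> x _; rewrite mulrCA ler_wpM2l// psiI_le.
Qed.

(** Jensen's inequality with the weights [m] reduces the claim to uniform bounds for the single
    operators f -> c_I psi_I. *)
Lemma mean_Lp (s : seq dyadic) (m : dyadic -> R) (L : R) (f : R -> R) (p : R) :
  1 <= p -> (forall I, 0 <= m I) -> 0 < L -> \sum_(I <- s) m I <= L ->
  measurable_fun [set: R] f -> (\int[mu]_x (`|f x| `^ p)%:E < +oo)%E ->
  (\int[mu]_x ((\sum_(I <- s) m I * (`|inner f (psiI psi I)| * `|psiI psi I x|)) `^ p)%:E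
    <= (C `^ p * C `^ p * wtc d `^ p * L `^ p)%:E * \int[mu]_x (`|f x| `^ p)%:E)%E.
Proof.
move=> p1 m0 L0 sL mf fp; have p0 : 0 <= p by lra.
have If0 : (0 <= \int[mu]_x (`|f x| `^ p)%:E)%E.
  by apply: integral_ge0 => x _; rewrite lee_fin powR_ge0.
have : (\int[mu]_x (`|f x| `^ p)%:E)%E \is a fin_num by rewrite ge0_fin_numE.
move=> /fineK; set phi := fine _ => Ephi; rewrite -Ephi.
have phi0 : 0 <= phi by rewrite -lee_fin Ephi.
have mnpsi I : measurable_fun [set: R] (fun x => `|psiI psi I x|) by exact: measurableT_comp.
have mS : measurable_fun [set: R]
    (fun x => \sum_(I <- s) m I * (`|inner f (psiI psi I)| * `|psiI psi I x|)).
  by apply: measurable_sum => I; apply: measurable_funM => //; exact: measurable_funM.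
have mz I : measurable_fun [set: R] (fun x => (`|inner f (psiI psi I)| * `|psiI psi I x|) `^ p).
  by apply: (measurableT_comp (measurable_powR p)); exact: measurable_funM.
apply: (@le_trans _ _ (\int[mu]_x (\sum_(I <- s) (L `^ (p - 1) * m I)
    * (`|inner f (psiI psi I)| * `|psiI psi I x|) `^ p)%:E)%E).
  apply: ge0_le_integral_EFin => //.
  - exact: (measurableT_comp (measurable_powR p)).
  - by apply: measurable_sum => I; apply: measurable_funM => //; exact: mz.
  - by move=> x; exact: powR_ge0.
  move=> x _; apply: (le_trans (jensen_sum _ s m _ L p p1 m0 _ L0 sL)).
    by move=> I; rewrite mulr_ge0.
  by rewrite mulr_sumr; under eq_bigr do rewrite mulrA.
rewrite ge0_integral_sum_EFin//; last 2 first.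
- by move=> I; apply: measurable_funM => //; exact: mz.
- by move=> I x; rewrite !mulr_ge0 ?powR_ge0.
pose c := C `^ p * C `^ p * wtc d `^ p * phi.
have c0 : 0 <= c by rewrite !mulr_ge0 ?powR_ge0.
apply: (@le_trans _ _ (\sum_(I <- s) ((L `^ (p - 1) * m I) * c)%:E)%E); last first.
  rewrite sumEFin lee_fin -mulr_suml -mulr_sumr.
  have -> : L `^ p = L `^ (p - 1) * L.
    by rewrite -[X in _ * X]powRr1 ?(ltW L0)// -powRD_gt0// subrK.
  rewrite [leRHS](_ : _ = L `^ (p - 1) * L * c); last by rewrite /c; ring.
  by rewrite ler_wpM2r// ler_wpM2l// powR_ge0.
apply: lee_sum => I _; rewrite ge0_integralZ ?mulr_ge0 ?powR_ge0//; last exact: mz.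
rewrite [leRHS]EFinM; apply: lee_wpmul2l; first by rewrite lee_fin mulr_ge0 ?powR_ge0.
under eq_integral do rewrite powRM//.
rewrite ge0_integralZ ?powR_ge0//; last by apply: measurable_norm_powR; exact: mpsi.
apply: (@le_trans _ _ ((C `^ p * sdy I.1 `^ p * (phi * (wtc d / dy I.1) `^ (p - 1)))%:E *
   (C `^ p * sdy I.1 `^ p * (wtc d / dy I.1))%:E)%E).
  apply: lee_pmul.
  - by rewrite lee_fin powR_ge0.
  - by apply: integral_ge0 => x _; rewrite lee_fin powR_ge0.
  - by apply: coef_powR => //; rewrite -Ephi.
  - exact: integral_psiI_powR.
rewrite -EFinM lee_fin le_eqVlt; apply/orP; left; apply/eqP.
have Wd : 0 < wtc d / dy I.1 by rewrite divr_gt0// powR_gt0.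
transitivity (C `^ p * C `^ p * phi * ((sdy I.1 `^ p * sdy I.1 `^ p) *
   ((wtc d / dy I.1) `^ (p - 1) * (wtc d / dy I.1)))); first by ring.
rewrite [_ `^ (p - 1) * _]mulrC (mulr_powRB1 (ltW Wd)); last by lra.
(* The two factors 2^(jp/2) cancel against 2^(-jp): the rank one operators are bounded uniformly in
   the scale. *)
have -> : sdy I.1 `^ p * sdy I.1 `^ p * (wtc d / dy I.1) `^ p = wtc d `^ p.
  rewrite -powRM ?powR_ge0// sdyM -powRM ?powR_ge0 ?(ltW Wd)//.
  by rewrite mulrC divfK// gt_eqF// powR_gt0.
by rewrite /c; ring.
Qed.

End LpEstimates.

(** * Interpolation for the square function and for the coefficients *)

Section Marcinkiewicz.
Context {R : realType}.
Notation mu := (@lebesgue_measure R).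
Notation dy j := ((2 : R) `^ (j%:~R)).
Notation sdy j := ((2 : R) `^ (j%:~R / 2)).
Variables (psi : R -> R) (C d : R).
Hypothesis psiC1 : C1 psi.
Hypothesis C0 : 0 < C.
Hypothesis d0 : 0 < d.
Hypothesis psi_decay : forall x, `|psi x| <= C * wt (2 * d) x.
Hypothesis psi'_decay : forall x, `|derive1 psi x| <= C * wt (2 * d) x.
Hypothesis psi_L2 : forall I, inLp 2 (psiI psi I).
Hypothesis psi_orth : forall I J, inner (psiI psi I) (psiI psi J) = (I == J)%:R.

Let mpsi := measurable_psiI psi psiC1.
Let wc0 : 0 < wtc d := wtc_gt0 d d0.
Let wk0 : 0 < weakc C d := weakc_gt0 C d d0.

Definition above (f : R -> R) (t : R) : set R := [set x | (t < `|f x|)%R].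

Lemma measurable_above (f : R -> R) (t : R) : measurable_fun [set: R] f ->
  measurable (above f t).
Proof. by move=> mf; apply: measurable_gt; exact: measurableT_comp. Qed.

Lemma measurable_cut (f : R -> R) (A : set R) : measurable_fun [set: R] f -> measurable A ->
  measurable_fun [set: R] (cut f A).
Proof. by move=> mf mA; exact: measurable_funM. Qed.

Lemma inLp2_cut (f : R -> R) (A : set R) : inLp 2 f -> measurable A -> inLp 2 (cut f A).
Proof.
move=> /inLp2P[mf If] mA; have mc := measurable_cut f A mf mA.
apply/inLp2P; split => //; apply: le_lt_trans If.
apply: ge0_le_integral_EFin => //; try exact: measurable_funX.
- by move=> x; exact: sqr_ge0.
- move=> x _; rewrite /cut indicE; case: (_ \in _); rewrite ?mulr1// mulr0 expr0n/=.
  exact: sqr_ge0.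
Qed.

(** On the set where |f| > t one has |f| <= f^2 / t. *)
Lemma integrable_above (f : R -> R) (t : R) : 0 < t -> inLp 2 f ->
  mu.-integrable [set: R] (EFin \o cut f (above f t)).
Proof.
move=> t0 /inLp2P[mf If]; have mA := measurable_above f t mf.
have mc := measurable_cut f _ mf mA.
apply: integrable_EFinP => //.
apply: (@le_lt_trans _ _ (\int[mu]_x (t^-1 * f x ^+ 2)%:E)%E).
  apply: ge0_le_integral_EFin => //.
  - exact: measurableT_comp.
  - by apply: measurable_funM => //; exact: measurable_funX.
  move=> x _; rewrite /cut indicE; have [xA|xA] := boolP (x \in above f t).
    move: xA => /set_mem; rewrite /above /= => tf.
    by rewrite mulr1 mulrC ler_pdivlMr// -real_normK ?num_real// expr2 ler_wpM2l// ltW.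
  by rewrite mulr0 normr0 mulr_ge0 ?sqr_ge0// invr_ge0 ltW.
rewrite ge0_integralZ ?invr_ge0 ?(ltW t0)//; last 2 first.
- exact: measurable_funX.
- by move=> x; exact: sqr_ge0.
by rewrite lte_mul_pinfty// lee_fin invr_ge0 ltW.
Qed.

Lemma cutDC (f : R -> R) (A : set R) x : cut f A x + cut f (~` A) x = f x.
Proof. by rewrite /cut !indicE in_setC; case: (x \in A); rewrite /= ?mulr1 ?mulr0 ?addr0 ?add0r. Qed.

Lemma inner_cutDC (f : R -> R) (A : set R) I : inLp 2 f -> measurable A ->
  inner f (psiI psi I) = inner (cut f A) (psiI psi I) + inner (cut f (~` A)) (psiI psi I).
Proof.
move=> f2 mA; rewrite -innerD.
- by congr inner; apply/funext => x; rewrite cutDC.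
- by apply: integrableM_inLp2 => //; exact: inLp2_cut.
- by apply: integrableM_inLp2 => //; apply: inLp2_cut => //; exact: measurableC.
Qed.

(** At y = |f(x)| the first term is the weak type cost of the part of f above height t, the second
    the Bessel cost of the part below. *)
Definition level_bound (y t : R) : R :=
  (4 * weakc C d / t) * (y * (t < y)%R%:R) + (4 / t ^+ 2) * (y ^+ 2 * (y <= t)%R%:R).

Lemma level_set (J K : seq int) (f : R -> R) (t : R) : uniq J -> uniq K -> 0 < t ->
  inLp 2 f ->
  (mu [set x | (t ^+ 2 < Sq psi (rect J K) f x)%R]
     <= \int[mu]_x (level_bound `|f x| t)%:E)%E.
Proof.
move=> uJ uK t0 f2; have [mf _] := f2; set s := rect J K.
pose A := above f t; have mA : measurable A by exact: measurable_above.
have mAc : measurable (~` A) by exact: measurableC.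
have intf1 : mu.-integrable [set: R] (EFin \o cut f A) by exact: integrable_above.
have f22 : inLp 2 (cut f (~` A)) by exact: inLp2_cut.
have mS h : measurable_fun [set: R] (Sq psi s h) by exact: measurable_Sq.
have mc1 := measurable_cut f A mf mA; have mc2 := measurable_cut f _ mf mAc.
(* Both thresholds equal t^2/4; they are written differently to match [weak_type] with lam = t/4 and
   Chebyshev's inequality. *)
have cover : [set x | (t ^+ 2 < Sq psi s f x)%R] `<=`
    [set x | (4 * (t / 4) ^+ 2 < Sq psi s (cut f A) x)%R] `|`
    ([set: R] `&` [set x | (t ^+ 2 / 4 < Sq psi s (cut f (~` A)) x)%R]).
  move=> x /= Sx; have [h1|h1] := ltP (4 * (t / 4) ^+ 2) (Sq psi s (cut f A) x); first by left.
  right; split => //; rewrite /= ltNge; apply/negP => h2; move: Sx; rewrite ltNge => /negP; apply.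
  apply: (@le_trans _ _ (2 * Sq psi s (cut f A) x + 2 * Sq psi s (cut f (~` A)) x)).
    rewrite /Sq !mulr_sumr -big_split; apply: ler_sum => I _ /=.
    rewrite (inner_cutDC f A)//; set u := inner _ _; set v := inner _ _.
    rewrite [leRHS](_ : _ = (2 * u ^+ 2 + 2 * v ^+ 2) * psiI psi I x ^+ 2); last by ring.
    by apply: ler_wpM2r; [exact: sqr_ge0|have := sqr_ge0 (u - v); nra].
  rewrite [leRHS](_ : _ = 2 * (4 * (t / 4) ^+ 2) + 2 * (t ^+ 2 / 4)); last by field.
  by rewrite lerD// ler_wpM2l.
have m1 := measurable_gt (Sq psi s (cut f A)) (4 * (t / 4) ^+ 2) (mS _).
have m2 := measurable_gt (Sq psi s (cut f (~` A))) (t ^+ 2 / 4) (mS _).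
apply: (@le_trans _ _ (mu ([set x | (4 * (t / 4) ^+ 2 < Sq psi s (cut f A) x)%R] `|`
    ([set: R] `&` [set x | (t ^+ 2 / 4 < Sq psi s (cut f (~` A)) x)%R])))).
  apply: le_measure => //; rewrite inE; first exact: (measurable_gt _ _ (mS f)).
  by rewrite setTI; exact: measurableU.
apply: (le_trans (measureU2 _ _ _)); rewrite ?setTI//.
have ind1 x : `|cut f A x| = `|f x| * (t < `|f x|)%R%:R.
  rewrite /cut indicE normrM; congr (_ * _).
  have -> : (x \in A) = (t < `|f x|) by apply/idP/idP => [/set_mem//|h]; exact/mem_set.
  by case: (_ < _); rewrite ?normr1 ?normr0.
have ind2 x : cut f (~` A) x ^+ 2 = `|f x| ^+ 2 * (`|f x| <= t)%R%:R.
  rewrite /cut indicE exprMn real_normK ?num_real//; congr (_ * _).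
  have -> : (x \in ~` A) = (`|f x| <= t).
    rewrite in_setC leNgt; congr (~~ _).
    by apply/idP/idP => [/set_mem//|h]; exact/mem_set.
  by case: (_ <= _); rewrite ?expr1n ?expr0n.
have c10 : 0 <= 4 * weakc C d / t by rewrite divr_ge0 ?mulr_ge0// ltW.
have c20 : 0 <= 4 / t ^+ 2 by rewrite divr_ge0// sqr_ge0.
rewrite /level_bound; under eq_integral do rewrite -ind1 -ind2.
rewrite ge0_integralD_EFin//; first last.
- by move=> x; rewrite mulr_ge0// sqr_ge0.
- by move=> x; rewrite mulr_ge0.
- by apply: measurable_funM => //; exact: measurable_funX.
- by apply: measurable_funM => //; exact: measurableT_comp.
rewrite !ge0_integralZ//; first last.
- exact: measurableT_comp.
- by move=> x; exact: sqr_ge0.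
- exact: measurable_funX.
apply: leeD.
  have t40 : 0 < t / 4 by rewrite divr_gt0.
  apply: (le_trans (weak_type psi C d psiC1 C0 d0 psi_decay psi'_decay psi_L2 psi_orth J K _ _ uJ uK t40 intf1)).
  rewrite (_ : weakc C d / (t / 4) = 4 * weakc C d / t)//.
  by field; rewrite gt_eqF.
have t20 : 0 < t ^+ 2 / 4 by rewrite divr_gt0// exprn_gt0.
have := markov_EFin mu _ _ _ measurableT (mS (cut f (~` A))) (Sq_ge0 psi s _) t20.
rewrite setTI => /le_trans; apply; rewrite invf_div.
apply: lee_wpmul2l => //; rewrite integral_Sq//; apply: bessel => //.
by apply: allpairs_uniq => // -[? ?] [? ?].
Qed.

Definition sqc (p : R) : R := 2 `^ p * (4 * weakc C d * geoc (p - 1) + 4 * geoc (2 - p)).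

(** For fixed y the levels below y sum 2^(n(p-1)) and those above sum 2^(-n(2-p)). Both series are
    geometric for 1 < p < 2 and are dominated by the levels near y. *)
Lemma sum_level_bound (p y : R) (s : seq int) : 1 < p < 2 -> 0 <= y -> uniq s ->
  \sum_(n <- s) 2 `^ p * dy n `^ p * level_bound y (dy n) <= sqc p * y `^ p.
Proof.
move=> /andP[p1 p2] y0 us; have [->|yn] := eqVneq y 0.
  rewrite powR0 ?mulr0; last by rewrite gt_eqF//; lra.
  by rewrite big1// => n _; rewrite /level_bound expr0n !mul0r !mulr0 addr0 mulr0.
have {yn} y0 : 0 < y by rewrite lt_neqAle eq_sym yn.
have E n : 2 `^ p * dy n `^ p * level_bound y (dy n)
    = 2 `^ p * (4 * weakc C d * y * (dy n `^ (p - 1) * (dy n < y)%R%:R)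
       + 4 * y ^+ 2 * (dy n `^ (- (2 - p)) * (y <= dy n)%R%:R)).
  have -> : dy n `^ (- (2 - p)) = dy n `^ p / dy n ^+ 2.
    by rewrite -powR_invn ?powR_ge0// -powRD_gt0 ?dy_gt0//; congr (_ `^ _); ring.
  have -> : dy n `^ (p - 1) = dy n `^ p / dy n.
    by rewrite -[X in _ / X]powRr1 ?powR_ge0// -powRN -powRD_gt0 ?dy_gt0.
  by rewrite /level_bound; field; rewrite gt_eqF// dy_gt0.
rewrite (eq_bigr _ (fun n _ => E n)) -mulr_sumr /sqc -[leRHS]mulrA.
apply: ler_wpM2l; first exact: powR_ge0.
rewrite big_split /= -!mulr_sumr [leRHS]mulrDl; apply: lerD.
  have := sum_dyadic_le (p - 1) y s; rewrite subr_gt0 => /(_ p1 y0 us) H.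
  apply: (@le_trans _ _ (4 * weakc C d * y * (geoc (p - 1) * y `^ (p - 1)))); last first.
    rewrite -[y `^ p](mulr_powRB1 (ltW y0)); last by lra.
    by rewrite le_eqVlt; apply/orP; left; apply/eqP; ring.
  rewrite ler_wpM2l ?mulr_ge0 ?(ltW y0) ?(ltW wk0)//; apply: le_trans H.
  rewrite [leRHS]big_mkcond; apply: ler_sum => n _; case: (ltP (dy n) y) => [/ltW ->|_].
    by rewrite mulr1.
  by rewrite mulr0; case: ifP => // _; exact: powR_ge0.
have := sum_dyadic_ge (2 - p) y s; rewrite subr_gt0 => /(_ p2 y0 us) H.
apply: (@le_trans _ _ (4 * y ^+ 2 * (geoc (2 - p) * y `^ (- (2 - p))))); last first.
  have -> : y `^ p = y ^+ 2 * y `^ (- (2 - p)).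
    by rewrite -powR_mulrn ?(ltW y0)// -powRD_gt0//; congr (_ `^ _); ring.
  by rewrite le_eqVlt; apply/orP; left; apply/eqP; ring.
apply: ler_wpM2l; first by rewrite mulr_ge0 ?sqr_ge0.
apply: le_trans H.
rewrite [leRHS]big_mkcond; apply: ler_sum => n _; case: (leP y (dy n)) => _.
  by rewrite mulr1.
by rewrite mulr0.
Qed.

Lemma measurable_level_bound (f : R -> R) (t : R) : measurable_fun [set: R] f ->
  measurable_fun [set: R] (fun x => level_bound `|f x| t).
Proof.
move=> mf; have mnf : measurable_fun [set: R] (fun x => `|f x|) by exact: measurableT_comp.
apply: measurable_funD; apply: measurable_funM => //; apply: measurable_funM => //.
- rewrite (_ : (fun _ => _) = \1_(above f t)).
    by apply: measurable_indic; exact: measurable_above.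
  apply/funext => x; rewrite indicE; congr (nat_of_bool _)%:R.
  by apply/idP/idP => [h|/set_mem//]; exact/mem_set.
- exact: measurable_funX.
rewrite (_ : (fun _ => _) = \1_(~` above f t)).
  by apply: measurable_indic; apply: measurableC; exact: measurable_above.
apply/funext => x; rewrite indicE in_setC leNgt; congr (nat_of_bool (~~ _))%:R.
by apply/idP/idP => [h|/set_mem//]; exact/mem_set.
Qed.

Lemma level_bound_ge0 (y t : R) : 0 <= y -> 0 < t -> 0 <= level_bound y t.
Proof.
move=> y0 t0; apply: addr_ge0; apply: mulr_ge0.
- by apply: divr_ge0; [apply: mulr_ge0 => //|]; exact: ltW.
- by rewrite mulr_ge0.
- by apply: divr_ge0 => //; exact: sqr_ge0.
- by apply: mulr_ge0 => //; exact: sqr_ge0.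
Qed.

(** The layer-cake bound for the square root of [Sq], with [level_set] at each dyadic height;
    exchanging sum and integral leaves [sum_level_bound] at every point. *)
Lemma Sq_Lp (J K : seq int) (f : R -> R) (p : R) : uniq J -> uniq K -> 1 < p < 2 ->
  inLp 2 f ->
  (\int[mu]_x (Sq psi (rect J K) f x `^ (p / 2))%:E
    <= (sqc p)%:E * \int[mu]_x (`|f x| `^ p)%:E)%E.
Proof.
move=> uJ uK /[dup] p12 /andP[p1 p2] f2; have [mf _] := f2; set s := rect J K.
have p0 : 0 < p by lra.
have mS : measurable_fun [set: R] (Sq psi s f) by exact: measurable_Sq.
have S0 x := Sq_ge0 psi s f x.
pose g x := Sq psi s f x `^ 2^-1.
have gE x : Sq psi s f x `^ (p / 2) = g x `^ p.
  by rewrite /g -powRrM; congr (_ `^ _); field.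
under eq_integral do rewrite gE.
apply: le_layers => //.
- exact: (measurableT_comp (measurable_powR _)).
- by move=> x; exact: powR_ge0.
move=> N.
have lE n : [set x | (dy n < g x)%R] = [set x | (dy n ^+ 2 < Sq psi s f x)%R].
  apply/seteqP; split => x; rewrite /= /g powR12_sqrt//.
    move=> h; rewrite -(sqr_sqrtr (S0 x)) ltr_sqr ?nnegrE ?powR_ge0 ?sqrtr_ge0//.
  move=> h; rewrite -(ltr_sqr (_ : dy n \in Num.nneg)) ?nnegrE ?powR_ge0 ?sqrtr_ge0//.
  by rewrite sqr_sqrtr.
have ml n : measurable_fun [set: R] (fun x => level_bound `|f x| (dy n)).
  exact: measurable_level_bound.
have l0 n (x : R) : 0 <= level_bound `|f x| (dy n).
  by apply: level_bound_ge0 => //; exact: dy_gt0.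
apply: (@le_trans _ _ (\sum_(n <- window N) \int[mu]_x (2 `^ p * dy n `^ p * level_bound `|f x| (dy n))%:E)%E).
  apply: lee_sum => n _; rewrite ge0_integralZ ?mulr_ge0 ?powR_ge0//; last exact: ml.
  apply: lee_wpmul2l; first by rewrite lee_fin mulr_ge0 ?powR_ge0.
  by rewrite lE; apply: level_set => //; exact: dy_gt0.
rewrite -ge0_integral_sum_EFin//; last 2 first.
- by move=> n; apply: measurable_funM => //; exact: ml.
- by move=> n x; rewrite !mulr_ge0 ?powR_ge0.
have g1 : 0 < geoc (p - 1) by rewrite geoc_gt0// subr_gt0.
have g2 : 0 < geoc (2 - p) by rewrite geoc_gt0// subr_gt0.
have sq0 : 0 <= sqc p.
  apply: mulr_ge0; first exact: powR_ge0.
  apply: addr_ge0; last by apply: mulr_ge0 => //; exact: ltW.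
  by apply: mulr_ge0; [apply: mulr_ge0 => //|]; exact: ltW.
rewrite -ge0_integralZ//; last exact: measurable_norm_powR.
apply: ge0_le_integral_EFin => //.
- by apply: measurable_sum => n; apply: measurable_funM => //; exact: ml.
- by apply: measurable_funM => //; exact: measurable_norm_powR.
- by move=> x; apply: sumr_ge0 => n _; rewrite !mulr_ge0 ?powR_ge0.
by move=> x _; apply: sum_level_bound => //; exact: uniq_window.
Qed.

(** The factor 2^(j/2) compensates the L^1 norm of the wavelet, of order 2^(-j/2). *)
Lemma coef_bounded (h : R -> R) (B : R) I : 0 <= B -> measurable_fun [set: R] h ->
  (forall x, `|h x| <= B) -> `|inner h (psiI psi I)| * sdy I.1 <= B * (C * wtc d).
Proof.
move=> B0 mh hB; case: I => j k /=.
have mp : measurable_fun [set: R] (fun x => `|psiI psi (j, k) x|).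
  by apply: measurableT_comp => //; exact: mpsi.
rewrite -ler_pdivlMr ?powR_gt0// -lee_fin.
apply: (le_trans (norm_inner_le _ _ mh (mpsi (j, k)))).
apply: (@le_trans _ _ (\int[mu]_x (B * `|psiI psi (j, k) x|)%:E)%E).
  apply: ge0_le_integral_EFin => //.
  - by apply: measurable_funM => //; exact: measurableT_comp.
  - exact: measurable_funM.
  - by move=> x _; rewrite ler_wpM2r.
rewrite ge0_integralZ// -mulrA [leRHS]EFinM; apply: lee_wpmul2l => //.
exact: integral_psiI.
Qed.

(** 2^p is the loss from rounding to dyadic levels, 4 comes from squaring half a level, [geoc] sums
    the levels, and the last factor is a^(-(p-2)) for the truncation ratio [a] in the proof of
    [seq_Lp]. *)
Definition seqc (p : R) : R := 2 `^ p * 4 * geoc (p - 2) * (2 * (C * wtc d)) `^ (p - 2).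

(* Marcinkiewicz interpolation between Bessel's inequality and the trivial bound
   [coef_bounded] for the coefficients weighted by the length of the intervals. *)
Lemma seq_Lp (s : seq dyadic) (f : R -> R) (p : R) : uniq s -> 2 < p -> inLp 2 f ->
  ((\sum_(I <- s) (`|inner f (psiI psi I)| * sdy I.1) `^ p / dy I.1)%:E
    <= (seqc p)%:E * \int[mu]_x (`|f x| `^ p)%:E)%E.
Proof.
move=> us p2 f2; have [mf _] := f2; have p0 : 0 < p by lra.
pose v I := `|inner f (psiI psi I)| * sdy I.1.
have v0 I : 0 <= v I by rewrite mulr_ge0// powR_ge0.
(* Each wavelet receives the dyadic level of its normalised coefficient; the level is arbitrary when
   the coefficient vanishes. *)
have /choice[n nP] I : exists n : int, 0 < v I -> dy n < v I <= 2 * dy n.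
  have [vI|vI] := ltP 0 (v I); last by exists 0.
  by have [n hn] := dyadic_scale _ vI; exists n.
(* By [coef_bounded], the part of f below height a 2^m contributes at most 2^m / 2 to a normalised
   coefficient. *)
pose a := (2 * (C * wtc d))^-1; have CW : 0 < C * wtc d by rewrite mulr_gt0.
have a0 : 0 < a by rewrite invr_gt0 mulr_gt0.
pose h (m : int) := cut f (above f (a * dy m)).
have mAb m : measurable (above f (a * dy m)) by exact: measurable_above.
have h2 m : inLp 2 (h m) by exact: inLp2_cut.
have term I : v I `^ p / dy I.1 <= 2 `^ p * 4 * (dy (n I) `^ (p - 2) * inner (h (n I)) (psiI psi I) ^+ 2).
  have [vI|vI] := ltP 0 (v I); last first.
    have -> : v I = 0 by apply/eqP; rewrite eq_le vI v0.
    rewrite powR0 ?gt_eqF// mul0r; apply: mulr_ge0; first by rewrite mulr_ge0 ?powR_ge0.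
    by rewrite mulr_ge0 ?powR_ge0 ?sqr_ge0.
  have /andP[n1 n2] := nP I vI; set m := n I in n1 n2 *.
  have dm : 0 < dy m by exact: dy_gt0.
  (* The coefficient exceeds 2^m, so at least half of that must come from the part of f above the
     height. *)
  have low : dy m / 2 <= `|inner (h m) (psiI psi I)| * sdy I.1.
    have lowc : `|inner (cut f (~` above f (a * dy m))) (psiI psi I)| * sdy I.1 <= dy m / 2.
      have -> : dy m / 2 = (a * dy m) * (C * wtc d).
        by rewrite /a; field; rewrite gt_eqF// gt_eqF.
      apply: coef_bounded.
      - by rewrite mulr_ge0// ltW.
      - by apply: measurable_cut => //; exact: measurableC.
      - move=> x; rewrite /cut indicE in_setC; have [xA|xA] /= := boolP (x \in above f (a * dy m)).
          by rewrite mulr0 normr0 mulr_ge0// ltW.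
        by rewrite mulr1 leNgt; apply: contra xA => ?; exact/mem_set.
    have : v I <= `|inner (h m) (psiI psi I)| * sdy I.1
        + `|inner (cut f (~` above f (a * dy m))) (psiI psi I)| * sdy I.1.
      rewrite -mulrDl /v ler_wpM2r ?powR_ge0//.
      by rewrite (inner_cutDC f (above f (a * dy m)))//; exact: ler_normD.
    by lra.
  have up : v I `^ p <= 2 `^ p * dy m `^ p.
    rewrite -(powRM p (ler0n R 2) (ltW dm)); apply: ler_powR2; [exact: ltW|exact: v0|exact: n2].
  have sq : dy m ^+ 2 <= 4 * (inner (h m) (psiI psi I) ^+ 2 * dy I.1).
    have : (dy m / 2) ^+ 2 <= (`|inner (h m) (psiI psi I)| * sdy I.1) ^+ 2.
      by rewrite ler_sqr ?nnegrE ?divr_ge0 ?mulr_ge0 ?powR_ge0// ltW.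
    rewrite [X in _ <= X]exprMn real_normK ?num_real// [sdy _ ^+ 2]expr2 sdyM => hh.
    by have := ler_wpM2l (_ : 0 <= 4) hh; rewrite (_ : 4 * (dy m / 2) ^+ 2 = dy m ^+ 2); [apply|field].
  rewrite ler_pdivrMr ?dy_gt0//; apply: (le_trans up).
  have -> : dy m `^ p = dy m `^ (p - 2) * dy m ^+ 2.
    by rewrite -powR_mulrn ?(ltW dm)// -powRD_gt0// subrK.
  rewrite [leRHS](_ : _ = 2 `^ p * (dy m `^ (p - 2) * (4 * (inner (h m) (psiI psi I) ^+ 2 * dy I.1)))); last by ring.
  by rewrite ler_wpM2l ?powR_ge0// ler_wpM2l ?powR_ge0.
pose ns := undup (map n s).
have uns : uniq ns by exact: undup_uniq.
have G0 m I : 0 <= dy m `^ (p - 2) * inner (h m) (psiI psi I) ^+ 2.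
  by rewrite mulr_ge0 ?powR_ge0 ?sqr_ge0.
(* Each wavelet needs only its own level, but it is counted at every level in [ns]; the inner sum is
   then a full Bessel sum for the truncation [h m]. *)
have S1 : \sum_(I <- s) v I `^ p / dy I.1
    <= 2 `^ p * 4 * \sum_(m <- ns) dy m `^ (p - 2) * \sum_(I <- s) inner (h m) (psiI psi I) ^+ 2.
  under [X in _ <= _ * X]eq_bigr do rewrite mulr_sumr.
  rewrite exchange_big /= mulr_sumr [leLHS]big_seq [leRHS]big_seq; apply: ler_sum => I sI.
  apply: (le_trans (term I)); rewrite ler_wpM2l ?mulr_ge0 ?powR_ge0//.
  have nI : n I \in ns by rewrite mem_undup; apply: map_f.
  rewrite (perm_big _ (perm_to_rem nI)) big_cons /= lerDl.
  by apply: sumr_ge0 => m _; exact: G0.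
apply: (@le_trans _ _ ((2 `^ p * 4)%:E * \sum_(m <- ns) \int[mu]_x (dy m `^ (p - 2) * h m x ^+ 2)%:E)%E).
  apply: (@le_trans _ _ (2 `^ p * 4 * \sum_(m <- ns) dy m `^ (p - 2) * \sum_(I <- s) inner (h m) (psiI psi I) ^+ 2)%:E).
    by rewrite lee_fin.
  rewrite EFinM; apply: lee_wpmul2l; first by rewrite lee_fin mulr_ge0 ?powR_ge0.
  rewrite -sumEFin; apply: lee_sum => m _; have [mh _] := h2 m.
  rewrite ge0_integralZ ?powR_ge0//; last 2 first.
  - exact: measurable_funX.
  - by move=> x; exact: sqr_ge0.
  by rewrite EFinM; apply: lee_wpmul2l; [rewrite lee_fin powR_ge0|exact: bessel].
have mh2 m : measurable_fun [set: R] (fun x => dy m `^ (p - 2) * h m x ^+ 2).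
  by have [mh _] := h2 m; apply: measurable_funM => //; exact: measurable_funX.
rewrite -ge0_integral_sum_EFin//; last first.
  by move=> m x; rewrite mulr_ge0 ?powR_ge0 ?sqr_ge0.
have g0 : 0 < geoc (p - 2) by rewrite geoc_gt0// subr_gt0.
have sc : seqc p = 2 `^ p * 4 * (geoc (p - 2) * (2 * (C * wtc d)) `^ (p - 2)).
  by rewrite /seqc; ring.
have k0 : 0 <= geoc (p - 2) * (2 * (C * wtc d)) `^ (p - 2).
  by apply: mulr_ge0; [exact: ltW|exact: powR_ge0].
rewrite sc [X in (_ <= X * _)%E]EFinM -muleA; apply: lee_wpmul2l.
  by rewrite lee_fin mulr_ge0 ?powR_ge0.
rewrite -ge0_integralZ//; last exact: measurable_norm_powR.
apply: ge0_le_integral_EFin => //.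
- exact: measurable_sum.
- by apply: measurable_funM => //; exact: measurable_norm_powR.
- by move=> x; apply: sumr_ge0 => m _; rewrite mulr_ge0 ?powR_ge0 ?sqr_ge0.
move=> x _; have [fx|fx] := eqVneq (f x) 0.
  rewrite big1 => [|m _]; first by apply: mulr_ge0 => //; exact: powR_ge0.
  by rewrite /h /cut fx mul0r expr0n mulr0.
have {}fx : 0 < `|f x| by rewrite normr_gt0.
have ya : 0 < `|f x| / a by rewrite divr_gt0.
have := sum_dyadic_le (p - 2) (`|f x| / a) ns; rewrite subr_gt0 => /(_ p2 ya uns) H.
have -> : geoc (p - 2) * (2 * (C * wtc d)) `^ (p - 2) * `|f x| `^ p
    = `|f x| ^+ 2 * (geoc (p - 2) * (`|f x| / a) `^ (p - 2)).
  have cw2 : 0 <= 2 * (C * wtc d) by rewrite mulr_ge0// ltW.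
  have -> : (`|f x| / a) `^ (p - 2) = `|f x| `^ (p - 2) * (2 * (C * wtc d)) `^ (p - 2).
    by rewrite /a invrK [LHS](powRM _ (normr_ge0 _) cw2).
  have -> : `|f x| `^ p = `|f x| `^ (p - 2) * `|f x| ^+ 2.
    by rewrite -powR_mulrn// -powRD_gt0// subrK.
  by ring.
(* At a point x only the levels with a 2^m < |f(x)| contribute, and p > 2 makes their sum geometric
   from above. *)
apply: (@le_trans _ _ (`|f x| ^+ 2 * \sum_(m <- ns | dy m <= `|f x| / a) dy m `^ (p - 2))); last first.
  by rewrite ler_wpM2l ?sqr_ge0.
rewrite mulr_sumr [leRHS]big_mkcond; apply: ler_sum => m _.
rewrite /h /cut indicE; have [xA|xA] := boolP (x \in above f (a * dy m)).
  rewrite ifT; first by rewrite mulr1 real_normK ?num_real// mulrC.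
  by move/set_mem: xA => /= /ltW; rewrite ler_pdivlMr// mulrC.
by rewrite mulr0 expr0n mulr0; case: ifP => // _; rewrite mulr_ge0 ?powR_ge0 ?sqr_ge0.
Qed.

(** Hoelder's inequality over the wavelets with r = p/2 leaves the sum of |c_I|^p |psi_I|^p, whose
    integral has exactly the weights of [seq_Lp]. *)
Lemma fluctuation_Lp (s : seq dyadic) (v : dyadic -> R) (M : R) (f : R -> R) (p : R) :
  uniq s -> 2 < p -> (forall I, 0 <= v I) -> 0 < M ->
  \sum_(I <- s) v I `^ (p / 2 / (p / 2 - 1)) <= M -> inLp 2 f ->
  (\int[mu]_x ((\sum_(I <- s) v I * (`|inner f (psiI psi I)| * `|psiI psi I x|) ^+ 2) `^ (p / 2))%:E
    <= (M `^ (p / 2 - 1) * (C `^ p * wtc d * seqc p))%:E * \int[mu]_x (`|f x| `^ p)%:E)%E.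
Proof.
move=> us p2 v0 M0 sM f2; have p21 : 1 < p / 2 by lra.
have p0 : 0 <= p by lra.
pose u I x := `|inner f (psiI psi I)| * `|psiI psi I x|.
have u0 I x : 0 <= u I x by rewrite mulr_ge0.
have mu_ I : measurable_fun [set: R] (u I).
  by apply: measurable_funM => //; apply: measurableT_comp => //; exact: mpsi.
have mup I : measurable_fun [set: R] (fun x => u I x `^ p).
  by apply: (measurableT_comp (measurable_powR p)).
apply: (@le_trans _ _ (\int[mu]_x (M `^ (p / 2 - 1) * \sum_(I <- s) u I x `^ p)%:E)%E).
  apply: ge0_le_integral_EFin => //.
  - apply: (measurableT_comp (measurable_powR (p / 2))); apply: measurable_sum => I.
    by apply: measurable_funM => //; apply: measurable_funX; exact: mu_.
  - by apply: measurable_funM => //; exact: measurable_sum.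
  - by move=> x; exact: powR_ge0.
  move=> x _; have := hoelder_sum _ s v (u ^~ x) M (p / 2) p21 v0 (u0 ^~ x) M0 sM.
  by rewrite (_ : 2 * (p / 2) = p)//; field.
rewrite ge0_integralZ ?powR_ge0//; last 2 first.
- exact: measurable_sum.
- by move=> x; apply: sumr_ge0 => I _; exact: powR_ge0.
rewrite [X in (_ <= X * _)%E]EFinM -muleA; apply: lee_wpmul2l; first by rewrite lee_fin powR_ge0.
rewrite ge0_integral_sum_EFin//; last by move=> I x; exact: powR_ge0.
have Cw : 0 <= C `^ p * wtc d by rewrite mulr_ge0 ?powR_ge0// ltW.
apply: (@le_trans _ _ ((C `^ p * wtc d)%:E * (\sum_(I <- s) (`|inner f (psiI psi I)| * sdy I.1) `^ p / dy I.1)%:E)%E).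
  rewrite -EFinM mulr_sumr -sumEFin; apply: lee_sum => I _.
  under eq_integral do rewrite /u powRM//.
  rewrite ge0_integralZ ?powR_ge0//; last by apply: measurable_norm_powR; exact: mpsi.
  have -> : C `^ p * wtc d * ((`|inner f (psiI psi I)| * sdy I.1) `^ p / dy I.1)
     = `|inner f (psiI psi I)| `^ p * (C `^ p * sdy I.1 `^ p * (wtc d / dy I.1)).
    by rewrite powRM ?powR_ge0//; ring.
  rewrite [leRHS]EFinM; apply: lee_wpmul2l; first by rewrite lee_fin powR_ge0.
  by apply: integral_psiI_powR => //; lra.
rewrite [X in (_ <= X * _)%E]EFinM -muleA; apply: lee_wpmul2l; first by rewrite lee_fin.
exact: seq_Lp.
Qed.

End Marcinkiewicz.

(** * Sub-Gaussian coefficients *)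

Section SubGaussian.
Context {d} {T : measurableType d} {R : realType} (P : probability T R).

(** The inequality y/q <= exp(y/q) raised to the power q. *)
Lemma powR_le_expR (q y : R) : 0 < q -> 0 <= y -> y `^ q <= q `^ q * expR y.
Proof.
move=> q0 y0; have -> : y = q * (y / q) by field; rewrite gt_eqF.
have z0 : 0 <= y / q by rewrite divr_ge0// ltW.
rewrite powRM ?(ltW q0)// ler_wpM2l ?powR_ge0//.
have -> : expR (q * (y / q)) = expR (y / q) `^ q by rewrite /powR gt_eqF ?expR_gt0// expRK.
apply: ler_powR2 => //; first exact: ltW.
by apply: le_trans (expR_ge1Dx _); rewrite lerDr.
Qed.

Variables (nu : R) (X : T -> R).
Hypothesis mX : measurable_fun [set: T] X.
Hypothesis sgX : sub_gaussian P nu X.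

Definition centered (w : T) : R := X w - fine 'E_P[X]%E.

Lemma expectationE (Z : T -> R) : 'E_P[Z]%E = (\int[P]_w (Z w)%:E)%E.
Proof. by rewrite unlock. Qed.

Lemma measurable_centered : measurable_fun [set: T] centered.
Proof. exact: measurable_funB. Qed.

Lemma integrable_centered : P.-integrable [set: T] (EFin \o centered).
Proof.
case: sgX => intX _; apply: integrableB_EFin => //.
by apply: finite_measure_integrable_cst.
Qed.

Lemma integral_centered : (\int[P]_w centered w)%R = 0.
Proof.
case: sgX => intX _; rewrite RintegralB//; last exact: finite_measure_integrable_cst.
rewrite Rintegral_cst// [X in _ * fine X](_ : _ = 1%E); last exact: probability_setT.
by rewrite mulr1 /Rintegral unlock subrr.
Qed.

Lemma integral_exp_centered (lam : R) : lam ^+ 2 = 1 ->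
  (\int[P]_w (expR (lam * centered w))%:E <= (expR (nu / 2))%:E)%E.
Proof.
move=> lam1; case: sgX => _ /(_ lam) []; rewrite /centered !expectationE; set m := fine _ => Mfin Mle.
have I0 : (0 <= \int[P]_w (expR (lam * (X w - m)))%:E)%E.
  by apply: integral_ge0 => w _; rewrite lee_fin expR_ge0.
move: Mle Mfin.
rewrite lam1 mul1r; move: I0; case: (\int[P]_w _)%E => // M; rewrite !lee_fin /= => M0 lnM _.
(* The logarithm can be undone only for a positive argument; the value 0 satisfies the bound
   anyway. *)
move: M0; rewrite le_eqVlt => /orP[/eqP<-|M0]; first exact: expR_ge0.
by rewrite -[leLHS]lnK ?posrE// ler_expR.
Qed.

(** From |y|^q <= q^q (e^y + e^(-y)) and the sub-Gaussian bound at the two parameters 1 and -1. *)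
Definition momc (q : R) : R := q `^ q * (2 * expR (nu / 2)).

Lemma momc_gt0 (q : R) : 0 < q -> 0 < momc q.
Proof. by move=> q0; rewrite !mulr_gt0 ?powR_gt0 ?expR_gt0. Qed.

Lemma moment_centered (q : R) : 0 < q ->
  (\int[P]_w (`|centered w| `^ q)%:E <= (momc q)%:E)%E.
Proof.
move=> q0; have mc := measurable_centered.
have mexp (lam : R) : measurable_fun [set: T] (fun w => expR (lam * centered w)).
  by apply: measurableT_comp => //; exact: measurable_funM.
apply: (@le_trans _ _ (\int[P]_w (q `^ q * (expR (1 * centered w) + expR (-1 * centered w)))%:E)%E).
  apply: ge0_le_integral_EFin => //.
  - exact: measurable_norm_powR.
  - by apply: measurable_funM => //; exact: measurable_funD.
  move=> w _; apply: (le_trans (powR_le_expR _ _ q0 (normr_ge0 _))).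
  rewrite ler_wpM2l ?powR_ge0// mul1r mulN1r.
  by case: (ger0P (centered w)) => _; rewrite ?lerDl ?lerDr expR_ge0.
rewrite ge0_integralZ ?powR_ge0//; last exact: measurable_funD.
rewrite /momc EFinM; apply: lee_wpmul2l; first by rewrite lee_fin powR_ge0.
rewrite ge0_integralD_EFin//; try (by move=> w; exact: expR_ge0).
rewrite mulr_natl mulr2n EFinD; apply: leeD; apply: integral_exp_centered.
  by rewrite expr1n.
by rewrite sqrrN expr1n.
Qed.

Definition var : R := fine (\int[P]_w (centered w ^+ 2)%:E)%E.

Lemma sqr_powR2 (y : R) : y ^+ 2 = `|y| `^ 2.
Proof. by rewrite powR_mulrn// real_normK ?num_real. Qed.

Lemma varE : (\int[P]_w (centered w ^+ 2)%:E = var%:E)%E.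
Proof.
rewrite /var fineK// ge0_fin_numE; last by apply: integral_ge0 => w _; rewrite lee_fin sqr_ge0.
apply: (@le_lt_trans _ _ (momc 2)%:E); last exact: ltry.
by under eq_integral do rewrite sqr_powR2; exact: moment_centered.
Qed.

Lemma var_ge0 : 0 <= var.
Proof. by apply: fine_ge0; apply: integral_ge0 => w _; rewrite lee_fin sqr_ge0. Qed.

Lemma var_le : var <= momc 2.
Proof.
rewrite -lee_fin -varE; under eq_integral do rewrite sqr_powR2.
exact: moment_centered.
Qed.

Definition mean_abs : R := fine (\int[P]_w `|X w|%:E)%E.

Lemma mean_absE : (\int[P]_w `|X w|%:E = mean_abs%:E)%E.
Proof.
case: sgX => intX _; rewrite /mean_abs fineK// ge0_fin_numE ?integral_ge0//.
exact: integrable_ltoo.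
Qed.

Lemma mean_abs_ge0 : 0 <= mean_abs.
Proof. by apply: fine_ge0; exact: integral_ge0. Qed.

Lemma norm_mean_le : `|fine 'E_P[X]%E| <= mean_abs.
Proof.
case: sgX => intX _; rewrite unlock -lee_fin -mean_absE.
have /= := le_abse_integral P measurableT (measurable_int _ intX).
apply: le_trans; case: (\int[P]_w _)%E => //=; by rewrite normr0 leey.
Qed.

Lemma integral_norm_centered : (\int[P]_w `|centered w|%:E <= (2 * mean_abs)%:E)%E.
Proof.
have mnX : measurable_fun [set: T] (fun w => `|X w|) by exact: measurableT_comp.
apply: (@le_trans _ _ (\int[P]_w (`|X w| + `|fine 'E_P[X]%E|)%:E)%E).
  apply: ge0_le_integral_EFin => //.
  - by apply: measurableT_comp => //; exact: measurable_centered.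
  - exact: measurable_funD.
  - by move=> w _; exact: ler_normB.
rewrite ge0_integralD_EFin//.
rewrite mean_absE integral_cst// [X in (_ + _ * X)%E](_ : _ = 1%E); last exact: probability_setT.
rewrite mule1 mulr_natl mulr2n EFinD leeD2l//.
by rewrite lee_fin norm_mean_le.
Qed.

(* Hoelder's inequality for the weight [|centered|]: the variance is almost as
   summable over the family as the first moments are. *)
Lemma var_powR (r : R) : 1 < r ->
  var `^ (r / (r - 1)) <= momc (r + 1) `^ (r - 1)^-1 * (2 * mean_abs).
Proof.
move=> r1; have r10 : 0 < r - 1 by rewrite subr_gt0.
have mc := measurable_centered.
have mnc : measurable_fun [set: T] (fun w => `|centered w|) by exact: measurableT_comp.
have K0 : 0 < momc (r + 1) by apply: momc_gt0; lra.
(* [hoelder_weight] asks for a positive mass; when the mean vanishes, the centred variable is 0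
   almost surely and so is the variance. *)
have [m0|m0] := eqVneq mean_abs 0.
  have : (\int[P]_w `|(EFin \o centered) w|)%E = 0%E.
    apply/eqP; rewrite eq_le integral_ge0// andbT.
    by apply: (le_trans integral_norm_centered); rewrite m0 mulr0.
  have mc' : measurable_fun [set: T] (EFin \o centered) by exact/measurable_EFinP.
  move=> /(ae_eq_integral_abs P measurableT mc') ae0.
  have -> : var = 0.
    rewrite /var (ge0_ae_eq_integral _ (g := cst 0%E))//.
    - by rewrite integral0.
    - by apply/measurable_EFinP; exact: measurable_funX.
    - by move=> w _; rewrite lee_fin sqr_ge0.
    - by apply: filterS ae0 => w /= h _; move: (h I) => [->]; rewrite expr0n.
  rewrite powR0; last by rewrite gt_eqF// divr_gt0//; lra.
  by rewrite mulr_ge0 ?powR_ge0// mulr_ge0// mean_abs_ge0.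
have m0' : 0 < 2 * mean_abs by rewrite mulr_gt0// lt_neqAle eq_sym m0 mean_abs_ge0.
(* With the weight |Y| and the function Y, for Y the centred variable, the weighted integrals are
   the variance and the moment of order r + 1. *)
have H : var `^ r <= momc (r + 1) * (2 * mean_abs) `^ (r - 1).
  apply: (@hoelder_weight _ _ _ P centered (fun w => `|centered w|)) => //.
  - exact: ltW.
  - exact: integral_norm_centered.
  - under eq_integral => w _.
      rewrite mulrC (_ : `|centered w| * `|centered w| `^ r = `|centered w| `^ (r + 1)); last first.
        by rewrite -[r in LHS](addrK 1) mulr_powRB1//; lra.
      over.
    by apply: moment_centered; lra.
  - exact: var_ge0.
  - rewrite -varE; under [leRHS]eq_integral do rewrite -expr2 real_normK ?num_real//.
    exact: lexx.
have -> : var `^ (r / (r - 1)) = (var `^ r) `^ (r - 1)^-1 by rewrite -powRrM.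
have i0 : 0 <= (r - 1)^-1 by rewrite invr_ge0 ltW.
apply: (le_trans (ler_powR2 _ _ _ i0 (powR_ge0 _ _) H)).
rewrite powRM ?powR_ge0 ?(ltW K0)// -[X in _ * X <= _]powRrM divff ?gt_eqF//.
by rewrite powRr1// ltW.
Qed.

End SubGaussian.

(** * Independence implies vanishing correlation *)

Section Uncorrelated.
Context {d} {T : measurableType d} {R : realType} (P : probability T R).

(** The joint law is the product of the marginal laws, so Fubini's theorem applies and the inner
    integral of y - b vanishes. *)
Lemma integral_indep_mul (X Y : T -> R) (a b : R) :
  measurable_fun [set: T] X -> measurable_fun [set: T] Y ->
  (forall A B : set R, measurable A -> measurable B ->
     P (X @^-1` A `&` Y @^-1` B) = (P (X @^-1` A) * P (Y @^-1` B))%E) ->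
  P.-integrable [set: T] (EFin \o X) ->
  P.-integrable [set: T] (EFin \o (fun w => Y w - b)) ->
  (\int[P]_w (Y w - b))%R = 0 ->
  P.-integrable [set: T] (EFin \o (fun w => (X w - a) * (Y w - b))) ->
  (\int[P]_w ((X w - a) * (Y w - b)))%R = 0.
Proof.
move=> mX mY indep intX intY EY intXY.
pose X' : {RV P >-> R} := mfun_Sub (mem_set mX : X \in mfun).
pose Y' : {RV P >-> R} := mfun_Sub (mem_set mY : Y \in mfun).
have mZ : measurable_fun [set: T] (fun w => (X w, Y w)) by exact: measurable_fun_pair.
pose Z' : {RV P >-> (R * R)%type} := mfun_Sub (mem_set mZ : (fun w => (X w, Y w)) \in mfun).
pose f (z : R * R) := ((z.1 - a) * (z.2 - b))%:E.
have mf : measurable_fun [set: R * R] f.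
  apply/measurable_EFinP; apply: measurable_funM.
    by apply: measurable_funB => //; exact: measurable_fst.
  by apply: measurable_funB => //; exact: measurable_snd.
pose m1 := distribution P X'; pose m2 := distribution P Y'.
(* Independence gives equality on rectangles, and these determine the product measure. *)
have law A : measurable A -> (m1 \x m2)%E A = distribution P Z' A.
  move=> mA; exact: product_measure_unique.
have intf : (m1 \x m2)%E.-integrable [set: R * R] f.
  apply/integrableP; split => //.
  rewrite (eq_measure_integral (distribution P Z')); last by move=> A mA _; exact: law.
  rewrite ge0_integral_distribution//; last exact: measurableT_comp.
  by have /integrableP[] := intXY.
have E1 : (\int[P]_w ((X w - a) * (Y w - b))%:E = \int[m1 \x m2]_z f z)%E.
  rewrite (eq_measure_integral (distribution P Z')); last by move=> A mA _; exact: law.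
  by rewrite integral_distribution.
rewrite /Rintegral E1 -integral12_prod_meas1//.
rewrite integral0_eq ?fine0//= => x _; rewrite /fubini_F /f /=.
under eq_integral do rewrite EFinM.
have intm2 : m2.-integrable [set: R] (fun y => (y - b)%:E).
  apply: (@integrable_pushforward _ _ _ _ _ Y') => //.
  by apply/measurable_EFinP; exact: measurable_funB.
rewrite integralZl//.
have -> : (\int[m2]_y (y - b)%:E = \int[P]_w (Y w - b)%:E)%E.
  rewrite integral_distribution//.
  by apply/measurable_EFinP; exact: measurable_funB.
move: EY; rewrite /Rintegral => EY.
have fin := integrable_fin_num measurableT intY.
by rewrite -(fineK fin) /= EY mule0.
Qed.

End Uncorrelated.

(** * Second moments of random sums *)

Section RandomSums.
Context {dd} {T : measurableType dd} {R : realType} (P : probability T R).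
Variables (nu : R) (a : dyadic -> T -> R).
Hypothesis indep : mutually_independent P a.
Hypothesis sga : forall I, sub_gaussian P nu (a I).

Let ma I : measurable_fun [set: T] (a I).
Proof. by case: indep. Qed.

Let mc I : measurable_fun [set: T] (centered P (a I)).
Proof. exact: measurable_centered. Qed.

Lemma integrable_centeredM (I J : dyadic) :
  P.-integrable [set: T] (EFin \o (fun w => centered P (a I) w * centered P (a J) w)).
Proof.
apply: integrable_EFinP; first exact: measurable_funM.
apply: (@le_lt_trans _ _ (\int[P]_w (centered P (a I) w ^+ 2 + centered P (a J) w ^+ 2)%:E)%E).
  apply: ge0_le_integral_EFin => //.
  - by apply: measurableT_comp => //; exact: measurable_funM.
  - by apply: measurable_funD; exact: measurable_funX.
  - move=> w _; rewrite normrM -(real_normK (num_real (centered P (a I) w))).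
    rewrite -(real_normK (num_real (centered P (a J) w))).
    have := sqr_ge0 (`|centered P (a I) w| - `|centered P (a J) w|).
    have := mulr_ge0 (normr_ge0 (centered P (a I) w)) (normr_ge0 (centered P (a J) w)).
    by nra.
rewrite ge0_integralD_EFin//; try (by move=> w; exact: sqr_ge0); try exact: measurable_funX.
by rewrite !(varE P nu)// -EFinD ltry.
Qed.

Lemma uncorrelated (I J : dyadic) : I != J ->
  (\int[P]_w (centered P (a I) w * centered P (a J) w))%R = 0.
Proof.
move=> IJ; apply: integral_indep_mul => //.
(* Independence of the family is used for the two-element list [[:: I; J]], with a choice of events
   that separates the two indices. *)
- move=> A B mA mB; case: indep => _ /(_ [:: I; J] (fun K => if K == I then A else B)).
  rewrite /= inE andbT IJ => /(_ isT) H.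
  have mAB (K : dyadic) : measurable (if K == I then A else B) by case: ifP.
  move: (H mAB); rewrite !big_cons big_nil mule1 eqxx eq_sym (negbTE IJ) => <-.
  congr (P _); apply/seteqP; split => w.
    move=> [wA wB] K /=; rewrite !inE => /orP[/eqP->|/eqP->]; first by rewrite eqxx.
    by rewrite eq_sym (negbTE IJ).
  move=> Hw; split; first by have /= := Hw I; rewrite inE eqxx; exact.
  by have /= := Hw J; rewrite !inE eqxx orbT eq_sym (negbTE IJ); exact.
- by case: (sga I).
- exact: (integrable_centered P nu).
- exact: (integral_centered P nu).
- exact: integrable_centeredM.
Qed.

Lemma second_moment_centered (s : seq dyadic) (b : dyadic -> R) : uniq s ->
  (\int[P]_w ((\sum_(I <- s) centered P (a I) w * b I) ^+ 2)%:E
    = (\sum_(I <- s) var P (a I) * b I ^+ 2)%:E)%E.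
Proof.
move=> us; pose F (I J : dyadic) w := b I * b J * (centered P (a I) w * centered P (a J) w).
have E w : (\sum_(I <- s) centered P (a I) w * b I) ^+ 2 = \sum_(I <- s) \sum_(J <- s) F I J w.
  rewrite expr2 big_distrlr/=; apply: eq_bigr => I _; apply: eq_bigr => J _.
  by rewrite /F; ring.
have intF I J : P.-integrable [set: T] (EFin \o F I J).
  by apply: integrableZ_EFin; exact: integrable_centeredM.
have intG I : P.-integrable [set: T] (EFin \o (fun w => \sum_(J <- s) F I J w)).
  exact: integrable_sum_EFin.
have intH : P.-integrable [set: T] (EFin \o (fun w => \sum_(I <- s) \sum_(J <- s) F I J w)).
  exact: integrable_sum_EFin.
under eq_integral do rewrite E.
have fin := integrable_fin_num measurableT intH.
rewrite -(fineK fin); congr EFin.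
rewrite -[LHS]/(\int[P]_w (\sum_(I <- s) \sum_(J <- s) F I J w))%R Rintegral_sum//.
rewrite big_seq [RHS]big_seq; apply: eq_bigr => I sI.
rewrite Rintegral_sum//.
have EF J : (\int[P]_w F I J w)%R = b I * b J * (\int[P]_w (centered P (a I) w * centered P (a J) w))%R.
  by apply: RintegralZl => //; exact: integrable_centeredM.
rewrite (bigD1_seq I)//= big1 => [|J JI]; last first.
  by rewrite EF uncorrelated ?mulr0// eq_sym.
by rewrite EF addr0 -expr2 mulrC.
Qed.

(** The sum splits into its mean, bounded through |E a_I| <= E|a_I|, and the centred sum, whose
    second moment is diagonal. The factors 2 come from (B + S)^2 <= 2 B^2 + 2 S^2. *)
Lemma second_moment_le (s : seq dyadic) (b : dyadic -> R) : uniq s ->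
  (\int[P]_w ((\sum_(I <- s) a I w * b I) ^+ 2)%:E
    <= (2 * (\sum_(I <- s) mean_abs P (a I) * `|b I|) ^+ 2
        + 2 * \sum_(I <- s) var P (a I) * b I ^+ 2)%:E)%E.
Proof.
move=> us; set M := \sum_(I <- s) mean_abs P (a I) * `|b I|.
have mcs : measurable_fun [set: T] (fun w => \sum_(I <- s) centered P (a I) w * b I).
  by apply: measurable_sum => I; exact: measurable_funM.
have mas : measurable_fun [set: T] (fun w => \sum_(I <- s) a I w * b I).
  by apply: measurable_sum => I; exact: measurable_funM.
have M0 : 0 <= M by apply: sumr_ge0 => I _; rewrite mulr_ge0 ?mean_abs_ge0.
apply: (@le_trans _ _ (\int[P]_w (2 * M ^+ 2
    + 2 * (\sum_(I <- s) centered P (a I) w * b I) ^+ 2)%:E)%E).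
  apply: ge0_le_integral_EFin => //.
  - exact: measurable_funX.
  - by apply: measurable_funD => //; apply: measurable_funM => //; exact: measurable_funX.
  - by move=> w; exact: sqr_ge0.
  - move=> w _; set S := \sum_(I <- s) centered P (a I) w * b I.
    pose B := \sum_(I <- s) fine 'E_P[a I]%E * b I.
    have -> : \sum_(I <- s) a I w * b I = B + S.
      by rewrite -big_split/=; apply: eq_bigr => I _; rewrite /centered; ring.
    have BM : `|B| <= M.
      apply: le_trans (ler_norm_sum _ _ _) _; apply: ler_sum => I _.
      by rewrite normrM ler_wpM2r// (norm_mean_le P nu).
    have : B ^+ 2 <= M ^+ 2.
      by rewrite -(real_normK (num_real B)) lerXn2r ?nnegrE.
    by have := sqr_ge0 (B - S); nra.
rewrite ge0_integralD_EFin//; last 3 first.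
- by apply: measurable_funM => //; exact: measurable_funX.
- by move=> w; apply: mulr_ge0 => //; exact: sqr_ge0.
- by move=> w; apply: mulr_ge0 => //; exact: sqr_ge0.
rewrite integral_cst// [X in (_ * X + _)%E](_ : _ = 1%E); last exact: probability_setT.
rewrite mule1 ge0_integralZ//; last 2 first.
- exact: measurable_funX.
- by move=> w; exact: sqr_ge0.
by rewrite second_moment_centered// EFinD EFinM.
Qed.

Lemma sum_mean_abs_le (s : seq dyadic) : uniq s ->
  ((\sum_(I <- s) mean_abs P (a I))%:E
    <= \esum_(I in [set: dyadic]) ('E_P[(fun w => `|a I w|)%R]))%E.
Proof.
move=> us; rewrite -sumEFin.
have -> : (\sum_(I <- s) (mean_abs P (a I))%:E = \sum_(I <- s) 'E_P[(fun w => `|a I w|)%R])%E.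
  by apply: eq_bigr => I _; rewrite expectationE (mean_absE P nu).
apply: ereal_sup_ubound; exists [set` s]; first by split; [exact: finite_seq|].
by rewrite -fsbig_seq.
Qed.

End RandomSums.

(** * Passing bounds to suprema and infima *)

Section EventuallyDominated.
Context {R : realType}.

(** A finite supremum s of the powers bounds every z n by s^(1/q), hence also y; raising back to the
    power q concludes. *)
Lemma le_sup_powR (y : \bar R) (z : nat -> R) (q : R) : 0 < q -> (0 <= y)%E ->
  (forall n, 0 <= z n) -> (y <= ereal_sup (range (fun n => (z n)%:E)))%E ->
  (y `^ q <= ereal_sup (range (fun n => (z n `^ q)%:E)))%E.
Proof.
move=> q0 y0 z0 yz; set S := ereal_sup (range (fun n => (z n `^ q)%:E)).
have Sub n : ((z n `^ q)%:E <= S)%E by apply: ereal_sup_ubound; exists n.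
move: Sub; case: S => [s|_|/(_ 0)//]; last exact: leey.
move=> Sub.
have s0 : 0 <= s by have := Sub 0; rewrite lee_fin; apply: le_trans; exact: powR_ge0.
have i0 : 0 <= q^-1 by rewrite invr_ge0 ltW.
have ys : (y <= (s `^ q^-1)%:E)%E.
  apply: (le_trans yz); apply: ge_ereal_sup => _ [n _ <-]; rewrite lee_fin.
  have := Sub n; rewrite lee_fin => /(ler_powR2 _ _ _ i0 (powR_ge0 _ _)).
  by rewrite -powRrM divff ?gt_eqF// powRr1//; exact.
have := gt0_ler_poweR (ltW q0) _ _ ys.
rewrite !in_itv/= !leey !andbT y0 lee_fin powR_ge0 => /(_ isT isT) /le_trans; apply.
by rewrite lee_fin -powRrM mulVf ?gt_eqF// powRr1.
Qed.

(** Used with u n the approximation error at a fixed point: infimum 0 suffices, since [B] does not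
    depend on n. *)
Lemma le_add_inf0 (u : nat -> \bar R) (y B : \bar R) : (forall n, 0 <= u n)%E ->
  ereal_inf (range u) = 0%E -> (forall n, y <= 2%:E * u n + B)%E -> (y <= B)%E.
Proof.
move=> u0 iu; case: B => [b|_|H]; last 2 first.
- exact: leey.
- by have := H 0; rewrite addeC/=; exact.
move=> H; apply/lee_addgt0Pr => e e0.
have : (ereal_inf (range u) < (e / 2)%:E)%E by rewrite iu lte_fin divr_gt0.
move=> /ereal_inf_lt[_ [n _ <-]] un; apply: (le_trans (H n)).
rewrite addeC leeD2l// -[e in leRHS](@divfK _ 2)// mulrC EFinM.
by apply: lee_wpmul2l => //; exact: ltW.
Qed.

End EventuallyDominated.

(** * The random operator *)

Section RandomOperator.
Context {R : realType} {dd} {T : measurableType dd} (P : probability T R).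
Notation mu := (@lebesgue_measure R).
Variables (psi : R -> R) (a : dyadic -> T -> R) (C d nu L : R).
Hypothesis psiC1 : C1 psi.
Hypothesis C0 : 0 < C.
Hypothesis d0 : 0 < d.
Hypothesis psi_decay : forall x, `|psi x| <= C * wt (2 * d) x.
Hypothesis psi'_decay : forall x, `|derive1 psi x| <= C * wt (2 * d) x.
Hypothesis psi_L2 : forall I, inLp 2 (psiI psi I).
Hypothesis psi_orth : forall I J, inner (psiI psi I) (psiI psi J) = (I == J)%:R.
Hypothesis indep : mutually_independent P a.
Hypothesis sga : forall I, sub_gaussian P nu (a I).
Hypothesis L0 : 0 < L.
Hypothesis sum_mean : forall s : seq dyadic, uniq s -> \sum_(I <- s) mean_abs P (a I) <= L.

Let mpsi := measurable_psiI psi psiC1.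
Let ma I : measurable_fun [set: T] (a I).
Proof. by case: indep. Qed.

Definition grid (N : nat) : seq dyadic := rect (window N) (window N).

Lemma uniq_grid N : uniq (grid N).
Proof. by apply: allpairs_uniq; rewrite ?uniq_window// => -[? ?] [? ?]. Qed.

Lemma sub_grid N M : (N <= M)%N -> {subset grid N <= grid M}.
Proof.
move=> NM I /allpairsP[[j k] /= [jN kN ->]]; apply/allpairsP; exists (j, k) => /=.
by split => //; exact: (sub_window _ _ NM).
Qed.

Definition drift (f : R -> R) N x : R :=
  \sum_(I <- grid N) mean_abs P (a I) * (`|inner f (psiI psi I)| * `|psiI psi I x|).

Definition fluct (f : R -> R) N x : R :=
  \sum_(I <- grid N) var P (a I) * (`|inner f (psiI psi I)| * `|psiI psi I x|) ^+ 2.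

(** Each 4 is a product of two factors 2: one from comparing G with its partial sum, one from
    separating mean and centred part in [second_moment_le]. *)
Definition majorant (f : R -> R) N x : R := 4 * drift f N x ^+ 2 + 4 * fluct f N x.

Lemma drift_ge0 f N x : 0 <= drift f N x.
Proof. by apply: sumr_ge0 => I _; rewrite mulr_ge0 ?mean_abs_ge0// mulr_ge0. Qed.

Lemma fluct_ge0 f N x : 0 <= fluct f N x.
Proof. by apply: sumr_ge0 => I _; apply: mulr_ge0; rewrite ?var_ge0// sqr_ge0. Qed.

Lemma majorant_ge0 f N x : 0 <= majorant f N x.
Proof. by rewrite addr_ge0// mulr_ge0// ?fluct_ge0// sqr_ge0. Qed.

Lemma measurable_drift f N : measurable_fun [set: R] (drift f N).
Proof.
apply: measurable_sum => I; apply: measurable_funM => //; apply: measurable_funM => //.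
by apply: measurableT_comp => //; exact: mpsi.
Qed.

Lemma measurable_fluct f N : measurable_fun [set: R] (fluct f N).
Proof.
apply: measurable_sum => I; apply: measurable_funM => //; apply: measurable_funX.
by apply: measurable_funM => //; apply: measurableT_comp => //; exact: mpsi.
Qed.

Lemma measurable_majorant f N : measurable_fun [set: R] (majorant f N).
Proof.
apply: measurable_funD; apply: measurable_funM => //; last exact: measurable_fluct.
by apply: measurable_funX; exact: measurable_drift.
Qed.

Lemma le_majorant f N M x : (N <= M)%N -> majorant f N x <= majorant f M x.
Proof.
move=> NM; have sub := sub_grid _ _ NM; have uN := uniq_grid N.
have h1 : drift f N x <= drift f M x.
  by apply: ler_sum_uniq => // I; rewrite mulr_ge0 ?mean_abs_ge0// mulr_ge0.
have h2 : fluct f N x <= fluct f M x.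
  by apply: ler_sum_uniq => // I; apply: mulr_ge0; rewrite ?var_ge0// sqr_ge0.
by rewrite /majorant lerD// ler_wpM2l// lerXn2r ?nnegrE ?drift_ge0.
Qed.

Lemma fluct_le_Sq f N x : fluct f N x <= momc nu 2 * Sq psi (grid N) f x.
Proof.
rewrite /Sq mulr_sumr; apply: ler_sum => I _.
rewrite -normrM real_normK ?num_real// exprMn ler_wpM2r ?(var_le P nu)//.
by apply: mulr_ge0; exact: sqr_ge0.
Qed.


Let V0 : 0 < momc nu 2.
Proof. exact: momc_gt0. Qed.

(** Below 2 bounded variances and the interpolated square function, at 2 Bessel's inequality, above
    2 the summability of powers of the variances. The absolute values in the constants spare a
    separate proof that they are nonnegative. *)
Lemma fluct_Lp (p : R) : 1 < p -> exists2 K : R, 0 <= K & forall f N, inLp 2 f ->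
  (\int[mu]_x (fluct f N x `^ (p / 2))%:E <= K%:E * \int[mu]_x (`|f x| `^ p)%:E)%E.
Proof.
move=> p1; have p20 : 0 <= p / 2 by lra.
have [p2|p2|->] := ltgtP p 2.
- exists (`|momc nu 2 `^ (p / 2) * sqc C d p|) => // f N f2.
  have mS : measurable_fun [set: R] (Sq psi (grid N) f) by exact: measurable_Sq.
  have mSp : measurable_fun [set: R] (fun x => Sq psi (grid N) f x `^ (p / 2)).
    by apply: (measurableT_comp (measurable_powR _)).
  apply: (@le_trans _ _ (\int[mu]_x (momc nu 2 `^ (p / 2) * Sq psi (grid N) f x `^ (p / 2))%:E)%E).
    apply: ge0_le_integral_EFin => //.
    - by apply: (measurableT_comp (measurable_powR _)); exact: measurable_fluct.
    - exact: measurable_funM.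
    - by move=> x; exact: powR_ge0.
    move=> x _; rewrite -powRM ?Sq_ge0 ?(ltW V0)//.
    by apply: ler_powR2; rewrite ?fluct_ge0 ?fluct_le_Sq.
  rewrite ge0_integralZ ?powR_ge0//; last by move=> x; exact: powR_ge0.
  apply: (@le_trans _ _ ((momc nu 2 `^ (p / 2) * sqc C d p)%:E * \int[mu]_x (`|f x| `^ p)%:E)%E).
    rewrite EFinM -muleA; apply: lee_wpmul2l; first by rewrite lee_fin powR_ge0.
    by apply: (Sq_Lp psi C d) => //; rewrite ?uniq_window// p1.
  apply: lee_wpmul2r; first by apply: integral_ge0 => x _; rewrite lee_fin powR_ge0.
  by rewrite lee_fin ler_norm.
- have r1 : 1 < p / 2 by rewrite ltr_pdivlMr ?mul1r.
  (* Sums the bound of [var_powR] at r = p/2 over the grid; its exponent r/(r-1) is the one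
     [fluctuation_Lp] asks for. *)
  pose M := momc nu (p / 2 + 1) `^ (p / 2 - 1)^-1 * (2 * L).
  have M0 : 0 < M.
    by rewrite mulr_gt0 ?mulr_gt0// powR_gt0// momc_gt0//; lra.
  exists (`|M `^ (p / 2 - 1) * (C `^ p * wtc d * seqc C d p)|) => // f N f2.
  apply: (@le_trans _ _ ((M `^ (p / 2 - 1) * (C `^ p * wtc d * seqc C d p))%:E * \int[mu]_x (`|f x| `^ p)%:E)%E).
    apply: fluctuation_Lp => //; first exact: uniq_grid.
      by move=> I; exact: var_ge0.
    apply: (@le_trans _ _ (\sum_(I <- grid N)
        momc nu (p / 2 + 1) `^ (p / 2 - 1)^-1 * (2 * mean_abs P (a I)))).
      by apply: ler_sum => I _; exact: var_powR.
    rewrite -mulr_sumr ler_wpM2l ?powR_ge0// -mulr_sumr ler_wpM2l//.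
    by apply: sum_mean; exact: uniq_grid.
  apply: lee_wpmul2r; first by apply: integral_ge0 => x _; rewrite lee_fin powR_ge0.
  by rewrite lee_fin ler_norm.
- exists (momc nu 2); first exact: ltW.
  move=> f N f2; have mS : measurable_fun [set: R] (Sq psi (grid N) f) by exact: measurable_Sq.
  under eq_integral do rewrite divff// powRr1 ?fluct_ge0//.
  under [X in (_ <= _ * X)%E]eq_integral do rewrite -sqr_powR2.
  apply: (@le_trans _ _ (\int[mu]_x (momc nu 2 * Sq psi (grid N) f x)%:E)%E).
    apply: ge0_le_integral_EFin => //.
    - exact: measurable_fluct.
    - exact: measurable_funM.
    - by move=> x; exact: fluct_ge0.
    by move=> x _; exact: fluct_le_Sq.
  rewrite ge0_integralZ ?(ltW V0)//; last by move=> x; exact: Sq_ge0.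
  apply: lee_wpmul2l; first by rewrite lee_fin ltW.
  rewrite integral_Sq//; apply: bessel => //; exact: uniq_grid.
Qed.

Lemma majorant_Lp (p : R) : 1 < p -> exists2 K : R, 0 <= K & forall f N,
  inLp 2 f -> inLp p f ->
  (\int[mu]_x (majorant f N x `^ (p / 2))%:E <= K%:E * \int[mu]_x (`|f x| `^ p)%:E)%E.
Proof.
move=> p1; have p0 : 0 < p by lra.
have p20 : 0 <= p / 2 by lra.
have [Kf Kf0 HK] := fluct_Lp p p1.
pose Km := C `^ p * C `^ p * wtc d `^ p * L `^ p.
have Km0 : 0 <= Km by rewrite !mulr_ge0 ?powR_ge0.
exists (8 `^ (p / 2) * (Km + Kf)); first by rewrite mulr_ge0 ?powR_ge0 ?addr_ge0.
move=> f N f2 /(inLpP _ _ p0)[mf fp].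
have If0 : (0 <= \int[mu]_x (`|f x| `^ p)%:E)%E.
  by apply: integral_ge0 => x _; rewrite lee_fin powR_ge0.
have mD := measurable_drift f N; have mF := measurable_fluct f N.
have mDp : measurable_fun [set: R] (fun x => drift f N x `^ p).
  by apply: (measurableT_comp (measurable_powR _)).
have mFp : measurable_fun [set: R] (fun x => fluct f N x `^ (p / 2)).
  by apply: (measurableT_comp (measurable_powR _)).
have mDF : measurable_fun [set: R] (fun x => drift f N x `^ p + fluct f N x `^ (p / 2)).
  exact: measurable_funD.
apply: (@le_trans _ _ (\int[mu]_x (8 `^ (p / 2) *
    (drift f N x `^ p + fluct f N x `^ (p / 2)))%:E)%E).
  apply: ge0_le_integral_EFin => //.
  - by apply: (measurableT_comp (measurable_powR _)); exact: measurable_majorant.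
  - exact: measurable_funM.
  - by move=> x; exact: powR_ge0.
  move=> x _; have D0 := drift_ge0 f N x; have F0 := fluct_ge0 f N x.
  have D2 : (drift f N x ^+ 2) `^ (p / 2) = drift f N x `^ p.
    by rewrite -powR_mulrn// -powRrM mulrC divfK.
  (* With A the larger of drift^2 and fluct, the majorant is at most 8A; this treats p/2 below and
     above 1 alike. *)
  have maj_le (A : R) : drift f N x ^+ 2 <= A -> fluct f N x <= A ->
      majorant f N x `^ (p / 2) <= 8 `^ (p / 2) * A `^ (p / 2).
    move=> DA FA; rewrite -powRM//; last exact: le_trans FA.
    by apply: ler_powR2; rewrite ?majorant_ge0// /majorant; lra.
  have [h|h] := leP (fluct f N x) (drift f N x ^+ 2).
    apply: (le_trans (maj_le _ (lexx _) h)).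
    by rewrite D2 ler_wpM2l ?powR_ge0// lerDl powR_ge0.
  apply: (le_trans (maj_le _ (ltW h) (lexx _))).
  by rewrite ler_wpM2l ?powR_ge0// lerDr powR_ge0.
rewrite ge0_integralZ ?powR_ge0//; last by move=> x; rewrite addr_ge0 ?powR_ge0.
rewrite ge0_integralD_EFin//; try (by move=> x; exact: powR_ge0).
rewrite [in leRHS]EFinM -muleA; apply: lee_wpmul2l; first by rewrite lee_fin powR_ge0.
rewrite EFinD ge0_muleDl ?lee_fin//; apply: leeD; last exact: HK.
apply: (mean_Lp psi C d) => //; first exact: ltW.
  by move=> I; exact: mean_abs_ge0.
by apply: sum_mean; exact: uniq_grid.
Qed.

Definition weakK : R := 4 * (C * C * wtc d * L) + weakc C d * (8 * (1 + momc nu 2)).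

(** The drift is bounded in L^1 by [mean_Lp] with p = 1 and handled by Chebyshev at t/4; the
    fluctuation is handled by [weak_type] at lam = t / (8 (1 + V)). *)
Lemma majorant_weak (f : R -> R) N (t : R) : 0 < t -> inLp 1 f ->
  (mu [set x | (t ^+ 2 < majorant f N x)%R] <= (weakK / t)%:E * \int[mu]_x `|f x|%:E)%E.
Proof.
move=> t0 /[dup] f1 /inLp1P intf; have wc0 := wtc_gt0 d d0.
have mD := measurable_drift f N.
have mS : measurable_fun [set: R] (Sq psi (grid N) f) by exact: measurable_Sq.
set V := momc nu 2; set lam := t / (8 * (1 + V)).
have lam0 : 0 < lam by rewrite divr_gt0// mulr_gt0// addr_gt0.
pose A := [set x | (t / 4 < drift f N x)%R].
pose B := [set x | (4 * lam ^+ 2 < Sq psi (grid N) f x)%R].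
have mA : measurable A by exact: measurable_gt.
have mB : measurable B by exact: measurable_gt.
(* Off both sets, 4 drift^2 and 4 fluct are each at most t^2/4; for the latter, V / (1 + V)^2 <= 1
   explains the choice of [lam]. *)
have AB : [set x | (t ^+ 2 < majorant f N x)%R] `<=` A `|` B.
  move=> x /= h; have [xA|xA] := ltP (t / 4) (drift f N x); [by left|right].
  rewrite /B /= ltNge; apply/negP => SqB; move: h; rewrite ltNge => /negP; apply.
  have F : fluct f N x <= V * (4 * lam ^+ 2).
    by apply: le_trans (fluct_le_Sq f N x) _; rewrite ler_wpM2l// ltW.
  have E : V * (4 * lam ^+ 2) = t ^+ 2 / 16 * (V / (1 + V) ^+ 2).
    by rewrite /lam; field; rewrite gt_eqF// addr_gt0.
  have W : V / (1 + V) ^+ 2 <= 1.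
    have V0' : 0 < V := V0.
    by rewrite ler_pdivrMr ?exprn_gt0 ?addr_gt0//; nra.
  have D2 : drift f N x ^+ 2 <= (t / 4) ^+ 2.
    by rewrite lerXn2r ?nnegrE ?drift_ge0// divr_ge0// ltW.
  have t2 : 0 < t ^+ 2 by rewrite exprn_gt0.
  have F' : fluct f N x <= t ^+ 2 / 16.
    by apply: (le_trans F); rewrite E ler_piMr// divr_ge0// ltW.
  by rewrite /majorant; nra.
have mM : measurable [set x | (t ^+ 2 < majorant f N x)%R].
  by apply: measurable_gt; exact: measurable_majorant.
have If0 : (0 <= \int[mu]_x `|f x|%:E)%E by exact: integral_ge0.
apply: (@le_trans _ _ (mu (A `|` B))); first by rewrite le_measure ?inE//; exact: measurableU.
apply: (le_trans (measureU2 mu mA mB)).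
have -> : weakK / t = 4 / t * (C * C * wtc d * L) + weakc C d / lam.
  rewrite /weakK /lam -/V; field; rewrite (gt_eqF t0)/=.
  by rewrite gt_eqF// addr_gt0.
have wk0 := weakc_gt0 C d d0.
rewrite EFinD ge0_muleDl; last 2 first.
- rewrite lee_fin; apply: mulr_ge0; first by rewrite divr_ge0// ltW.
  by do 2 (apply: mulr_ge0; last exact: ltW); apply: mulr_ge0; exact: ltW.
- by rewrite lee_fin divr_ge0// ltW.
apply: leeD; last first.
  by apply: weak_type => //; exact: uniq_window.
have -> : A = setT `&` A by rewrite setTI.
have t40 : 0 < t / 4 by rewrite divr_gt0.
apply: (le_trans (markov_EFin mu setT (drift f N) (t / 4) measurableT mD (drift_ge0 f N) t40)).
rewrite invf_div [in leRHS]EFinM -muleA; apply: lee_wpmul2l; first by rewrite lee_fin divr_ge0// ltW.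
have [mf f1'] := (inLpP 1 f ltr01).1 f1.
have := mean_Lp psi C d psiC1 C0 d0 psi_decay (grid N) (fun I => mean_abs P (a I)) L f 1 (lexx _)
  (fun I => mean_abs_ge0 P (a I)) L0 (sum_mean _ (uniq_grid N)) mf f1'.
rewrite !powRr1 ?(ltW C0) ?(ltW wc0) ?(ltW L0)//.
under [in X in (_ <= X)%E -> _]eq_integral do rewrite powRr1//.
apply: le_trans; rewrite le_eqVlt; apply/orP; left; apply/eqP; apply: eq_integral => x _.
by rewrite powRr1// drift_ge0.
Qed.

Variables (f : R -> R) (G : R -> T -> R).
Hypothesis TfG : is_Tf P a psi f G.

Let mG : measurable_fun [set: R * T] (fun z : R * T => G z.1 z.2).
Proof. by case: TfG. Qed.

Let mTf N : measurable_fun [set: R * T] (fun z : R * T => Tpartial a psi f N z.1 z.2).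
Proof.
apply: measurable_sum => j; apply: measurable_sum => k.
apply: measurable_funM; first apply: measurable_funM => //.
  by apply: measurableT_comp => //; exact: ma.
by apply: measurableT_comp => //; exact: mpsi.
Qed.

Definition energy x : \bar R := (\int[P]_w (G x w ^+ 2)%:E)%E.

Lemma energy_ge0 x : (0 <= energy x)%E.
Proof. by apply: integral_ge0 => w _; rewrite lee_fin sqr_ge0. Qed.

Lemma measurable_energy : measurable_fun [set: R] energy.
Proof.
apply: (measurable_fun_fubini_tonelli_F (m2 := P) (fun z : R * T => (G z.1 z.2 ^+ 2)%:E)).
  by apply/measurable_EFinP; exact: measurable_funX.
by move=> z; rewrite lee_fin sqr_ge0.
Qed.

(** G^2 <= 2 (G - T_N)^2 + 2 T_N^2, and [second_moment_le] bounds the second moment of the partial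
    sum. *)
Lemma energy_le N x : (energy x <=
  2%:E * (\int[P]_w ((G x w - Tpartial a psi f N x w) ^+ 2)%:E) + (majorant f N x)%:E)%E.
Proof.
have mGx : measurable_fun [set: T] (G x) := measurableT_comp mG (pair1_measurable x).
have mTx : measurable_fun [set: T] (Tpartial a psi f N x) :=
  measurableT_comp (mTf N) (pair1_measurable x).
have mGT : measurable_fun [set: T] (fun w => (G x w - Tpartial a psi f N x w) ^+ 2).
  by apply: measurable_funX; exact: measurable_funB.
have mT2 : measurable_fun [set: T] (fun w => Tpartial a psi f N x w ^+ 2).
  exact: measurable_funX.
apply: (@le_trans _ _ (\int[P]_w (2 * (G x w - Tpartial a psi f N x w) ^+ 2
    + 2 * Tpartial a psi f N x w ^+ 2)%:E)%E).
  apply: ge0_le_integral_EFin => //.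
  - exact: measurable_funX.
  - by apply: measurable_funD; exact: measurable_funM.
  - by move=> w; exact: sqr_ge0.
  move=> w _; have := sqr_ge0 (G x w - 2 * Tpartial a psi f N x w); nra.
rewrite ge0_integralD_EFin//; last 4 first.
- exact: measurable_funM.
- exact: measurable_funM.
- by move=> w; apply: mulr_ge0 => //; exact: sqr_ge0.
- by move=> w; apply: mulr_ge0 => //; exact: sqr_ge0.
rewrite ge0_integralZ//; last by move=> w; exact: sqr_ge0.
rewrite ge0_integralZ//; last by move=> w; exact: sqr_ge0.
apply: leeD2l.
have TE w : Tpartial a psi f N x w =
    \sum_(I <- grid N) a I w * (inner f (psiI psi I) * psiI psi I x).
  rewrite /Tpartial /grid /rect big_allpairs.
  by apply: eq_bigr => j _; apply: eq_bigr => k _; rewrite mulrA.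
under eq_integral do rewrite TE.
have H := second_moment_le P nu a indep sga (grid N)
  (fun I => inner f (psiI psi I) * psiI psi I x) (uniq_grid N).
apply: (le_trans (lee_wpmul2l _ H)) => //.
rewrite -EFinM lee_fin /majorant.
under eq_bigr do rewrite normrM.
have -> : \sum_(I <- grid N) var P (a I) * (inner f (psiI psi I) * psiI psi I x) ^+ 2 = fluct f N x.
  by apply: eq_bigr => I _; rewrite -normrM real_normK ?num_real.
by rewrite -/(drift f N x) mulrDr !mulrA -natrM.
Qed.

(** The integrals of the errors h N tend to 0, so their infimum over N integrates to 0 and vanishes
    almost everywhere; at such points [le_add_inf0] applies with the supremum of the majorants. *)
Lemma ae_energy_le :
  {ae mu, forall x, (energy x <= ereal_sup (range (fun N => (majorant f N x)%:E)))%E}.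
Proof.
pose h N x : \bar R := (\int[P]_w ((G x w - Tpartial a psi f N x w) ^+ 2)%:E)%E.
have mh N : measurable_fun [set: R] (h N).
  apply: (measurable_fun_fubini_tonelli_F (m2 := P)
    (fun z : R * T => ((G z.1 z.2 - Tpartial a psi f N z.1 z.2) ^+ 2)%:E)).
    by apply/measurable_EFinP; apply: measurable_funX; exact: measurable_funB.
  by move=> z; rewrite lee_fin sqr_ge0.
have h0 N x : (0 <= h N x)%E by apply: integral_ge0 => w _; rewrite lee_fin sqr_ge0.
pose u x := ereal_inf (range (h^~ x)).
have mu_u : measurable_fun [set: R] u.
  have := measurable_fun_einfs mh 0; congr measurable_fun.
  apply/funext => x; rewrite /u /einfs /=; congr ereal_inf.
  by apply/seteqP; split => _ [n _ <-]; exists n.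
have u0 x : (0 <= u x)%E by apply: le_ereal_inf_tmp => _ [n _ <-]; exact: h0.
have Iu : (\int[mu]_x `|u x| = 0)%E.
  under eq_integral do rewrite gee0_abs//.
  apply/eqP; rewrite eq_le integral_ge0// andbT.
  case: TfG => _ cG; apply: (@cvge_to_ge _ _ _ _ _ _ _ cG); apply: nearW => N.
  apply: ge0_le_integral => //; try (by move=> x _; exact: h0).
  - exact: mh.
  - by move=> x _; apply: ereal_inf_lbound; exists N.
have /= := (ae_eq_integral_abs mu measurableT mu_u).1 Iu.
apply: filterS => x /(_ I) ux; apply: (le_add_inf0 (h^~ x)) ux _ => // N.
apply: (le_trans (energy_le N x)); apply: leeD2l.
by apply: ereal_sup_ubound; exists N.
Qed.

Lemma Lnorm2_energy x : ('N[P]_2%:E[EFin \o G x] = energy x `^ 2^-1)%E.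
Proof.
rewrite unlock /=; congr (_ `^ _)%E; apply: eq_integral => w _ /=.
by rewrite -sqr_powR2.
Qed.

(** Monotone convergence passes the uniform bounds of the majorants to their supremum, which
    dominates the energy almost everywhere. *)
Lemma strong_bound (p K : R) : 1 < p -> 0 <= K -> inLp p f ->
  (forall N, (\int[mu]_x (majorant f N x `^ (p / 2))%:E <= K%:E * \int[mu]_x (`|f x| `^ p)%:E)%E) ->
  ((\int[mu]_x ('N[P]_2%:E[EFin \o G x] `^ p)) `^ p^-1 <= (K `^ p^-1)%:E * 'N[mu]_p%:E[EFin \o f])%E.
Proof.
move=> p1 K0 fp HK; have p0 : 0 < p by exact: lt_trans p1.
have p20 : 0 < p / 2 by rewrite divr_gt0.
pose S x := ereal_sup (range (fun N => (majorant f N x `^ (p / 2))%:E)).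
have nd x : {homo (fun N => (majorant f N x `^ (p / 2))%:E) : n m / (n <= m)%N >-> (n <= m)%E}.
  move=> n m nm; rewrite lee_fin; apply: ler_powR2; first exact: ltW.
    exact: majorant_ge0.
  exact: le_majorant.
have cvgS x : (fun N => (majorant f N x `^ (p / 2))%:E) @ \oo --> S x.
  exact: ereal_nondecreasing_cvgn.
have mM N : measurable_fun [set: R] (fun x => (majorant f N x `^ (p / 2))%:E).
  apply/measurable_EFinP; apply: (measurableT_comp (measurable_powR _)).
  exact: measurable_majorant.
have S0 x : (0 <= S x)%E.
  by apply: (@le_trans _ _ (majorant f 0 x `^ (p / 2))%:E);
    [rewrite lee_fin powR_ge0|apply: ereal_sup_ubound; exists 0].
have mS : measurable_fun [set: R] S.
  have := measurable_fun_esups mM 0; congr measurable_fun.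
  apply/funext => x; rewrite /S /esups /=; congr ereal_sup.
  by apply/seteqP; split => _ [n _ <-]; exists n.
have IS : (\int[mu]_x S x <= K%:E * \int[mu]_x (`|f x| `^ p)%:E)%E.
  have -> : (\int[mu]_x S x = \int[mu]_x limn (fun N => (majorant f N x `^ (p / 2))%:E))%E.
    by apply: eq_integral => x _; apply/esym/cvg_lim => //; exact: cvgS.
  rewrite monotone_convergence//; last by move=> N x _; rewrite lee_fin powR_ge0.
  apply: lime_le; last exact: nearW.
  apply: ereal_nondecreasing_is_cvgn => n m nm; apply: ge0_le_integral => //.
  - by move=> x _; rewrite lee_fin powR_ge0.
  - exact: mM.
  - exact: mM.
  - by move=> x _; exact: nd.
have E x : ('N[P]_2%:E[EFin \o G x] `^ p = energy x `^ (p / 2))%E.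
  by rewrite Lnorm2_energy -poweRrM mulrC.
have I1 : (\int[mu]_x ('N[P]_2%:E[EFin \o G x] `^ p) <= K%:E * \int[mu]_x (`|f x| `^ p)%:E)%E.
  under eq_integral do rewrite E.
  apply: le_trans IS; apply: ae_ge0_le_integral => //.
  - by move=> x _; exact: poweR_ge0.
  - by apply: (measurableT_comp (measurable_poweR _)); exact: measurable_energy.
  have [Z [mZ Z0 subZ]] := ae_energy_le; exists Z; split => // x nx.
  apply: subZ => ex; apply: nx => _; apply: le_sup_powR => //.
    exact: energy_ge0.
  by move=> N; exact: majorant_ge0.
have If0 : (0 <= \int[mu]_x (`|f x| `^ p)%:E)%E.
  by apply: integral_ge0 => x _; rewrite lee_fin powR_ge0.
have i0 : 0 <= p^-1 by rewrite invr_ge0 ltW.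
have := gt0_ler_poweR i0 _ _ I1.
rewrite !in_itv/= !leey !andbT mule_ge0// integral_ge0; last by move=> x _; exact: poweR_ge0.
move=> /(_ isT isT) /le_trans; apply.
by rewrite poweRM//= unlock.
Qed.

(** A strict inequality against a supremum is attained at some N, so up to a null set the level set
    is covered by the increasing sets [B N]; continuity from below keeps their uniform bound. *)
Lemma weak_bound (t : R) : 0 < t -> inLp 1 f ->
  (mu [set x | t%:E < 'N[P]_2%:E[EFin \o G x]] <= (weakK / t)%:E * 'N[mu]_1%:E[EFin \o f])%E.
Proof.
move=> t0 f1; set A := [set x | _].
pose B N := [set x | (t ^+ 2 < majorant f N x)%R].
have mB N : measurable (B N) by apply: measurable_gt; exact: measurable_majorant.
have mBU : measurable (\bigcup_N B N) by exact: bigcup_measurable.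
have ndB : {homo B : n m / (n <= m)%N >-> (n <= m)%O}.
  by move=> n m nm; apply/subsetPset => x /= /lt_le_trans; apply; exact: le_majorant.
have Nf : ('N[mu]_1%:E[EFin \o f] = \int[mu]_x `|f x|%:E)%E by rewrite Lnorm1.
have BU : (mu (\bigcup_N B N) <= (weakK / t)%:E * 'N[mu]_1%:E[EFin \o f])%E.
  have cv := @nondecreasing_cvg_mu _ _ _ mu _ mB mBU ndB.
  apply: (@cvge_to_le _ _ _ _ _ _ _ cv); apply: nearW => N.
  by rewrite Nf; exact: majorant_weak.
have AE : A = [set x | ((t ^+ 2)%:E < energy x)%E].
  apply/seteqP; split => x; rewrite /A /= Lnorm2_energy.
    rewrite !ltNge; apply: contra => ex.
    have := gt0_ler_poweR (_ : 0 <= 2^-1) _ _ ex.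
    rewrite !in_itv/= !leey !andbT energy_ge0 lee_fin sqr_ge0 => /(_ _ isT isT).
    by rewrite -powR_mulrn ?(ltW t0)// -powRrM divff// powRr1 ?(ltW t0)//; apply; rewrite invr_ge0.
  rewrite !ltNge; apply: contra => ex.
  have := gt0_ler_poweR (_ : 0 <= 2) _ _ ex.
  rewrite !in_itv/= !leey !andbT poweR_ge0 lee_fin (ltW t0) -poweRrM mulVf// poweRe1 ?energy_ge0//.
  by rewrite powR_mulrn ?(ltW t0)//; apply.
have mA : measurable A.
  rewrite AE -[X in measurable X]setTI; apply: emeasurable_fun_o_infty => //.
  exact: measurable_energy.
have [Z [mZ Z0 subZ]] := ae_energy_le.
have AZ : A `<=` Z `|` \bigcup_N B N.
  rewrite AE => x /= tx; have [xZ|xZ] := pselect (Z x); [by left|right].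
  have : (energy x <= ereal_sup (range (fun N => (majorant f N x)%:E)))%E.
    by apply: contrapT => nx; apply: xZ; exact: subZ.
  move=> /(lt_le_trans tx) /ereal_sup_gt[_ [N _ <-]]; rewrite lte_fin => tN.
  by exists N.
apply: (@le_trans _ _ (mu (Z `|` \bigcup_N B N))).
  by rewrite le_measure ?inE//; exact: measurableU.
by apply: (le_trans (measureU2 mu mZ mBU)); rewrite [X in (X + _)%E]Z0 add0e.
Qed.

End RandomOperator.

Theorem theorem4p3 (R : realType) (d : measure_display) (Omega : measurableType d)
  (P : probability Omega R) (psi : R -> R) (a : dyadic -> Omega -> R)
  (C eps nu : R) :
  C1 psi -> 0 < C -> 0 < eps ->
  (forall x, `|psi x| + `|derive1 psi x| <= C * (1 + `|x|) `^ (-1 - eps)) ->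
  wavelet_ONB psi ->
  mutually_independent P a ->
  (\esum_(I in [set: dyadic]) ('E_P[(fun w => `|a I w|)%R])%E < +oo)%E ->
  0 < nu ->
  (forall I, sub_gaussian P nu (a I)) ->
  (forall p : R, 1 < p -> exists Cp : R, forall (f : R -> R) (G : R -> Omega -> R),
     inLp 2 f -> inLp p f -> is_Tf P a psi f G ->
     ((\int[@lebesgue_measure R]_x ('N[P]_2%:E[EFin \o G x] `^ p)) `^ p^-1
        <= Cp%:E * 'N[@lebesgue_measure R]_p%:E[EFin \o f])%E) /\
  (exists C' : R, forall (t : R) (f : R -> R) (G : R -> Omega -> R),
     0 < t -> inLp 1 f -> inLp 2 f -> is_Tf P a psi f G ->
     (@lebesgue_measure R [set x | t%:E < 'N[P]_2%:E[EFin \o G x]]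
        <= (C' / t)%:E * 'N[@lebesgue_measure R]_1%:E[EFin \o f])%E).
Proof.
move=> psiC1 C0 eps0 decay [psi_L2 [psi_orth _]] indep Efin nu0 sga.
(* Makes [wt (2 * d')] exactly the assumed decay. *)
pose d' := eps / 2; have d0 : 0 < d' by rewrite divr_gt0.
have wtE x : wt (2 * d') x = (1 + `|x|) `^ (-1 - eps).
  by rewrite /wt /d'; congr (_ `^ _); field.
have psi_decay x : `|psi x| <= C * wt (2 * d') x.
  by rewrite wtE; apply: le_trans (decay x); rewrite lerDl.
have psi'_decay x : `|derive1 psi x| <= C * wt (2 * d') x.
  by rewrite wtE; apply: le_trans (decay x); rewrite lerDr.
pose E := (\esum_(I in [set: dyadic]) ('E_P[(fun w => `|a I w|)%R]))%E.
have E0 : (0 <= E)%E.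
  by apply: esum_ge0 => I _; rewrite expectationE integral_ge0// => w _; rewrite lee_fin.
(* The added 1 makes [L] positive even if all coefficients vanish. *)
pose L := fine E + 1.
have L0 : 0 < L by rewrite ltr_wpDl// fine_ge0.
have sum_mean (s : seq dyadic) : uniq s -> \sum_(I <- s) mean_abs P (a I) <= L.
  move=> us; apply: (@le_trans _ _ (fine E)); last by rewrite lerDl.
  rewrite -lee_fin fineK ?ge0_fin_numE//.
  exact: (sum_mean_abs_le P nu).
split=> [p p1|].
  have [K K0 HK] := majorant_Lp P psi a C d' nu L psiC1 C0 d0 psi_decay psi'_decay psi_L2
    psi_orth indep sga L0 sum_mean p p1.
  exists (K `^ p^-1) => f G f2 fp Tf.
  exact: (strong_bound P psi a nu psiC1 indep sga f G Tf p K p1 K0 fp (fun N => HK f N f2 fp)).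
exists (weakK C d' nu L) => t f G t0 f1 f2 Tf.
by apply: (weak_bound P psi a C d' nu L).
Qed.
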